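(* Let $(X,p)$ be an irreducible complex analytic surface germ (with $p$ not necessarily an isolated singular point) and let $\phi=(f,g):(X,p)\to(\mathbb{C}^2,0)$ be a finite analytic morphism. Let $\nu:(\bar X,\bar p)\to(X,p)$ be the normalization of $(X,p)$, let $\bar R:(\bar Y,E_{\bar Y})\to(\bar X,\bar p)$ be a good resolution of $\phi\circ\nu$, and consider the good resolution $\nu\circ\bar R:(\bar Y,E_{\bar Y})\to(X,p)$ of $\phi$. Let $G(\bar Y)$ be the weighted, partially oriented dual graph associated to $\bar R$ and let $A(\bar Y)$ be the union of all maximal arcs in $G(\bar Y)$. Then, for every connected component of the closure of $G(\bar Y)\setminus A(\bar Y)$, the Hironaka quotients of $\phi$ on the vertices of this connected component are constant (all equal). Moreover, $G(\bar Y)\setminus A(\bar Y)$ does not contain any arrow.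
   Context: Write $\bar f=f\circ\nu$, $\bar g=g\circ\nu$, so that $\phi\circ\nu=(\bar f,\bar g)$ is a finite analytic morphism on the normal surface germ $(\bar X,\bar p)$. A resolution $\bar R:(\bar Y,E_{\bar Y})\to(\bar X,\bar p)$, with exceptional divisor $E_{\bar Y}=\bar R^{-1}(\bar p)$, is a good resolution of $\phi\circ\nu$ if the total transform $E_{\bar Y}^+=((\bar f\bar g)\circ\bar R)^{-1}(0)$ is a normal crossings divisor and the irreducible components of $E_{\bar Y}$ are non-singular. The good resolutions of $\phi$ considered here are the compositions $\nu\circ\bar R$ (they begin with the normalization). A curvetta $c_i$ of an irreducible component $E_i$ of $E_{\bar Y}$ is a smooth curve germ that intersects $E_i$ transversally at a smooth point of the total transform. The Hironaka quotient of $\phi$ on $E_i$ is $q_{E_i}=V_{f\circ\nu\circ\bar R}(c_i)/V_{g\circ\nu\circ\bar R}(c_i)$, where $V_h(c_i)$ denotes the order of $h$ on $c_i$. The weighted dual graph $G(\bar Y)$: to each irreducible component $E_i$ of $E_{\bar Y}$ corresponds a vertex $(i)$ weighted by $q_{E_i}$. When two components of $E_{\bar Y}$ intersect, their vertices are joined by as many edges as there are intersection points. When $k$ irreducible components of the strict transform of $\{\bar f\bar g=0\}$ meet $E_i$, $k$ edges are added to the vertex $(i)$; if such an edge represents the intersection point of $E_i$ with a component of the strict transform of $\{\bar f=0\}$ (resp. $\{\bar g=0\}$), it is endowed with a going-out arrow (resp. a going-in arrow, i.e. a reverse arrow). By convention the Hironaka quotient of a going-in arrow is $0$ and that of a going-out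 arrow is infinite. Partial orientation: let $(e_{ij})$ be an edge representing a point of $E_i\cap E_j$. If $q_{E_i}=q_{E_j}$ the edge is not oriented; if $q_{E_i}<q_{E_j}$ the edge is oriented from $(i)$ to $(j)$ and is said to be positively oriented. Likewise (by the convention on arrows) an edge with a going-in arrow is oriented towards its vertex and an edge with a going-out arrow is oriented away from its vertex. A maximal arc in $G(\bar Y)$ is a subgraph homeomorphic to a segment such that: (1) it begins with a going-in arrow and ends with a going-out arrow; (2) it is a sequence of positively oriented edges; (3) the orientation of the edges induces a compatible positive orientation on the whole segment. Closures and connected components are taken in $G(\bar Y)$ viewed as a topological graph. *)

(* Defs.v *)
From HB Require Import structures.
From mathcomp Require Import all_boot all_order all_algebra.
From mathcomp Require Import complex.
From mathcomp Require Import all_classical all_reals all_analysis.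

Set Implicit Arguments.
Unset Strict Implicit.
Unset Printing Implicit Defensive.

Import Order.TTheory GRing.Theory Num.Theory.
Import numFieldNormedType.Exports.

Local Open Scope classical_set_scope.
Local Open Scope ring_scope.

(* The field R[i], seen as a numClosedFieldType so that it inherits the norm
   topology that MathComp-Analysis puts on every such field. *)
Definition Cx (R : realType) : numClosedFieldType := R[i].

Section ComplexAnalytic.
Context {R : realType}.
Local Notation C := (Cx R).

(* Near a, f is the sum of a power series.  The bound on the coefficients is
   Cauchy's; it makes the series converge absolutely on the polydisc of
   radius r, so that summing over the boxes {alpha | alpha_i < d} is
   immaterial. *)
Definition analytic_at n (f : 'rV[C]_n -> C) (a : 'rV[C]_n) : Prop :=
  exists (c : {ffun 'I_n -> nat} -> C) (r M : C),
    [/\ 0 < r,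
        forall alpha, `|c alpha| * r ^+ (\sum_i alpha i)%N <= M &
        forall x : 'rV[C]_n, (forall i, `|x 0 i - a 0 i| < r) ->
          (fun d : nat => \sum_(alpha : {ffun 'I_n -> 'I_d})
             c [ffun i => val (alpha i)]
             * \prod_i (x 0 i - a 0 i) ^+ val (alpha i)) @ \oo --> f x].

Definition analytic1_at (f : C -> C) (a : C) : Prop :=
  analytic_at (fun x : 'rV[C]_1 => f (x 0 0)) (const_mx a).

Record chart (Y : topologicalType) (n : nat) := Chart {
  dom : set Y;
  coord : Y -> 'rV[C]_n;
  param : 'rV[C]_n -> Y }.

Section Manifold.
Context {Y : topologicalType} {n : nat}.
Implicit Types (c : chart Y n) (A : set (chart Y n)) (y : Y) (Z : set Y).

Definition is_chart c : Prop :=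
  [/\ open (dom c), open (coord c @` dom c),
      {within dom c, continuous (coord c)},
      {within coord c @` dom c, continuous (param c)} &
      forall y, dom c y -> param c (coord c y) = y].

Definition compatible c c' : Prop :=
  forall y, dom c y -> dom c' y ->
    forall j, analytic_at (fun z => coord c' (param c z) 0 j) (coord c y).

Definition complex_manifold A : Prop :=
  [/\ hausdorff_space Y, @second_countable Y,
      forall c, A c -> is_chart c,
      forall y, exists2 c, A c & dom c y &
      forall c c', A c -> A c' -> compatible c c'].

(* c need not belong to A, only to the maximal atlas containing A. *)
Definition coordinates_at A y c : Prop :=
  [/\ is_chart c, dom c y, coord c y = 0 &
      forall c', A c' -> compatible c c' /\ compatible c' c].

Definition holomorphic_at A (h : Y -> C) y : Prop :=
  forall c, A c -> dom c y -> analytic_at (h \o param c) (coord c y).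

Definition analytic_set_at A Z y : Prop :=
  exists (m : nat) (h : 'I_m -> Y -> C),
    (forall k, holomorphic_at A (h k) y) /\
    (\forall z \near y, Z z <-> forall k, h k z = 0).

Definition analytic_subset A Z : Prop := forall y, analytic_set_at A Z y.

Definition irreducible_analytic_subset A Z : Prop :=
  [/\ analytic_subset A Z, Z !=set0 &
      forall Z1 Z2, analytic_subset A Z1 -> analytic_subset A Z2 ->
        Z = Z1 `|` Z2 -> Z = Z1 \/ Z = Z2].

Definition submanifold_at A (d : nat) Z y : Prop :=
  (d <= n)%N /\
  exists2 c, coordinates_at A y c &
    \forall z \near y, Z z <-> forall j : 'I_n, (d <= j)%N -> coord c z 0 j = 0.

(* The irredundant decomposition of Z into irreducible analytic subsets. *)
Definition irreducible_components A Z (I : finType) (E : I -> set Y) : Prop :=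
  [/\ Z = \bigcup_i E i,
      forall i, irreducible_analytic_subset A (E i) &
      forall i j, E i `<=` E j -> i = j].

End Manifold.

Definition std_atlas n : set (chart 'rV[C]_n n) := [set Chart setT id id].

(* Germs at p of analytic subsets of C^N, and of maps between them, are given
   by arbitrary extensions: a set X : set 'rV_N or a function on 'rV_N of which
   only the behaviour near p, on X, is relevant. *)
Section Germs.
Context {N : nat}.
Implicit Types (X Z U : set 'rV[C]_N) (p : 'rV[C]_N).

Definition analytic_germ X p : Prop := X p /\ analytic_set_at (@std_atlas N) X p.

Definition irreducible_germ X p : Prop :=
  analytic_germ X p /\
  forall X1 X2, analytic_set_at (@std_atlas N) X1 p ->
    analytic_set_at (@std_atlas N) X2 p ->
    (\forall z \near p, X z <-> (X1 z \/ X2 z)) ->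
    (\forall z \near p, X z <-> X1 z) \/ (\forall z \near p, X z <-> X2 z).

Definition has_regular_points X p (d : nat) : Prop :=
  forall U, nbhs p U ->
    exists x, [/\ U x, X x & submanifold_at (@std_atlas N) d X x].

Definition germ_dim X p (d : nat) : Prop :=
  has_regular_points X p d /\
  forall d', has_regular_points X p d' -> (d' <= d)%N.

Definition surface_germ X p : Prop := analytic_germ X p /\ germ_dim X p 2.

Definition representative X p U : Prop :=
  [/\ open U, U p & forall x, U x -> analytic_set_at (@std_atlas N) X x].

(* F defines an element of the local ring O_{X,p}. *)
Definition regular_at X (F : 'rV[C]_N -> C) p : Prop :=
  exists2 G, analytic_at G p & \forall z \near p, X z -> F z = G z.

Definition vanishes_at X (F : 'rV[C]_N -> C) p : Prop :=
  \forall z \near p, X z -> F z = 0.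

(* O_{X,p} is integrally closed in its total ring of fractions; a/b is integral
   when a^m + \sum_(k < m) e_k a^k b^(m - k) = 0, b being a non-zero-divisor. *)
Definition normal_germ X p : Prop :=
  analytic_germ X p /\
  forall a b : 'rV[C]_N -> C, regular_at X a p -> regular_at X b p ->
    (forall e, regular_at X e p ->
       vanishes_at X (fun z => b z * e z) p -> vanishes_at X e p) ->
    forall (m : nat) (e : 'I_m -> 'rV[C]_N -> C),
      (forall k, regular_at X (e k) p) ->
      vanishes_at X (fun z => a z ^+ m
        + \sum_(k < m) e k z * a z ^+ k * b z ^+ (m - k)) p ->
    exists2 h, regular_at X h p & vanishes_at X (fun z => a z - h z * b z) p.

End Germs.

Definition analytic_map_at N M (X : set 'rV[C]_N) (F : 'rV[C]_N -> 'rV[C]_M)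
    (x : 'rV[C]_N) : Prop :=
  forall j, regular_at X (fun z => F z 0 j) x.

(* F : X \cap U -> Z \cap V is analytic, proper and has finite fibres. *)
Definition finite_on N M (X : set 'rV[C]_N) (F : 'rV[C]_N -> 'rV[C]_M)
    (Z : set 'rV[C]_M) (U : set 'rV[C]_N) (V : set 'rV[C]_M) : Prop :=
  [/\ forall x, (X `&` U) x -> (Z `&` V) (F x),
      forall x, (X `&` U) x -> analytic_map_at X F x,
      forall K, K `<=` Z `&` V -> compact K ->
        compact (X `&` U `&` F @^-1` K) &
      forall w, finite_set (X `&` U `&` F @^-1` [set w])].

Definition finite_morphism N M (X : set 'rV[C]_N) (p : 'rV[C]_N)
    (F : 'rV[C]_N -> 'rV[C]_M) (Z : set 'rV[C]_M) (q : 'rV[C]_M) : Prop :=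
  F p = q /\
  exists U V, [/\ representative X p U, representative Z q V &
                  finite_on X F Z U V].

Definition biholomorphic N M (A : set 'rV[C]_N) (B : set 'rV[C]_M)
    (F : 'rV[C]_N -> 'rV[C]_M) : Prop :=
  exists G : 'rV[C]_M -> 'rV[C]_N,
    (forall x, A x -> [/\ B (F x), G (F x) = x & analytic_map_at A F x]) /\
    (forall w, B w -> [/\ A (G w), F (G w) = w & analytic_map_at B G w]).

(* nu is finite, its source is normal, and it is biholomorphic over the
   complement of a nowhere dense analytic subset S of X whose preimage is
   nowhere dense. *)
Definition normalization N M (Xb : set 'rV[C]_M) (pb : 'rV[C]_M)
    (nu : 'rV[C]_M -> 'rV[C]_N) (X : set 'rV[C]_N) (p : 'rV[C]_N) : Prop :=
  [/\ normal_germ Xb pb, nu pb = p &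
    exists U V S,
      [/\ representative Xb pb U, representative X p V,
          forall x, V x -> analytic_set_at (@std_atlas N) S x,
          finite_on Xb nu X U V &
          [/\ X `&` V `<=` closure ((X `&` V) `\` S),
              Xb `&` U `<=` closure ((Xb `&` U) `\` nu @^-1` S) &
              biholomorphic ((Xb `&` U) `\` nu @^-1` S) ((X `&` V) `\` S) nu]]].

Definition exceptional M (Y : Type) (Rb : Y -> 'rV[C]_M) (pb : 'rV[C]_M)
  : set Y := Rb @^-1` [set pb].

(* Rb is a proper analytic map from the complex surface Y onto a representative
   of (Xb, pb), biholomorphic outside the exceptional set, G being the
   inverse. *)
Definition resolution M (Y : topologicalType) (A : set (chart Y 2))
    (Rb : Y -> 'rV[C]_M) (Xb : set 'rV[C]_M) (pb : 'rV[C]_M) : Prop :=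
  exists (W : set 'rV[C]_M) (G : 'rV[C]_M -> Y),
    let Xreg := (Xb `&` W) `\ pb in
    [/\ representative Xb pb W /\ Rb @` setT = Xb `&` W,
        forall y j, holomorphic_at A (fun z => Rb z 0 j) y,
        forall K, K `<=` Xb `&` W -> compact K -> compact (Rb @^-1` K),
        dense (~` exceptional Rb pb) &
        [/\ forall y, ~ exceptional Rb pb y -> G (Rb y) = y,
            forall x, Xreg x -> Rb (G x) = x,
            {within Xreg, continuous G} &
            forall x c, Xreg x -> A c -> dom c (G x) ->
              analytic_map_at Xreg (fun w => coord c (G w)) x]].

Section Surface.
Context {Y : topologicalType}.
Implicit Types (A : set (chart Y 2)) (T Exc : set Y) (y : Y).

Definition normal_crossings_at A T y : Prop :=
  exists2 c, coordinates_at A y c &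
    (\forall z \near y, T z <-> coord c z 0 0 = 0) \/
    (\forall z \near y, T z <-> (coord c z 0 0 = 0 \/ coord c z 0 1 = 0)).

(* The components E are smooth curves (in particular the exceptional set is not
   reduced to a point), and the total transform, as a germ along the
   exceptional set, has normal crossings. *)
Definition good_resolution M A (Rb : Y -> 'rV[C]_M) (Xb : set 'rV[C]_M)
    (pb : 'rV[C]_M) (fb gb : 'rV[C]_M -> C) (I : finType) (E : I -> set Y)
  : Prop :=
  [/\ resolution A Rb Xb pb,
      irreducible_components A (exceptional Rb pb) E,
      forall i y, E i y -> submanifold_at A 1 (E i) y &
      forall y, exceptional Rb pb y ->
        normal_crossings_at A [set z | fb (Rb z) * gb (Rb z) = 0] y].

(* A parametrized smooth curve germ, transversal to Ei at a smooth point of the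
   total transform T: in suitable coordinates (u, v), both T and Ei are
   {u = 0}, and du does not vanish on the velocity of the curve. *)
Definition curvetta A T (Ei : set Y) (gam : C -> Y) : Prop :=
  exists2 c, coordinates_at A (gam 0) c &
    [/\ \forall z \near gam 0, T z <-> coord c z 0 0 = 0,
        \forall z \near gam 0, Ei z <-> coord c z 0 0 = 0,
        {for 0, continuous gam},
        forall j, analytic1_at (fun t => coord c (gam t) 0 j) 0 &
        derive1 (fun t => coord c (gam t) 0 0) 0 != 0].

(* V_h(c), with the dummy value 0 when h vanishes identically on the curve. *)
Definition order_on (h : Y -> C) (gam : C -> Y) : nat :=
  xget 0%N [set m | exists u : C -> C,
    [/\ analytic1_at u 0, u 0 != 0 &
        \forall t \near (0 : C), h (gam t) = t ^+ m * u t]].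

Definition strict_transform Exc (h : Y -> C) : set Y :=
  closure ([set z | h z = 0] `\` Exc).

End Surface.

End ComplexAnalytic.

(* Edges and arrows are named by the points of the surface they represent:
   joins i j y says that y is an edge between i and j, in_arrow i y and
   out_arrow i y that y is an arrow attached to i. *)
Record dual_graph := DualGraph {
  vertex : finType;
  node : Type;
  joins : vertex -> vertex -> node -> Prop;
  in_arrow : vertex -> node -> Prop;
  out_arrow : vertex -> node -> Prop;
  quotient_of : vertex -> rat }.

Section TopologicalGraph.
Variables (R : realType) (G : dual_graph).

Local Notation ambient := {ptws (vertex G + node G)%type -> R}.

Definition basis_point (s : vertex G + node G) : ambient :=
  fun s' => (`[< s' = s >])%:R.

Definition vertex_point (i : vertex G) : ambient := basis_point (inl i).

Definition half_edge (i : vertex G) (y : node G) : set ambient :=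
  [set x | exists2 t : R, 0 <= t <= 1 &
     x = fun s => (1 - t) * basis_point (inl i) s + t * basis_point (inr y) s].

Definition incident (i : vertex G) (y : node G) : Prop :=
  [\/ exists j, joins i j y, in_arrow i y | out_arrow i y].

(* The topological graph, realized with every edge subdivided at its middle:
   an edge y between i and j is half_edge i y followed by half_edge j y, and an
   arrow y attached to i is half_edge i y. *)
Definition topological_graph : set ambient :=
  [set vertex_point i | i in setT] `|`
  \bigcup_(iy in [set iy | incident iy.1 iy.2]) half_edge iy.1 iy.2.

Definition positively_oriented (i j : vertex G) (y : node G) : Prop :=
  joins i j y /\ quotient_of i < quotient_of j.

(* The arc (e 0) - v 0 - (e 1) - v 1 - ... - v k - (e (k + 1)), oriented from
   left to right; the injectivity conditions make it a topological segment. *)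
Definition maximal_arc (k : nat) (v : nat -> vertex G) (e : nat -> node G)
  : Prop :=
  [/\ forall l l', (l <= k)%N -> (l' <= k)%N -> v l = v l' -> l = l',
      forall l l', (l <= k.+1)%N -> (l' <= k.+1)%N -> e l = e l' -> l = l',
      in_arrow (v 0%N) (e 0%N),
      forall l, (l < k)%N -> positively_oriented (v l) (v l.+1) (e l.+1) &
      out_arrow (v k) (e k.+1)].

Definition arc_points (k : nat) (v : nat -> vertex G) (e : nat -> node G)
  : set ambient :=
  \bigcup_(l in [set l | (l <= k)%N])
     (half_edge (v l) (e l) `|` half_edge (v l) (e l.+1)).

Definition union_of_arcs : set ambient :=
  [set x | exists k v e, maximal_arc k v e /\ arc_points k v e x].

End TopologicalGraph.

Arguments topological_graph R G : clear implicits.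
Arguments union_of_arcs R G : clear implicits.
Arguments vertex_point R {G} i.
Arguments half_edge R {G} i y.

(* F and H are the lifts of f and g to Y.  By normal crossings, at most two
   branches of the total transform pass through a point, so a point of E i
   carries at most one edge, or one component of a strict transform. *)
Definition resolution_graph (R : realType) (Y : topologicalType)
    (Exc : set Y) (I : finType) (E : I -> set Y) (F H : Y -> Cx R)
    (c : I -> Cx R -> Y) : dual_graph :=
  {| vertex := I;
     node := Y;
     joins := fun i j y => [/\ i <> j, E i y & E j y];
     in_arrow := fun i y => E i y /\ strict_transform Exc H y;
     out_arrow := fun i y => E i y /\ strict_transform Exc F y;
     quotient_of := fun i =>
       (order_on F (c i))%:R / (order_on H (c i))%:R |}.

Definition pair_map (R : realType) N (f g : 'rV[Cx R]_N -> Cx R)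
    (x : 'rV[Cx R]_N) : 'rV[Cx R]_2 :=
  \row_j (if j == 0 then f x else g x).

(* Main.v *)
Require Import Defs.
From HB Require Import structures.
From mathcomp Require Import all_boot all_order all_algebra.
From mathcomp Require Import complex.
From mathcomp Require Import all_classical all_reals all_analysis.
From mathcomp Require Import ring lra zify.
Import Order.TTheory GRing.Theory Num.Theory.
Import numFieldNormedType.Exports.
Local Open Scope classical_set_scope.
Local Open Scope ring_scope.
Set Implicit Arguments.
Unset Strict Implicit.
Unset Printing Implicit Defensive.

(** The quotients attached to the vertices satisfy a discrete maximum
    principle, and the theorem is a statement about finite graphs with that
    property.

    Let F and H be the lifts of f and g to the resolution, and let al and be be
    the orders of F and H along a component E_i of the exceptional curve, so
    that q_i = al / be.  The meromorphic function F^be / H^al has neither a zero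
    nor a pole along E_i, so it restricts to a nonzero meromorphic function on
    the compact connected curve E_i.  In coordinates (u, v) at a point of E_i
    in which E_i is {u = 0} and the total transform lies in {uv = 0}, one has
    F = u^a v^p U and H = u^b v^q V with units U and V ([normal_form]), and the
    restriction has order p * be - q * al there.  This order is positive exactly
    when the point lies on a component of larger quotient or carries a going-out
    arrow, and negative exactly when it lies on a component of smaller quotient
    or carries a going-in arrow ([local_directions]).  A meromorphic function
    on a compact connected curve that has a zero has a pole: this is the
    maximum principle ([no_pole_no_zero]), applied to F^be / H^al and to its
    inverse.  Hence a vertex has an edge or arrow going up if and only if it has
    one going down ([up_iff_down]).

    In a finite graph with this property every oriented edge and every arrow
    extends in both directions until an arrow is met, quotients increasing
    strictly along the way, and so lies on a maximal arc.  What is left outside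
    the arcs are vertices and unoriented edges; the quotient, extended to be
    constant along the latter, is a locally constant function on the closure
    ([balanced_graph_quotients]).

    The complex analysis rests on one device.  A function is analytic near a
    point if and only if it is a uniform limit of polynomials on a polydisc
    around it; the condition on the right ([holo]) is evidently stable under
    ring operations, composition and change of centre.  In one variable the
    coefficients are recovered by averaging over roots of unity
    ([poly_coef_le]), which gives power series, orders of vanishing and the
    maximum modulus principle.  The normal form in two variables follows from
    division by a coordinate and an argument of Hurwitz type. *)

(** * The modulus of a complex number, as a real number *)

Section Modulus.
Context {R : realType}.
Local Notation C := (Cx R).
Implicit Types z w : C.

(** The norm of [Cx R] takes values in [Cx R], which is only partially ordered;
    estimates are made with this real-valued modulus instead. *)
Definition modulus (z : C) : R := ComplexField.Normc.normc z.
Definition ofR (x : R) : C := (x%:C)%C.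

Local Notation N := modulus.

Lemma normC_modulus z : `|z| = ofR (N z).
Proof. by case: z. Qed.

Lemma ofR_le x y : (ofR x <= ofR y) = (x <= y).
Proof. exact: lecR. Qed.
Lemma ofR_lt x y : (ofR x < ofR y) = (x < y).
Proof. exact: ltcR. Qed.
Lemma ofR_gt0 (r : C) : 0 < r -> exists2 x : R, 0 < x & r = ofR x.
Proof.
case: r => a b; rewrite ltcE /= => /andP[/eqP -> a0].
by exists a.
Qed.
Lemma ofRM x y : ofR (x * y) = ofR x * ofR y.
Proof. exact: rmorphM. Qed.
Lemma ofRD x y : ofR (x + y) = ofR x + ofR y.
Proof. exact: rmorphD. Qed.
Lemma ofRX x n : ofR (x ^+ n) = ofR x ^+ n.
Proof. exact: rmorphXn. Qed.

Lemma modulus0 : N 0 = 0. Proof. exact: ComplexField.Normc.normc0. Qed.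
Lemma modulus1 : N 1 = 1. Proof. exact: ComplexField.Normc.normc1. Qed.
Lemma modulus_ge0 z : 0 <= N z. Proof. by rewrite -ofR_le -normC_modulus normr_ge0. Qed.
Lemma modulus_eq0 z : (N z == 0) = (z == 0).
Proof. by rewrite -(inj_eq (@complexI R)) -[(N z)%:C%C]/(ofR _) -normC_modulus normr_eq0. Qed.
Lemma modulus_gt0 z : (0 < N z) = (z != 0).
Proof. by rewrite lt_neqAle modulus_ge0 andbT eq_sym modulus_eq0. Qed.
Lemma modulusM z w : N (z * w) = N z * N w.
Proof. exact: ComplexField.Normc.normcM. Qed.
Lemma modulusX z n : N (z ^+ n) = N z ^+ n.
Proof. by elim: n => [|n IH]; rewrite ?expr0 ?modulus1// !exprS modulusM IH. Qed.
Lemma modulusV z : N z^-1 = (N z)^-1.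
Proof. exact: ComplexField.Normc.normcV. Qed.
Lemma modulusN z : N (- z) = N z.
Proof. exact: normcN. Qed.
Lemma modulusD z w : N (z + w) <= N z + N w.
Proof. exact: le_normcD. Qed.
Lemma modulusB z w : N (z - w) <= N z + N w.
Proof. by rewrite (le_trans (modulusD _ _))// modulusN. Qed.
Lemma modulusBC z w : N (z - w) = N (w - z).
Proof. by rewrite -modulusN opprB. Qed.
Lemma modulus_ofR x : N (ofR x) = `|x|.
Proof. by rewrite /N /= expr0n addr0 sqrtr_sqr. Qed.
Lemma modulus_nat n : N (n%:R) = n%:R.
Proof.
have -> : n%:R = ofR n%:R by rewrite /ofR rmorph_nat.
by rewrite modulus_ofR ger0_norm.
Qed.
Lemma modulus_sum I (r : seq I) P (F : I -> C) :
  N (\sum_(i <- r | P i) F i) <= \sum_(i <- r | P i) N (F i).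
Proof.
elim/big_ind2 : _ => [|x a y b xa yb|//]; first by rewrite modulus0.
by rewrite (le_trans (modulusD _ _)) ?lerD.
Qed.
Lemma modulus_prod I (r : seq I) P (F : I -> C) :
  N (\prod_(i <- r | P i) F i) = \prod_(i <- r | P i) N (F i).
Proof. exact: (big_morph N modulusM modulus1). Qed.

Lemma nearC_ball (a : C) (P : C -> Prop) :
  (\forall z \near a, P z) <-> exists2 r, 0 < r & forall z, N (z - a) < r -> P z.
Proof.
split.
  case/nbhs_ballP => e /ofR_gt0[r r0 ->] sub; exists r => // z zr.
  by apply: sub; rewrite /ball /= distrC normC_modulus ofR_lt.
case=> r r0 sub; apply/nbhs_ballP; exists (ofR r); first by rewrite /= ofR_lt.
by move=> z; rewrite /ball /= distrC normC_modulus ofR_lt => /sub.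
Qed.

Lemma near_row_ball n (a : 'rV[C]_n) (P : 'rV[C]_n -> Prop) :
  (\forall x \near a, P x) <->
  exists2 r, 0 < r & forall x : 'rV[C]_n, (forall i, N (x 0 i - a 0 i) < r) -> P x.
Proof.
split.
  case/nbhs_ballP => e /ofR_gt0[r r0 ->] sub; exists r => // x xr.
  apply: sub; rewrite /ball /= /mx_ball; split; first by rewrite ofR_lt.
  by move=> i j; rewrite (ord1 i) /ball /= distrC normC_modulus ofR_lt.
case=> r r0 sub; apply/nbhs_ballP; exists (ofR r); first by rewrite /= ofR_lt.
move=> x; rewrite /ball /= /mx_ball => -[_ H]; apply: sub => i.
by have := H 0 i; rewrite /ball /= distrC normC_modulus ofR_lt.
Qed.

Lemma cvg_modulusP T (F : set_system T) (FF : Filter F) (f : T -> C) (l : C) :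
  f @ F --> l <-> forall e, 0 < e -> \forall t \near F, N (f t - l) < e.
Proof.
split=> [fl e e0|H].
  by apply: (fl [set z | N (z - l) < e]); apply/nearC_ball; exists e.
move=> P /nearC_ball[r r0 sub]; rewrite /nbhs /=.
by apply: filterS (H r r0) => t; apply: sub.
Qed.

Lemma modulus_le_ReIm (x y : R) : N (x +i* y)%C <= `|x| + `|y|.
Proof.
have -> : (x +i* y)%C = ofR x + 'i%C * ofR y by rewrite [LHS]complexE.
rewrite (le_trans (modulusD _ _))// modulusM !modulus_ofR.
have -> : N 'i%C = 1 by rewrite /N /= expr0n /= expr1n add0r sqrtr1.
by rewrite mul1r.
Qed.

Lemma Re_le_modulus z : `|complex.Re z| <= N z.
Proof. by rewrite -ofR_le -normC_modulus; exact: normc_ge_Re. Qed.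

Lemma Im_le_modulus z : `|complex.Im z| <= N z.
Proof.
have := Re_le_modulus (z * - 'i%C); rewrite mulrN raddfN /= ReiNIm opprK modulusN modulusM.
have -> : N 'i%C = 1 by rewrite /N /= expr0n /= expr1n add0r sqrtr1.
by rewrite mulr1.
Qed.

(** The disc is a closed subset of the image of a square of the real plane. *)
Lemma compact_disc (r : R) : compact [set z : C | N z <= r].
Proof.
pose f (p : R * R) : C := (p.1 +i* p.2)%C.
have cf : continuous f.
  move=> p; apply/cvg_modulusP => e e0.
  have e2 : 0 < e / 2 by lra.
  have h1 : \forall q \near p, `|q.1 - p.1| < e / 2.
    have /cvgrPdistC_lt h : (fun q : R * R => q.1) q @[q --> p] --> p.1 by exact: cvg_fst.
    exact: h.
  have h2 : \forall q \near p, `|q.2 - p.2| < e / 2.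
    have /cvgrPdistC_lt h : (fun q : R * R => q.2) q @[q --> p] --> p.2 by exact: cvg_snd.
    exact: h.
  near=> q.
  have -> : f q - f p = ((q.1 - p.1) +i* (q.2 - p.2))%C by [].
  apply: le_lt_trans (modulus_le_ReIm _ _) _.
  rewrite [X in _ < X](splitr e) ltrD//; near: q; [exact: h1|exact: h2].
have /(subclosed_compact _) : compact (f @` (`[- r, r] `*` `[- r, r])).
  apply: continuous_compact; first exact: continuous_subspaceT.
  by apply: compact_setX; exact: segment_compact.
apply.
  move=> z zcl; rewrite /= leNgt; apply/negP => rz.
  have /zcl[w [/= wr zw]] : \forall w \near z, N (w - z) < N z - r.
    by apply/nearC_ball; exists (N z - r); rewrite ?subr_gt0.
  have := modulusD (z - w) w; rewrite subrK modulusBC => zle.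
  by move: zw wr zle; lra.
move=> z /= zr; exists (complex.Re z, complex.Im z); last by rewrite /f /=; case: z zr.
have := Re_le_modulus z; have := Im_le_modulus z.
rewrite !ler_norml => /andP[a b] /andP[c d].
by split; rewrite /= in_itv /=; apply/andP; split; lra.
Unshelve. all: by end_near.
Qed.

(** Completeness of C, from that of R applied to real and imaginary parts. *)
Lemma complete_C (u : nat -> C) :
  (forall e, 0 < e -> exists n, forall p q, (n <= p)%N -> (n <= q)%N ->
     N (u p - u q) <= e) ->
  exists l, forall e, 0 < e -> exists n, forall p, (n <= p)%N -> N (u p - l) <= e.
Proof.
move=> cu.
have cvgR (h : C -> R) : (forall z w, `|h z - h w| <= N (z - w)) ->
    exists l : R, forall e, 0 < e -> exists n, forall p, (n <= p)%N -> `|h (u p) - l| <= e.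
  move=> hN.
  have : cvg ((h \o u) n @[n --> \oo]).
    apply: cauchy_cvg; apply/cauchyP => e e0.
    have [|n Hn] := cu (e / 2); first by lra.
    exists (h (u n)); exists n => // p /= np.
    rewrite /ball /= (le_lt_trans (hN _ _))// (le_lt_trans (Hn _ _ _ _))//; lra.
  move=> cv; exists (lim ((h \o u) n @[n --> \oo])) => e e0.
  have /cvgrPdistC_lt/(_ e e0) [n _ Hn] := cv.
  by exists n => p np; rewrite ltW// Hn.
have [a Ha] := cvgR (@complex.Re R) (fun z w => eq_ind _ (fun x => `|x| <= _) (Re_le_modulus (z - w)) _ (raddfB _ _ _)).
have [b Hb] := cvgR (@complex.Im R) (fun z w => eq_ind _ (fun x => `|x| <= _) (Im_le_modulus (z - w)) _ (raddfB _ _ _)).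
exists (a +i* b)%C => e e0; have e2 : 0 < e / 2 by lra.
have [n1 H1] := Ha _ e2; have [n2 H2] := Hb _ e2.
exists (maxn n1 n2) => p; rewrite geq_max => /andP[p1 p2].
have -> : u p - (a +i* b)%C = ((complex.Re (u p) - a) +i* (complex.Im (u p) - b))%C.
  by case: (u p).
by rewrite (le_trans (modulus_le_ReIm _ _))// (splitr e) lerD// ?H1 ?H2.
Qed.

End Modulus.

Arguments modulus {R} z : simpl never.
Arguments ofR {R} x : simpl never.

(** * Local uniform limits of polynomials *)

Section Approx.
Context {R : realType}.
Local Notation C := (Cx R).
Local Notation N := modulus.

Definition polydisc n (a : 'rV[C]_n) (r : R) : set 'rV[C]_n :=
  [set x | forall i, N (x 0 i - a 0 i) <= r].

Lemma cvg_rowC_modulusP n (f : 'rV[C]_n -> C) (a : 'rV[C]_n) (l : C) :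
  f x @[x --> a] --> l <-> forall e, 0 < e -> \forall x \near a, N (f x - l) < e.
Proof. exact: (@cvg_modulusP _ _ (nbhs a) (nbhs_filter a)). Qed.

Lemma cvgC_modulusP (f : C -> C) (a l : C) :
  f x @[x --> a] --> l <-> forall e, 0 < e -> \forall x \near a, N (f x - l) < e.
Proof. exact: (@cvg_modulusP _ _ (nbhs a) (nbhs_filter a)). Qed.

Lemma polydisc_le n (a : 'rV[C]_n) r s : r <= s -> polydisc a r `<=` polydisc a s.
Proof. by move=> rs x xr i; exact: le_trans (xr i) rs. Qed.

Lemma polydisc_center n (a : 'rV[C]_n) r : 0 <= r -> polydisc a r a.
Proof. by move=> r0 i; rewrite subrr modulus0. Qed.

Lemma near_polydisc n (a : 'rV[C]_n) r : 0 < r -> \forall x \near a, polydisc a r x.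
Proof. by move=> r0; apply/near_row_ball; exists r => // x xr i; exact: ltW. Qed.

Lemma near_row_polydisc n (a : 'rV[C]_n) (P : 'rV[C]_n -> Prop) :
  (\forall x \near a, P x) <-> exists2 r, 0 < r & forall x, polydisc a r x -> P x.
Proof.
split=> [/near_row_ball[r r0 sub]|[r r0 sub]].
  exists (r / 2); first by lra.
  by move=> x xr; apply: sub => i; apply: le_lt_trans (xr i) _; lra.
by apply: filterS (near_polydisc a r0).
Qed.

(** Polynomial functions, with no preferred centre, so that approximation by
    them is insensitive to a change of centre. *)
Inductive polyfun n : ('rV[C]_n -> C) -> Prop :=
| polyfun_const (c : C) : polyfun (fun=> c)
| polyfun_coord i : polyfun (fun x => x 0 i)
| polyfunD p q : polyfun p -> polyfun q -> polyfun (fun x => p x + q x)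
| polyfunM p q : polyfun p -> polyfun q -> polyfun (fun x => p x * q x).

Lemma polyfun_sum n I (r : seq I) (P : pred I) (F : I -> 'rV[C]_n -> C) :
  (forall i, polyfun (F i)) -> polyfun (fun x => \sum_(i <- r | P i) F i x).
Proof.
move=> HF; elim: r => [|i r IH].
  under eq_fun do rewrite big_nil; exact: polyfun_const.
under eq_fun do rewrite big_cons.
by case: (P i) => //; exact: polyfunD.
Qed.

Lemma polyfun_prod n I (r : seq I) (P : pred I) (F : I -> 'rV[C]_n -> C) :
  (forall i, polyfun (F i)) -> polyfun (fun x => \prod_(i <- r | P i) F i x).
Proof.
move=> HF; elim: r => [|i r IH].
  under eq_fun do rewrite big_nil; exact: polyfun_const.
under eq_fun do rewrite big_cons.
by case: (P i) => //; exact: polyfunM.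
Qed.

Lemma polyfunX n (p : 'rV[C]_n -> C) k : polyfun p -> polyfun (fun x => p x ^+ k).
Proof.
move=> pp; elim: k => [|k IH]; first by under eq_fun do rewrite expr0; exact: polyfun_const.
by under eq_fun do rewrite exprS; exact: polyfunM.
Qed.

Lemma polyfun_comp m n (p : 'rV[C]_m -> C) (g : 'I_m -> 'rV[C]_n -> C) :
  polyfun p -> (forall j, polyfun (g j)) -> polyfun (fun x => p (\row_j g j x)).
Proof.
move=> pp gp; elim: pp => [c|i|p1 p2 _ H1 _ H2|p1 p2 _ H1 _ H2].
- exact: polyfun_const.
- by have -> : (fun x => (\row_j g j x) 0 i) = g i by apply/funext => x; rewrite mxE.
- exact: polyfunD.
- exact: polyfunM.
Qed.

Lemma polyfun_continuous n (p : 'rV[C]_n -> C) : polyfun p ->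
  forall a, p x @[x --> a] --> p a.
Proof.
elim => [c|i|p1 p2 _ H1 _ H2|p1 p2 _ H1 _ H2] a.
- exact: (@cvg_cst _ c _ (nbhs a) (nbhs_filter a)).
- exact: coord_continuous.
- exact: (@cvgD _ _ _ (nbhs a) (nbhs_filter a) p1 p2 _ _ (H1 a) (H2 a)).
- exact: (@cvgM _ _ (nbhs a) (nbhs_filter a) p1 p2 _ _ (H1 a) (H2 a)).
Qed.

Lemma polyfun_bounded n (p : 'rV[C]_n -> C) (a : 'rV[C]_n) r : polyfun p ->
  exists2 B, 0 < B & forall x, polydisc a r x -> N (p x) <= B.
Proof.
elim => [c|i|p1 p2 _ [B1 B10 H1] _ [B2 B20 H2]|p1 p2 _ [B1 B10 H1] _ [B2 B20 H2]].
- by exists (N c + 1) => [|x _]; rewrite ?ltr_wpDl ?modulus_ge0// lerDl.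
- exists (`|r| + N (a 0 i) + 1) => [|x xr]; first by rewrite ltr_wpDl ?addr_ge0 ?modulus_ge0.
  have := modulusD (x 0 i - a 0 i) (a 0 i); rewrite subrK.
  have := xr i; have := ler_norm r; lra.
- exists (B1 + B2) => [|x xr]; first exact: addr_gt0.
  by rewrite (le_trans (modulusD _ _))// lerD ?H1 ?H2.
- exists (B1 * B2) => [|x xr]; first exact: mulr_gt0.
  by rewrite modulusM ler_pM ?modulus_ge0 ?H1 ?H2.
Qed.

Definition poly_approx n (D : set 'rV[C]_n) (f : 'rV[C]_n -> C) : Prop :=
  forall e, 0 < e -> exists2 p, polyfun p & forall x, D x -> N (f x - p x) <= e.

Lemma approx_sub n (D D' : set 'rV[C]_n) f : D' `<=` D -> poly_approx D f -> poly_approx D' f.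
Proof. by move=> sub H e /H[p pp pH]; exists p => // x /sub /pH. Qed.

Lemma approx_eq n (D : set 'rV[C]_n) f g : (forall x, D x -> f x = g x) ->
  poly_approx D f -> poly_approx D g.
Proof. by move=> fg H e /H[p pp pH]; exists p => // x Dx; rewrite -fg// pH. Qed.

Lemma approx_polyfun n (D : set 'rV[C]_n) p : polyfun p -> poly_approx D p.
Proof. by move=> pp e e0; exists p => // x _; rewrite subrr modulus0 ltW. Qed.

(** A uniform limit of uniform limits of polynomials is one. *)
Lemma approx_approx n (D : set 'rV[C]_n) f :
  (forall e, 0 < e -> exists2 g, poly_approx D g & forall x, D x -> N (f x - g x) <= e) ->
  poly_approx D f.
Proof.
move=> H e e0; have e2 : 0 < e / 2 by lra.
have [g gD fg] := H _ e2; have [p pp gp] := gD _ e2.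
exists p => // x Dx; rewrite (splitr e) -(subrK (g x) (f x)) -addrA.
by rewrite (le_trans (modulusD _ _))// lerD ?fg ?gp.
Qed.

Section OnDisc.
Variables (n : nat) (a : 'rV[C]_n) (r : R).
Local Notation D := (polydisc a r).

Lemma approx_bounded f : poly_approx D f ->
  exists2 B, 0 < B & forall x, D x -> N (f x) <= B.
Proof.
move=> /(_ 1 ltr01)[p pp fp]; have [B B0 HB] := polyfun_bounded a r pp.
exists (1 + B) => [|x Dx]; first by lra.
by rewrite -(subrK (p x) (f x)) (le_trans (modulusD _ _))// lerD ?fp ?HB.
Qed.

Lemma approxD f g : poly_approx D f -> poly_approx D g -> poly_approx D (fun x => f x + g x).
Proof.
move=> Hf Hg e e0; have e2 : 0 < e / 2 by lra.
have [p pp fp] := Hf _ e2; have [q qp gq] := Hg _ e2.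
exists (fun x => p x + q x) => [|x Dx]; first exact: polyfunD.
by rewrite opprD addrACA (splitr e) (le_trans (modulusD _ _))// lerD ?fp ?gq.
Qed.

Lemma approxM f g : poly_approx D f -> poly_approx D g -> poly_approx D (fun x => f x * g x).
Proof.
move=> Hf Hg; have [B B0 HB] := approx_bounded Hg.
apply: approx_approx => e e0.
have [p pp fp] := Hf (e / B) (divr_gt0 e0 B0).
exists (fun x => p x * g x); last first.
  by move=> x Dx; rewrite -mulrBl modulusM -(divfK (lt0r_neq0 B0) e) ler_pM ?modulus_ge0 ?fp ?HB.
have [B' B'0 HB'] := polyfun_bounded a r pp.
move=> e' e'0; have [q qp gq] := Hg (e' / B') (divr_gt0 e'0 B'0).
exists (fun x => p x * q x) => [|x Dx]; first exact: polyfunM.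
by rewrite -mulrBr modulusM mulrC -(divfK (lt0r_neq0 B'0) e') ler_pM ?modulus_ge0 ?gq ?HB'.
Qed.

Lemma approx_polycomp m (p : 'rV[C]_m -> C) (g : 'I_m -> 'rV[C]_n -> C) :
  polyfun p -> (forall j, poly_approx D (g j)) -> poly_approx D (fun x => p (\row_j g j x)).
Proof.
move=> pp gp; elim: pp => [c|i|p1 p2 _ H1 _ H2|p1 p2 _ H1 _ H2].
- exact/approx_polyfun/polyfun_const.
- by have -> : (fun x => (\row_j g j x) 0 i) = g i by apply/funext => x; rewrite mxE.
- exact: approxD.
- exact: approxM.
Qed.

End OnDisc.

(** Equivalent to analyticity at [a].  One implication is [analytic_holo]; the
    other one is only needed in one variable, where it is [holo1_analytic]. *)
Definition holo n (f : 'rV[C]_n -> C) (a : 'rV[C]_n) : Prop :=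
  exists2 r, 0 < r & poly_approx (polydisc a r) f.

Lemma holo_eq n (f g : 'rV[C]_n -> C) a : (\forall x \near a, f x = g x) ->
  holo f a -> holo g a.
Proof.
move=> /near_row_polydisc[s s0 fg] [r r0 fa]; exists (Num.min r s); first by rewrite lt_min r0.
apply: (@approx_eq _ _ f).
  by move=> x xr; apply: fg; apply: polydisc_le xr; rewrite ge_min lexx orbT.
by apply: approx_sub fa; apply: polydisc_le; rewrite ge_min lexx.
Qed.

Lemma holo_near n (f : 'rV[C]_n -> C) a : holo f a -> \forall x \near a, holo f x.
Proof.
move=> [r r0 fa]; have r2 : 0 < r / 2 by lra.
apply/near_row_polydisc; exists (r / 2) => // x xr; exists (r / 2) => //.
apply: approx_sub fa => y yr i.
rewrite -(subrK (x 0 i) (y 0 i)) -addrA (splitr r) (le_trans (modulusD _ _))// lerD//.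
Qed.

Lemma holo_continuous n (f : 'rV[C]_n -> C) a : holo f a -> f x @[x --> a] --> f a.
Proof.
move=> [r r0 fa]; apply/cvg_rowC_modulusP => e e0; have e3 : 0 < e / 3 by lra.
have [p pp fp] := fa _ e3.
have /cvg_rowC_modulusP/(_ _ e3) pc := @polyfun_continuous _ _ pp a.
near=> x.
have xr : polydisc a r x by near: x; exact: near_polydisc.
have h1 := fp _ xr; have h2 := fp _ (polydisc_center a (ltW r0)).
have h3 : N (p x - p a) < e / 3 by near: x; exact: pc.
have -> : f x - f a = (f x - p x) + ((p x - p a) - (f a - p a)) by ring.
have := modulusD (f x - p x) ((p x - p a) - (f a - p a)).
have := modulusB (p x - p a) (f a - p a).
lra.
Unshelve. all: by end_near.
Qed.

Lemma holo_radius n m (g : 'I_m -> 'rV[C]_n -> C) a : (forall j, holo (g j) a) ->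
  exists2 r, 0 < r & forall j, poly_approx (polydisc a r) (g j).
Proof.
move=> gh; have : \forall r \near 0^'+, forall j, poly_approx (polydisc a r) (g j).
  apply: filter_forall => j; have [r r0 ga] := gh j.
  near=> s; apply: approx_sub ga; apply: polydisc_le; near: s.
  exact: nbhs_right_le.
move=> H; have [r [r0 Hr]] := @filter_ex _ _ _ _ (filterI (nbhs_right_gt (0:R)) H).
by exists r.
Unshelve. all: by end_near.
Qed.

Lemma holo_polyfun n (p : 'rV[C]_n -> C) a : polyfun p -> holo p a.
Proof. by move=> pp; exists 1 => //; exact: approx_polyfun. Qed.

(** Composing an approximating polynomial of [f] with the [g j] gives a function
    that is again approximable, and it is close to the composite as long as the
    [g j] stay in the polydisc of [f]. *)
Lemma holo_comp m n (f : 'rV[C]_m -> C) (g : 'I_m -> 'rV[C]_n -> C) a :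
  (forall j, holo (g j) a) -> holo f (\row_j g j a) ->
  holo (fun x => f (\row_j g j x)) a.
Proof.
move=> gh [r r0 fb]; have [s s0 gs] := holo_radius gh.
have : \forall x \near a, forall j, N (g j x - g j a) < r.
  apply: (@filter_forall _ _ _ (nbhs a) (nbhs_filter a)) => j; have /cvg_rowC_modulusP H := holo_continuous (gh j).
    exact: H.
move=> /near_row_polydisc[t t0 gt].
exists (Num.min s t); first by rewrite lt_min s0.
apply: approx_approx => e e0; have [p pp fp] := fb _ e0.
exists (fun x => p (\row_j g j x)).
  apply: approx_polycomp => // j; apply: approx_sub (gs j).
  by apply: polydisc_le; rewrite ge_min lexx.
move=> x xst; apply: fp => i; rewrite !mxE ltW// gt//.
by apply: polydisc_le xst; rewrite ge_min lexx orbT.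
Qed.

Lemma holo_comp1 n (f : 'rV[C]_1 -> C) (g : 'rV[C]_n -> C) a :
  holo g a -> holo f (const_mx (g a)) -> holo (fun x => f (const_mx (g x))) a.
Proof.
have E y : const_mx (g y) = \row_(j < 1) g y by apply/rowP => j; rewrite !mxE.
rewrite E => gh fh; under eq_fun do rewrite E.
exact: (@holo_comp 1 n f (fun=> g)).
Qed.

Lemma holo_comp2 n (f : 'rV[C]_2 -> C) (g h : 'rV[C]_n -> C) a :
  holo g a -> holo h a -> holo f (\row_j (if j == 0 then g a else h a)) ->
  holo (fun x => f (\row_j (if j == 0 then g x else h x))) a.
Proof.
move=> gh hh fh.
apply: (@holo_comp 2 n f (fun j x => if j == 0 then g x else h x)) => // j.
by case: (j == 0).
Qed.

Lemma holo_const n (c : C) (a : 'rV[C]_n) : holo (fun=> c) a.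
Proof. exact/holo_polyfun/polyfun_const. Qed.

Lemma holo_coord n i (a : 'rV[C]_n) : holo (fun x => x 0 i) a.
Proof. exact/holo_polyfun/polyfun_coord. Qed.

Lemma holoD n (f g : 'rV[C]_n -> C) a : holo f a -> holo g a ->
  holo (fun x => f x + g x) a.
Proof.
move=> fh gh.
have := @holo_comp2 n (fun x => x 0 0 + x 0 1) f g a fh gh.
have -> : (fun x : 'rV[C]_n => (\row_(j < 2) (if j == 0 then f x else g x)) 0 0 + (\row_(j < 2) (if j == 0 then f x else g x)) 0 1) = (fun x => f x + g x) by apply/funext => x; rewrite !mxE.
by apply; apply/holo_polyfun/polyfunD; exact: polyfun_coord.
Qed.

Lemma holoM n (f g : 'rV[C]_n -> C) a : holo f a -> holo g a ->
  holo (fun x => f x * g x) a.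
Proof.
move=> fh gh.
have := @holo_comp2 n (fun x => x 0 0 * x 0 1) f g a fh gh.
have -> : (fun x : 'rV[C]_n => (\row_(j < 2) (if j == 0 then f x else g x)) 0 0 * (\row_(j < 2) (if j == 0 then f x else g x)) 0 1) = (fun x => f x * g x) by apply/funext => x; rewrite !mxE.
by apply; apply/holo_polyfun/polyfunM; exact: polyfun_coord.
Qed.

Lemma holoX n (f : 'rV[C]_n -> C) k a : holo f a -> holo (fun x => f x ^+ k) a.
Proof.
move=> fh; elim: k => [|k IH]; first by under eq_fun do rewrite expr0; exact: holo_const.
by under eq_fun do rewrite exprS; exact: holoM.
Qed.

(** The polynomials are the partial sums of the geometric series of ratio
    1 - z / b. *)
Lemma holo_inv (b : C) : b != 0 ->
  holo (fun x : 'rV[C]_1 => (x 0 0)^-1) (const_mx b).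
Proof.
move=> b0; have Nb : 0 < N b by rewrite modulus_gt0.
exists (N b / 2); first by lra.
move=> e e0.
have [k Hk] : exists k, (N b)^-1 * 2 * (1/2) ^+ k <= e.
  have := @cvg_geometric R ((N b)^-1 * 2) (1/2).
  rewrite ger0_norm ?divr_ge0// => /(_ _)/cvgrPdist_le/(_ e e0) [|k _ Hk]; first lra.
  exists k; have := Hk k (leqnn k); rewrite /= sub0r normrN.
  by apply: le_trans; rewrite ler_norm.
exists (fun x => b^-1 * \sum_(i < k) (1 + (- b^-1) * x 0 0) ^+ i).
  apply: polyfunM; first exact: polyfun_const.
  apply: polyfun_sum => i; apply: polyfunX; apply: polyfunD; first exact: polyfun_const.
  by apply: polyfunM; [exact: polyfun_const|exact: polyfun_coord].
move=> x /(_ 0); rewrite mxE; set z := x 0 0 => zb.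
have z2 : N b / 2 <= N z.
  have := modulusD (b - z) z; rewrite subrK modulusBC; lra.
have z0 : z != 0 by rewrite -modulus_gt0; lra.
have -> : z^-1 - b^-1 * \sum_(i < k) (1 + (- b^-1) * z) ^+ i = z^-1 * (1 - z / b) ^+ k.
  set w := 1 + (- b^-1) * z.
  have -> : 1 - z / b = w by rewrite /w mulNr mulrC.
  have zE : z = b * (1 - w) by rewrite /w; field.
  have w1 : 1 - w != 0 by apply: contra_neq z0; rewrite zE => ->; rewrite mulr0.
  have := subrX1 w k; rewrite zE => H.
  have -> : w ^+ k = 1 + (w - 1) * \sum_(i < k) w ^+ i by rewrite -H; ring.
  by field; rewrite b0 w1.
apply: le_trans Hk; rewrite modulusM modulusX modulusV.
have Nw : N (1 - z / b) <= 1/2.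
  have -> : 1 - z / b = (b - z) / b by field.
  rewrite modulusM modulusV ler_pdivrMr// modulusBC; lra.
apply: ler_pM; rewrite ?invr_ge0 ?exprn_ge0 ?modulus_ge0//.
  rewrite -[X in _ * X]invrK -invfM lef_pV2 ?posrE//; lra.
by apply: lerXn2r; rewrite ?nnegrE ?modulus_ge0//; lra.
Qed.

Lemma holoV n (f : 'rV[C]_n -> C) a : holo f a -> f a != 0 ->
  holo (fun x => (f x)^-1) a.
Proof.
move=> fh fa0; have := @holo_comp1 n (fun x => (x 0 0)^-1) f a fh (holo_inv fa0).
by under eq_fun do rewrite mxE.
Qed.

Lemma sum_box_widen (V : nmodType) n d e (G : {ffun 'I_n -> nat} -> V) : (d <= e)%N ->
  \sum_(s : {ffun 'I_n -> 'I_d}) G [ffun i => val (s i)] =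
  \sum_(s : {ffun 'I_n -> 'I_e} | [forall i, (s i < d)%N]) G [ffun i => val (s i)].
Proof.
move=> de; pose h (s : {ffun 'I_n -> 'I_d}) : {ffun 'I_n -> 'I_e} :=
  [ffun i => widen_ord de (s i)].
have hinj : injective h.
  move=> s s' /ffunP H; apply/ffunP => i; have := H i; rewrite !ffunE.
  by move=> /(congr1 val) /= /val_inj.
have him s : (s \in (h @: [set: {ffun 'I_n -> 'I_d}])%SET) = [forall i, (s i < d)%N].
  apply/imsetP/forallP => [[s' _ ->] i|H]; first by rewrite ffunE /=.
  exists [ffun i => Ordinal (H i)] => //.
  by apply/ffunP => i; rewrite !ffunE; exact: val_inj.
under [RHS]eq_bigl do rewrite -him.
rewrite big_imset /=; last by move=> ? ? _ _; exact: hinj.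
apply: eq_big => [s|s _]; first by rewrite inE.
by congr G; apply/ffunP => i; rewrite !ffunE.
Qed.

Lemma sum_box_prod n d (F : nat -> R) :
  \sum_(s : {ffun 'I_n -> 'I_d}) \prod_i F ([ffun i => val (s i)] i) =
  (\sum_(k < d) F k) ^+ n.
Proof.
under eq_bigr do under eq_bigr do rewrite ffunE.
rewrite -(bigA_distr_bigA (fun (i : 'I_n) (k : 'I_d) => F k)).
by rewrite prodr_const card_ord.
Qed.

(** On the polydisc of half the radius the terms are dominated by a product of
    geometric series, so the sums over boxes converge uniformly. *)
Lemma analytic_holo n (f : 'rV[C]_n -> C) a : analytic_at f a -> holo f a.
Proof.
move=> [c [r0 [M0 [/ofR_gt0[r r_gt0 ->] cM cvg]]]].
have [M M_ge0 HM] : exists2 M : R, 0 <= M &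
    forall s : {ffun 'I_n -> nat}, N (c s) * r ^+ (\sum_i s i)%N <= M.
  have HH s : ofR (N (c s) * r ^+ (\sum_i s i)%N) <= M0 by rewrite ofRM ofRX -normC_modulus cM.
  have M00 : 0 <= M0.
    apply: le_trans (HH [ffun => 0%N]); rewrite ofR_le mulr_ge0 ?modulus_ge0//.
    by rewrite exprn_ge0// ltW.
  exists (complex.Re M0); first by move: M00; rewrite lecE => /andP[].
  by move=> s; have := HH s; rewrite lecE => /andP[].
exists (r / 2); first by lra.
pose g : nat -> R := fun k => (1/2) ^+ k.
pose S d := \sum_(k < d) g k.
have S2 d : S d <= 2.
  rewrite /S /g; have := subrX1 (1/2 : R) d.
  have : 0 <= (1/2 : R) ^+ d by rewrite exprn_ge0.
  by move=> H E; move: E H; set x := \sum_(k < d) _; set y := _ ^+ _; lra.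
have S0 d : 0 <= S d by apply: sumr_ge0 => k _; rewrite exprn_ge0.
have Scvg : S d ^+ n @[d --> \oo] --> (2 : R) ^+ n.
  apply: (@cvg_comp _ _ _ S (fun x => x ^+ n) _ (nbhs (2:R))); last exact: exprn_continuous.
  have := @cvg_geometric_series R 1 (1/2); rewrite ger0_norm ?divr_ge0//.
  have -> : (1 * (1 - 1/2)^-1 : R) = 2 by field.
  move=> /(_ _) H; have : S = series (geometric 1 (1/2)).
    apply/funext => d; rewrite /series /= big_mkord /S.
    by apply: eq_bigr => i _; rewrite /g /= [RHS]mul1r.
  by move=> ->; apply: H; lra.
move=> e e0.
have [d Hd] : exists d, M * (2 ^+ n - S d ^+ n) <= e.
  have : 0 < e / (M + 1) by rewrite divr_gt0//; lra.
  move=> e1; have /cvgrPdist_le/(_ _ e1)[d _ Hd] := Scvg.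
  exists d; have := Hd d (leqnn d) => /= H.
  have : 2 ^+ n - S d ^+ n <= e / (M + 1) by apply: le_trans H; rewrite ler_norm.
  rewrite ler_pdivlMr; last lra.
  have : 0 <= 2 ^+ n - S d ^+ n by rewrite subr_ge0 lerXn2r// nnegrE.
  move: (2 ^+ n - S d ^+ n) => x x0 H1; apply: le_trans H1; rewrite mulrC ler_wpM2l//; lra.
pose G (x : 'rV[C]_n) (s : {ffun 'I_n -> nat}) := c s * \prod_i (x 0 i - a 0 i) ^+ s i.
pose T x d := \sum_(s : {ffun 'I_n -> 'I_d}) G x [ffun i => val (s i)].
exists (T^~ d).
  apply: polyfun_sum => s; apply: polyfunM; first exact: polyfun_const.
  apply: polyfun_prod => i; apply: polyfunX; apply: polyfunD; first exact: polyfun_coord.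
  exact: polyfun_const.
move=> x xr.
have Gle s : N (G x s) <= M * \prod_i g (s i).
  have -> : \prod_i g (s i) = (1/2) ^+ (\sum_i s i) by rewrite expr_sum.
  rewrite modulusM modulus_prod; apply: (@le_trans _ _ (N (c s) * \prod_i (r / 2) ^+ s i)).
    rewrite ler_wpM2l ?modulus_ge0//; apply: ler_prod => i _.
    rewrite modulus_ge0 modulusX; apply: lerXn2r; rewrite ?nnegrE ?modulus_ge0//.
    by apply: le_trans (xr i); exact: modulus_ge0.
  rewrite -expr_sum (_ : r / 2 = r * (1 / 2)); last by rewrite mul1r.
  rewrite exprMn mulrA ler_wpM2r ?HM//.
have Tle D : (d <= D)%N -> N (T x D - T x d) <= e.
  move=> dD; apply: le_trans Hd.
  rewrite /T (sum_box_widen _ dD) (bigID (fun s : {ffun 'I_n -> 'I_D} => [forall i, (s i < d)%N])) /= addrC addrK.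
  rewrite (le_trans (modulus_sum _ _ _))//.
  apply: (@le_trans _ _ (\sum_(s : {ffun 'I_n -> 'I_D} | ~~ [forall i, (s i < d)%N])
     M * \prod_i g ([ffun i => val (s i)] i))).
    by apply: ler_sum => s _; exact: Gle.
  rewrite -mulr_sumr ler_wpM2l//.
  have := sum_box_prod n D g; rewrite (bigID (fun s : {ffun 'I_n -> 'I_D} => [forall i, (s i < d)%N])) /=.
  rewrite -(sum_box_widen (fun s : {ffun 'I_n -> nat} => \prod_i g (s i)) dD) sum_box_prod -/(S d) -/(S D).
  have : S D ^+ n <= 2 ^+ n by rewrite lerXn2r// nnegrE.
  by move=> H1 H2; rewrite lerBrDl H2.
have /cvg_modulusP cv : T x D @[D --> \oo] --> f x.
  have -> : T x = (fun D => \sum_(s : {ffun 'I_n -> 'I_D})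
      c [ffun i => val (s i)] * \prod_i (x 0 i - a 0 i) ^+ val (s i)).
    apply/funext => D; apply: eq_bigr => s _; congr (_ * _).
    by apply: eq_bigr => i _; rewrite ffunE.
  by apply: cvg => i; rewrite normC_modulus ofR_lt; apply: le_lt_trans (xr i) _; lra.
apply/ler_addgt0Pl => e' e'0; have [D _ HD] := cv _ e'0.
have -> : f x - T x d = - (T x (maxn d D) - f x) + (T x (maxn d D) - T x d) by ring.
rewrite (le_trans (modulusD _ _))// modulusN lerD ?Tle ?leq_maxl//.
by rewrite ltW// HD//= leq_maxr.
Qed.

End Approx.

(** * Power series in one variable *)

Section OneVar.
Context {R : realType}.
Local Notation C := (Cx R).
Local Notation N := modulus.

(** A root of z ^ (2 ^ m) = -1 has order 2 ^ (m + 1). *)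
Lemma prim_root_pow2 m : exists z : C, (2 ^ m.+1).-primitive_root z.
Proof.
pose z : C := (2 ^ m).-root (-1).
have zm : z ^+ (2 ^ m) = -1 by rewrite /z rootCK// expn_gt0.
have zS : z ^+ (2 ^ m.+1) = 1 by rewrite expnS mulnC exprM zm sqrrN expr1n.
have [k kz] := prim_order_exists (leq_trans (ltn0Sn 0) (expn_gt0 2 m.+1)) zS.
move=> /(dvdn_pfactor _ _ (isT : prime 2))[j jm kj]; rewrite kj in kz.
exists z; move: jm; rewrite leq_eqVlt => /orP[/eqP <-//|jm].
have : z ^+ (2 ^ m) = 1.
  by apply/eqP; rewrite -(prim_order_dvd kz) dvdn_exp2l.
rewrite zm => /eqP; rewrite -subr_eq0 -opprD oppr_eq0.
by rewrite (_ : 1 + 1 = 2%:R)// pnatr_eq0.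
Qed.

(** Cauchy's estimate.  The coefficient is the average of P(w) w^(-k) over the
    n-th roots of unity times r, as soon as n exceeds the degree and k. *)
Lemma poly_coef_le (P : {poly C}) (r B : R) k : 0 < r ->
  (forall v, N v = r -> N P.[v] <= B) -> N P`_k * r ^+ k <= B.
Proof.
move=> r0 HB.
pose m := (size P + k)%N; pose n := (2 ^ m.+1)%N.
have mn : (m < n)%N by rewrite /n (leq_trans (ltn_expl m (isT : (1 < 2)%N)))// leq_exp2l.
have [w wn] := prim_root_pow2 m; rewrite -/n in wn.
have n0 : (0 < n)%N by rewrite (leq_ltn_trans _ mn).
have kn : (k < n)%N by rewrite (leq_ltn_trans _ mn)// leq_addl.
have Pn : (size P <= n)%N by rewrite (leq_trans _ (ltnW mn))// leq_addr.
have Nw : N w = 1.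
  have /eqP : N w ^+ n = 1 by rewrite -modulusX (prim_expr_order wn) modulus1.
  by rewrite pexpr_eq1 ?modulus_ge0// => /eqP.
pose rc := ofR r.
(* The exponent n - k plays the part of -k, as w ^+ n = 1. *)
have S0 : \sum_(j < n) P.[rc * w ^+ j] * w ^+ (j * (n - k)) = n%:R * (P`_k * rc ^+ k).
  under eq_bigr do rewrite (horner_coef_wide _ Pn) mulr_suml.
  rewrite exchange_big /= (bigD1 (Ordinal kn)) //= [X in _ + X]big1 ?addr0.
    rewrite (eq_bigr (fun=> P`_k * rc ^+ k)); last first.
      move=> j _; rewrite exprMn -[RHS]mulr1 -!mulrA; congr (_ * (_ * _)).
      by rewrite -exprM -exprD -mulnDr subnKC ?(ltnW kn)// mulnC exprM (prim_expr_order wn) expr1n.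
    by rewrite sumr_const card_ord mulr_natl.
  move=> l lk; set x := w ^+ (l + (n - k)).
  rewrite (eq_bigr (fun j : 'I_n => P`_l * rc ^+ l * x ^+ j)); last first.
    move=> j _; rewrite exprMn -!mulrA; congr (_ * (_ * _)).
    by rewrite -exprM -exprD -mulnDr mulnC exprM.
  rewrite -mulr_sumr.
  have xn : x ^+ n = 1 by rewrite /x -exprM mulnC exprM (prim_expr_order wn) expr1n.
  have x1 : x - 1 != 0.
    rewrite subr_eq0 -(prim_order_dvd wn); apply: contra_neqN lk => H.
    apply: val_inj => /=; have ln := ltn_ord l.
    have : (l + (n - k) = n)%N.
      by move: H => /dvdnP[[|[|q]] E]; lia.
    lia.
  have := subrX1 x n; rewrite xn subrr => /esym/eqP.
  by rewrite mulf_eq0 (negbTE x1) /= => /eqP ->; rewrite mulr0.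
have : N (n%:R * (P`_k * rc ^+ k)) <= n%:R * B.
  rewrite -S0 (le_trans (modulus_sum _ _ _))//.
  rewrite -[n in n%:R * B]card_ord mulr_natl -sumr_const ler_sum// => j _.
  rewrite modulusM modulusX Nw expr1n mulr1 HB// modulusM modulusX Nw expr1n mulr1 modulus_ofR ger0_norm// ltW//.
rewrite !modulusM modulus_nat modulusX modulus_ofR (ger0_norm (ltW r0)) ler_pM2l ?ltr0n//.
Qed.

Definition approx1 (r : R) (h : C -> C) : Prop :=
  forall e, 0 < e -> exists P : {poly C}, forall v, N v <= r -> N (h v - P.[v]) <= e.

Lemma polyfun_line n (p : 'rV[C]_n -> C) (x w : 'rV[C]_n) : polyfun p ->
  exists P : {poly C}, forall v, p (x + v *: w) = P.[v].
Proof.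
elim => [c|i|p1 p2 _ [P1 H1] _ [P2 H2]|p1 p2 _ [P1 H1] _ [P2 H2]].
- by exists c%:P => v; rewrite hornerC.
- by exists ((x 0 i)%:P + 'X * (w 0 i)%:P) => v; rewrite !mxE !hornerE.
- by exists (P1 + P2) => v; rewrite H1 H2 hornerD.
- by exists (P1 * P2) => v; rewrite H1 H2 hornerM.
Qed.

Lemma approx_line n (D : set 'rV[C]_n) f (x w : 'rV[C]_n) r : poly_approx D f ->
  (forall v, N v <= r -> D (x + v *: w)) -> approx1 r (fun v => f (x + v *: w)).
Proof.
move=> fD sub e e0; have [p pp fp] := fD e e0.
have [P HP] := polyfun_line x w pp.
by exists P => v vr; rewrite -HP fp//; exact: sub.
Qed.

Lemma polyfun_horner (P : {poly C}) : polyfun (fun x : 'rV[C]_1 => P.[x 0 0]).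
Proof.
rewrite (_ : (fun x : 'rV[C]_1 => P.[x 0 0]) =
  (fun x => \sum_(i < size P) P`_i * x 0 0 ^+ i)); last first.
  by apply/funext => x; rewrite horner_coef.
apply: polyfun_sum => i; apply: polyfunM; first exact: polyfun_const.
exact/polyfunX/polyfun_coord.
Qed.

Lemma approx1_bounded r h : approx1 r h ->
  exists2 B, 0 < B & forall v, N v <= r -> N (h v) <= B.
Proof.
move=> /(_ 1 ltr01)[P HP].
have [B B0 HB] := polyfun_bounded 0 r (polyfun_horner P).
exists (1 + B) => [|v vr]; first by lra.
rewrite -(subrK P.[v] (h v)) (le_trans (modulusD _ _))// lerD ?HP//.
have := HB (const_mx v); rewrite mxE; apply => i.
by rewrite !mxE subr0.
Qed.

Definition holo1 (h : C -> C) : Prop := holo (fun x : 'rV[C]_1 => h (x 0 0)) 0.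

Lemma polydisc1 r (v : C) : polydisc (0 : 'rV[C]_1) r (const_mx v) <-> N v <= r.
Proof.
split=> [/(_ 0)|vr i]; first by rewrite !mxE subr0.
by rewrite !mxE subr0.
Qed.

Lemma holo1P h : holo1 h <-> exists2 r, 0 < r & approx1 r h.
Proof.
split=> [[r r0 H]|[r r0 H]]; exists r => //.
  have := @approx_line _ _ _ 0 (const_mx 1) r H.
  rewrite (_ : (fun v => _) = h); last by apply/funext => v; rewrite !mxE add0r mulr1.
  apply=> v vr; rewrite add0r (_ : v *: const_mx 1 = const_mx v); first exact/polydisc1.
  by apply/rowP => i; rewrite !mxE mulr1.
move=> e /H[P HP]; exists (fun x => P.[x 0 0]); first exact: polyfun_horner.
by move=> x xr; apply: HP; have := xr 0; rewrite mxE subr0.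
Qed.

Lemma near0_disc (P : C -> Prop) :
  (\forall z \near (0 : C), P z) <-> exists2 r, 0 < r & forall z, N z <= r -> P z.
Proof.
split=> [/nearC_ball[r r0 sub]|[r r0 sub]].
  exists (r / 2); first by lra.
  by move=> x xr; apply: sub; rewrite subr0; apply: le_lt_trans xr _; lra.
by apply/nearC_ball; exists r => // z zr; apply: sub; rewrite ltW// -(subr0 z).
Qed.

Lemma near_mx1 (P : C -> Prop) : (\forall z \near (0 : C), P z) <->
  nbhs (0 : 'rV[C]_1) [set x : 'rV[C]_1 | P (x 0 0)].
Proof.
split=> [/near0_disc[r r0 H]|/near_row_polydisc[r r0 H]].
  apply/near_row_polydisc; exists r => // x /(_ 0); rewrite mxE subr0; exact: H.
apply/near0_disc; exists r => // v /polydisc1 /H /=; by rewrite mxE.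
Qed.

Lemma holo1_continuous h : holo1 h -> h x @[x --> (0 : C)] --> h 0.
Proof.
move=> hh; have /cvg_rowC_modulusP H := holo_continuous hh.
apply/cvgC_modulusP => e e0; apply/near_mx1; have := H e e0; rewrite mxE; exact.
Qed.

Lemma sum_geo_le (x : R) m n : 0 <= x -> x <= 1/2 ->
  \sum_(m <= k < n) x ^+ k <= 2 * x ^+ m.
Proof.
move=> x0 x2; have [nm|mn] := leqP n m.
  by rewrite big_geq// mulr_ge0 ?exprn_ge0.
rewrite -{1}(add0n m) big_addn big_mkord.
under eq_bigr do rewrite exprD.
rewrite -mulr_suml ler_wpM2r ?exprn_ge0//.
have := subrX1 x (n - m); set s := \sum_(i < _) _ => H.
have : 0 <= x ^+ (n - m) by rewrite exprn_ge0.
have s0 : 0 <= s by apply: sumr_ge0 => i _; rewrite exprn_ge0.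
move: (x ^+ (n - m)) H => y H y0; nra.
Qed.

(** By Cauchy's estimate the k-th coefficients of approximating polynomials form
    a Cauchy sequence; the limit is the k-th coefficient of the power series. *)
Lemma approx1_coef r h : 0 < r -> approx1 r h ->
  exists c : nat -> C, forall e (P : {poly C}), 0 < e ->
    (forall v, N v <= r -> N (h v - P.[v]) <= e) ->
    forall k, N (P`_k - c k) * r ^+ k <= e.
Proof.
move=> r0 H.
have coefB e e' (P Q : {poly C}) : (forall v, N v <= r -> N (h v - P.[v]) <= e) ->
    (forall v, N v <= r -> N (h v - Q.[v]) <= e') ->
    forall k, N (P`_k - Q`_k) * r ^+ k <= e + e'.
  move=> HP HQ k; rewrite -coefB; apply: poly_coef_le => // v vr.
  have -> : (P - Q).[v] = (h v - Q.[v]) - (h v - P.[v]) by rewrite !hornerE; ring.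
  by rewrite (le_trans (modulusB _ _))// addrC lerD ?HP ?HQ ?vr.
have eps n : 0 < n.+1%:R^-1 :> R by [].
have [P HP] := choice (fun n => H _ (eps n)).
have small e : 0 < e -> exists n, forall p, (n <= p)%N -> p.+1%:R^-1 <= e :> R.
  move=> e0; have /cvgrPdist_le/(_ e e0)[n _ Hn] := @cvg_harmonic R.
  exists n => p /Hn; rewrite /= sub0r normrN; apply: le_trans; exact: ler_norm.
have [c Hc] : exists c : nat -> C, forall k e, 0 < e -> exists n, forall p, (n <= p)%N ->
    N ((P p)`_k - c k) <= e.
  suff : forall k, exists c, forall e, 0 < e -> exists n, forall p, (n <= p)%N ->
    N ((P p)`_k - c) <= e by move=> Hk; have [c Hc] := choice Hk; exists c.
  move=> k; apply: complete_C => e e0.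
  have rk : 0 < r ^+ k by rewrite exprn_gt0.
  have [|n Hn] := small (e * r ^+ k / 2); first by rewrite divr_gt0// mulr_gt0.
  exists n => p q np nq; rewrite -(ler_pM2r rk).
  have := coefB _ _ _ _ (HP p) (HP q) k; have := Hn _ np; have := Hn _ nq => /=.
  move: (p.+1%:R^-1) (q.+1%:R^-1) => a b; lra.
exists c => e Q e0 HQ k; apply/ler_addgt0Pl => e' e'0.
have rk : 0 < r ^+ k by rewrite exprn_gt0.
have [|n Hn] := small (e' / 2); first lra.
have [|n' Hn'] := Hc k (e' / 2 / r ^+ k); first by rewrite !divr_gt0.
have h1 := Hn _ (leq_maxl n n'); have h2 := Hn' _ (leq_maxr n n').
have := coefB _ _ _ _ HQ (HP (maxn n n')) k.
move: h2; rewrite ler_pdivlMr// => h2 h3.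
have -> : Q`_k - c k = (Q`_k - (P (maxn n n'))`_k) + ((P (maxn n n'))`_k - c k) by ring.
have := ler_wpM2r (ltW rk) (modulusD (Q`_k - (P (maxn n n'))`_k) ((P (maxn n n'))`_k - c k)).
rewrite mulrDl; move: h1 h3; move: ((maxn n n').+1%:R^-1) => a h1 h3; lra.
Qed.

(** The error after n terms carries the factor v^n: this is what makes the
    division of [approx1_shift] possible. *)
Lemma power_series r h B : 0 < r -> approx1 r h -> 0 <= B ->
  (forall v, N v <= r -> N (h v) <= B) ->
  exists c : nat -> C, (forall k, N (c k) * r ^+ k <= B) /\
    forall v n, N v <= r / 2 ->
      N (h v - \sum_(k < n) c k * v ^+ k) <= 2 * B * (N v / r) ^+ n.
Proof.
move=> r0 H B0 HB; have [c Hc] := approx1_coef r0 H; exists c.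
have Pk e (P : {poly C}) : 0 < e -> (forall v, N v <= r -> N (h v - P.[v]) <= e) ->
    forall k, N P`_k * r ^+ k <= B + e.
  move=> e0 HP k; apply: poly_coef_le => // v vr.
  have -> : P.[v] = h v - (h v - P.[v]) by ring.
  by rewrite (le_trans (modulusB _ _))// lerD ?HB ?HP ?vr.
split.
  move=> k; apply/ler_addgt0Pl => e e0; have e2 : 0 < e / 2 by lra.
  have [P HP] := H _ e2; have h1 := Pk _ _ e2 HP k; have h2 := Hc _ _ e2 HP k.
  have rk : 0 < r ^+ k by rewrite exprn_gt0.
  have -> : c k = P`_k - (P`_k - c k) by ring.
  have := ler_wpM2r (ltW rk) (modulusB P`_k (P`_k - c k)); rewrite mulrDl; lra.
move=> v n vr; set x := N v / r.
have x0 : 0 <= x by rewrite divr_ge0 ?modulus_ge0// ltW.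
have x2 : x <= 1/2 by rewrite ler_pdivrMr//; lra.
have vx : N v = x * r by rewrite divfK ?gt_eqF.
have term (a : C) k b : N a * r ^+ k <= b -> N (a * v ^+ k) <= b * x ^+ k.
  move=> ab; rewrite modulusM modulusX vx exprMn mulrCA mulrC.
  by rewrite ler_wpM2r// exprn_ge0.
apply/ler_addgt0Pl => e e0; have e5 : 0 < e / 5 by lra.
have [P HP] := H _ e5.
have h1 : N (h v - P.[v]) <= e / 5 by apply: HP; lra.
have h2 : N (\sum_(k < n) (P`_k - c k) * v ^+ k) <= e / 5 * 2.
  rewrite (le_trans (modulus_sum _ _ _))//.
  apply: (@le_trans _ _ (\sum_(k < n) e / 5 * x ^+ k)).
    by apply: ler_sum => k _; apply: term; exact: Hc.
  rewrite -mulr_sumr ler_wpM2l ?(ltW e5)//.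
  by have := sum_geo_le 0 n x0 x2; rewrite big_mkord expr0 mulr1.
have h3 : N (\sum_(n <= k < maxn n (size P)) P`_k * v ^+ k) <= (B + e / 5) * (2 * x ^+ n).
  rewrite (le_trans (modulus_sum _ _ _))//.
  apply: (@le_trans _ _ (\sum_(n <= k < maxn n (size P)) (B + e / 5) * x ^+ k)).
    by apply: ler_sum => k _; apply: term; exact: Pk.
  by rewrite -mulr_sumr ler_wpM2l ?sum_geo_le//; lra.
have xn1 : x ^+ n <= 1 by apply: exprn_ile1 => //; lra.
have xn0 : 0 <= x ^+ n by rewrite exprn_ge0.
have E : h v - \sum_(k < n) c k * v ^+ k = (h v - P.[v]) +
    (\sum_(k < n) (P`_k - c k) * v ^+ k + \sum_(n <= k < maxn n (size P)) P`_k * v ^+ k).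
  rewrite (horner_coef_wide _ (leq_maxr n (size P))).
  rewrite -(big_mkord xpredT (fun i => P`_i * v ^+ i)).
  rewrite (@big_cat_nat _ _ _ n)//= ?leq_maxl// big_mkord.
  under [X in _ + (X + _)]eq_bigr do rewrite mulrBl.
  rewrite sumrB; ring.
rewrite E (le_trans (modulusD _ _))//.
have := modulusD (\sum_(k < n) (P`_k - c k) * v ^+ k) (\sum_(n <= k < maxn n (size P)) P`_k * v ^+ k).
nra.
Qed.

Lemma approx1_horner_sum r (c : nat -> C) n : approx1 r (fun v => \sum_(k < n) c k * v ^+ k).
Proof.
move=> e e0; exists (\poly_(i < n) c i) => v _.
by rewrite horner_poly subrr modulus0 ltW.
Qed.

Lemma approx1_lim r h : (forall e, 0 < e -> exists2 g, approx1 r g &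
  forall v, N v <= r -> N (h v - g v) <= e) -> approx1 r h.
Proof.
move=> H e e0; have e2 : 0 < e / 2 by lra.
have [g gr hg] := H _ e2; have [P HP] := gr _ e2.
exists P => v vr; rewrite (splitr e) -(subrK (g v) (h v)) -addrA.
by rewrite (le_trans (modulusD _ _))// lerD ?hg ?HP.
Qed.

(** If the first k coefficients vanish, h is v^k times an approximable function,
    namely the limit of the shifted partial sums. *)
Lemma approx1_shift r h B (c : nat -> C) k : 0 < r -> 0 <= B ->
  (forall v n, N v <= r / 2 ->
      N (h v - \sum_(k < n) c k * v ^+ k) <= 2 * B * (N v / r) ^+ n) ->
  (forall i, (i < k)%N -> c i = 0) ->
  exists w, [/\ approx1 (r / 2) w, w 0 = c k &
    forall v, N v <= r / 2 -> h v = v ^+ k * w v].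
Proof.
move=> r0 B0 H c0; exists (fun v => if v == 0 then c k else h v / v ^+ k).
have h0 : h 0 = c 0%N.
  apply/eqP; rewrite -subr_eq0 -modulus_eq0 eq_le modulus_ge0 andbT.
  have := H 0 1%N; rewrite modulus0 mul0r expr1 mulr0 big_ord1 expr0 mulr1; apply; lra.
split; last 2 first.
- by rewrite eqxx.
- move=> v vr; have [->|v0] := eqVneq v 0; last by rewrite mulrC divfK// expf_neq0.
  by rewrite h0; case: k c0 => [|k] c0; rewrite ?expr0 ?mul1r// c0// expr0n mul0r.
apply: approx1_lim => e e0.
have [n Hn] : exists n, (2 * B / r ^+ k) * (1/2) ^+ n <= e.
  have := @cvg_geometric R (2 * B / r ^+ k) (1/2).
  rewrite ger0_norm ?divr_ge0// => /(_ _)/cvgrPdist_le/(_ e e0) [|n _ Hn]; first lra.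
  exists n; have := Hn n (leqnn n); rewrite /= sub0r normrN.
  by apply: le_trans; rewrite ler_norm.
exists (fun v => \sum_(j < n.+1) c (k + j)%N * v ^+ j); first exact: (approx1_horner_sum _ (fun j => c (k + j)%N)).
move=> v vr; have rk : 0 < r ^+ k by rewrite exprn_gt0.
have Bk : 0 <= 2 * B / r ^+ k by rewrite divr_ge0 ?(ltW rk)//; lra.
case: eqVneq => [->|v0].
  rewrite big_ord_recl expr0 mulr1 addn0 big1 ?addr0 ?subrr ?modulus0 ?ltW//.
  by move=> i _; rewrite exprS mul0r mulr0.
have Nv : 0 < N v by rewrite modulus_gt0.
apply: le_trans Hn; have := H v (k + n.+1)%N vr.
rewrite -(big_mkord xpredT (fun i => c i * v ^+ i)) (@big_cat_nat _ _ _ k) ?leq_addr//=.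
rewrite big_nat_cond big1 ?add0r; last by move=> i /andP[/andP[_ ik] _]; rewrite c0 ?mul0r.
rewrite -{1}(add0n k) big_addn addKn big_mkord => Hv.
have vk : v ^+ k != 0 by rewrite expf_neq0.
have E : h v / v ^+ k - \sum_(j < n.+1) c (k + j)%N * v ^+ j =
   (h v - \sum_(i < n.+1) c (i + k)%N * v ^+ (i + k)) / v ^+ k.
  rewrite mulrBl; congr (_ - _); rewrite mulr_suml; apply: eq_bigr => i _.
  by rewrite exprD addnC mulrA mulfK.
rewrite E modulusM modulusV modulusX; set x := N v / r in Hv *.
have x0 : 0 <= x by rewrite divr_ge0 ?modulus_ge0// ltW.
have x2 : x <= 1/2 by rewrite ler_pdivrMr//; lra.
have vx : N v = x * r by rewrite divfK ?gt_eqF.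
move: x0 x2 vx Hv; clearbody x => x0 x2 vx Hv.
rewrite ler_pdivrMr ?exprn_gt0// (le_trans Hv)// vx (exprMn k x r) exprD.
have -> : forall a b c d : R, b != 0 -> a / b * c * (d * b) = a * (d * c).
  by move=> a b c' d b0; field.
  rewrite ler_wpM2l//; first lra.
  rewrite ler_wpM2l ?exprn_ge0//.
  apply: (@le_trans _ _ (x ^+ n)).
    by rewrite exprS ler_piMl ?exprn_ge0//; lra.
  by apply: lerXn2r; rewrite ?nnegrE//; lra.
by rewrite gt_eqF.
Qed.

Lemma approx1_vanish r h B (c : nat -> C) : 0 < r -> 0 <= B ->
  (forall v n, N v <= r / 2 ->
      N (h v - \sum_(k < n) c k * v ^+ k) <= 2 * B * (N v / r) ^+ n) ->
  (forall i, c i = 0) -> forall v, N v <= r / 2 -> h v = 0.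
Proof.
move=> r0 B0 H c0 v vr; apply/eqP; rewrite -modulus_eq0 eq_le modulus_ge0 andbT.
apply/ler_addgt0Pl => e e0; rewrite addr0.
have x0 : 0 <= N v / r by rewrite divr_ge0 ?modulus_ge0// ltW.
have x2 : N v / r < 1 by rewrite ltr_pdivrMr//; lra.
have := @cvg_geometric R (2 * B) (N v / r).
rewrite ger0_norm// => /(_ x2)/cvgrPdist_le/(_ e e0) [n _ Hn].
have := Hn n (leqnn n); rewrite /= sub0r normrN => Hn'.
have := H v n vr; rewrite big1 ?subr0; last by move=> i _; rewrite c0 mul0r.
move/le_trans; apply; apply: le_trans Hn'; exact: ler_norm.
Qed.

(** Divide by the power of v of the first nonzero coefficient. *)
Lemma holo1_order h : holo1 h ->
  (\forall v \near (0 : C), h v = 0) \/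
  exists k w, [/\ holo1 w, w 0 != 0 & \forall v \near (0 : C), h v = v ^+ k * w v].
Proof.
move=> /holo1P[r r0 H]; have [B B0 HB] := approx1_bounded H.
have [c [_ Hc]] := power_series r0 H (ltW B0) HB.
have r2 : 0 < r / 2 by lra.
have [[k ck]|c0] := pselect (exists k, c k != 0); last first.
  left; apply/near0_disc; exists (r / 2) => //.
  apply: (approx1_vanish r0 (ltW B0) Hc) => i; apply/eqP/negPn/negP => ci.
  by apply: c0; exists i.
right; have := @ex_minnP (fun k => c k != 0) (ex_intro _ k ck).
case=> m cm mmin.
have c0 i : (i < m)%N -> c i = 0.
  move=> im; apply/eqP/negPn/negP => /mmin; by rewrite leqNgt im.
have [w [wr w0 hw]] := approx1_shift r0 (ltW B0) Hc c0.
exists m, w; split; [by apply/holo1P; exists (r / 2)|by rewrite w0|].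
by apply/near0_disc; exists (r / 2).
Qed.

Lemma holo1_analytic h : holo1 h -> analytic1_at h 0.
Proof.
move=> /holo1P[r r0 H]; have [B B0 HB] := approx1_bounded H.
have [c [Bc Hc]] := power_series r0 H (ltW B0) HB.
exists (fun a : {ffun 'I_1 -> nat} => c (a 0)), (ofR (r / 2)), (ofR B); split.
- by rewrite ofR_lt; lra.
- move=> a; rewrite big_ord1 normC_modulus -ofRX -ofRM ofR_le.
  apply: le_trans (Bc (a 0)); rewrite ler_wpM2l ?modulus_ge0//.
  by apply: lerXn2r; rewrite ?nnegrE; lra.
move=> x /(_ 0); rewrite mxE subr0 normC_modulus ofR_lt => xr.
have E d : \sum_(a : {ffun 'I_1 -> 'I_d}) c ([ffun i => val (a i)] 0) *
    \prod_i (x 0 i - (const_mx 0 : 'rV[C]_1) 0 i) ^+ val (a i) = \sum_(k < d) c k * x 0 0 ^+ k.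
  rewrite (reindex (fun k : 'I_d => [ffun=> k])) /=; last first.
    exists (fun a : {ffun 'I_1 -> 'I_d} => a 0) => [k _|a _]; first by rewrite ffunE.
    by apply/ffunP => i; rewrite ffunE ord1.
  by apply: eq_bigr => k _; rewrite big_ord1 !ffunE mxE subr0.
under eq_fun do rewrite E.
have x0 : 0 <= N (x 0 0) / r by rewrite divr_ge0 ?modulus_ge0// ltW.
have x2 : N (x 0 0) / r < 1 by rewrite ltr_pdivrMr//; lra.
have := @cvg_geometric R (2 * B) (N (x 0 0) / r).
rewrite ger0_norm// => /(_ x2)/cvgrPdist_lt cv.
apply/cvg_modulusP => e e0; apply: filterS (cv e e0) => n /=; rewrite sub0r normrN => Hn.
rewrite modulusBC; apply: le_lt_trans (Hc _ _ (ltW xr)) _.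
exact: le_lt_trans (ler_norm _) Hn.
Qed.

End OneVar.

(** * The maximum modulus principle *)

Section Modulus_principle.
Context {R : realType}.
Local Notation C := (Cx R).
Local Notation N := modulus.

Lemma near_and (T : topologicalType) (a : T) (P Q : T -> Prop) :
  (\forall x \near a, P x) -> (\forall x \near a, Q x) ->
  \forall x \near a, P x /\ Q x.
Proof. exact: filterI. Qed.

Lemma cvg_nearR (T : topologicalType) (f : T -> R) (a : T) :
  (forall e, 0 < e -> \forall x \near a, `|f x - f a| < e) -> f x @[x --> a] --> f a.
Proof. by move=> H; apply/(@cvgrPdistC_lt _ _ _ (nbhs a) (nbhs_filter a)) => e; exact: H. Qed.

Lemma holo1_const (c : C) : holo1 (fun=> c).
Proof. exact: holo_const. Qed.
Lemma holo1_id : holo1 (fun v : C => v).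
Proof. exact: holo_coord. Qed.
Lemma holo1D (f g : C -> C) : holo1 f -> holo1 g -> holo1 (fun v => f v + g v).
Proof. exact: holoD. Qed.
Lemma holo1M (f g : C -> C) : holo1 f -> holo1 g -> holo1 (fun v => f v * g v).
Proof. exact: holoM. Qed.
Lemma holo1X (f : C -> C) k : holo1 f -> holo1 (fun v => f v ^+ k).
Proof. exact: holoX. Qed.
Lemma holo1V (f : C -> C) : holo1 f -> f 0 != 0 -> holo1 (fun v => (f v)^-1).
Proof. by move=> fh f0; apply: holoV => //; rewrite mxE. Qed.

Lemma holo1_near_close (h : C -> C) (e : R) : holo1 h -> 0 < e ->
  \forall v \near (0 : C), N (h v - h 0) < e.
Proof. by move=> /holo1_continuous/cvgC_modulusP H /H. Qed.

Lemma holo1_near_neq0 (h : C -> C) : holo1 h -> h 0 != 0 ->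
  \forall v \near (0 : C), h v != 0.
Proof.
move=> hh h0; have h_gt0 : 0 < N (h 0) by rewrite modulus_gt0.
apply: filterS (holo1_near_close hh h_gt0) => v; apply: contraTneq => ->.
by rewrite sub0r modulusN ltxx.
Qed.

(** Identity theorem: a nonzero function is v^k times a unit, so its zeros are
    isolated. *)
Lemma holo1_zeros (h : C -> C) : holo1 h ->
  (forall r : R, 0 < r -> exists v, [/\ v != 0, N v < r & h v = 0]) ->
  \forall v \near (0 : C), h v = 0.
Proof.
move=> /holo1_order[//|[k [w [wh w0 hw]]]] H.
have /nearC_ball[r r0 Hr] := near_and hw (holo1_near_neq0 wh w0).
have [v [v0 vr hv]] := H r r0.
have [|E wv] := Hr v; first by rewrite subr0.
by move/eqP: hv; rewrite E mulf_eq0 expf_eq0 (negbTE v0) andbF (negbTE wv).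
Qed.

(** Otherwise h = h(0) + v^k w with k > 0 and w(0) nonzero, and |h| increases in
    the direction of a k-th root of h(0) / w(0). *)
Lemma maximum_modulus (h : C -> C) : holo1 h ->
  (\forall v \near (0 : C), N (h v) <= N (h 0)) -> \forall v \near (0 : C), h v = h 0.
Proof.
move=> hh hmax; have [h0|h0] := eqVneq (h 0) 0.
  apply: filterS hmax => v; rewrite h0 modulus0 => Nv.
  by apply/eqP; rewrite -modulus_eq0 eq_le Nv modulus_ge0.
have gh : holo1 (fun v => h v + - h 0) by apply: holo1D => //; exact: holo1_const.
case: (holo1_order gh) => [|[k [w [wh w0 hw]]]].
  by apply: filterS => v /eqP; rewrite subr_eq0 => /eqP.
have k0 : (0 < k)%N.
  rewrite lt0n; apply: contraTneq w0 => k0; rewrite negbK.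
  by have := nbhs_singleton hw; rewrite subrr k0 expr0 mul1r => <-.
have w2 : 0 < N (w 0) / 2 by rewrite divr_gt0// modulus_gt0.
have /nearC_ball[r r0 Hr] := near_and hmax (near_and hw (holo1_near_close wh w2)).
(* With this choice z^k w(0) is a positive multiple of h(0). *)
pose z : C := k.-root (h 0 / w 0).
have zk : z ^+ k = h 0 / w 0 by rewrite /z rootCK.
have z0 : z != 0.
  by apply: contra_neq (mulf_neq0 h0 (invr_neq0 w0)) => z0; rewrite -zk z0 expr0n gtn_eqF.
have Nz : 0 < N z by rewrite modulus_gt0.
pose t := r / (N z + r) / 2.
have t0 : 0 < t by rewrite !divr_gt0// addr_gt0.
have tz : t * N z < r.
  have : t * (N z + r) = r / 2 by rewrite /t; field; rewrite gt_eqF// addr_gt0.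
  by nra.
pose v := ofR t * z.
have [|hv [E wv]] := Hr v.
  by rewrite subr0 modulusM modulus_ofR gtr0_norm.
exfalso.
pose q := w v / w 0 - 1.
have q2 : N q < 1 / 2.
  have -> : q = (w v - w 0) / w 0 by rewrite /q; field.
  by rewrite modulusM modulusV ltr_pdivrMr ?modulus_gt0//; lra.
have hE : h v = h 0 * (1 + ofR (t ^+ k) * (1 + q)).
  have -> : h v = (h v + - h 0) + h 0 by ring.
  rewrite E exprMn zk /q ofRX; field.
  by rewrite w0.
move: hv; rewrite hE modulusM; apply/negP; rewrite -ltNge.
rewrite -[X in X < _]mulr1 ltr_pM2l ?modulus_gt0//.
have tk : 0 < t ^+ k by rewrite exprn_gt0.
have : N (1 + ofR (t ^+ k)) = 1 + t ^+ k.
  by rewrite (_ : 1 = ofR 1)// -ofRD modulus_ofR ger0_norm// addr_ge0// ltW.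
have : N (ofR (t ^+ k) * q) <= t ^+ k / 2.
  by rewrite modulusM modulus_ofR gtr0_norm// ler_wpM2l ?(ltW tk)//; lra.
have := modulusD (1 + ofR (t ^+ k) * (1 + q)) (- (ofR (t ^+ k) * q)).
rewrite modulusN (_ : 1 + _ * _ + - _ = 1 + ofR (t ^+ k)); last by ring.
by move: tk; lra.
Qed.

Lemma minimum_modulus (h : C -> C) : holo1 h -> h 0 != 0 ->
  (\forall v \near (0 : C), N (h 0) <= N (h v)) -> \forall v \near (0 : C), h v = h 0.
Proof.
move=> hh h0 hmin.
have /(maximum_modulus (holo1V hh h0)) : \forall v \near (0 : C), N (h v)^-1 <= N (h 0)^-1.
  have hp : 0 < N (h 0) by rewrite modulus_gt0.
  by apply: filterS hmin => v hv; rewrite !modulusV lef_pV2// posrE// (lt_le_trans hp).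
by apply: filterS => v /invr_inj.
Qed.

(** Otherwise |g| attains a positive minimum in the open disc.  Among the minimum
    points take one of largest modulus: by the minimum modulus principle g is
    constant near it, which yields a minimum point of larger modulus. *)
Lemma disc_has_zero (g : C -> C) (rho delta : R) : 0 < rho ->
  (forall v, N v <= rho -> holo1 (fun t => g (v + t))) ->
  (forall v, N v = rho -> delta <= N (g v)) -> N (g 0) < delta ->
  exists2 v, N v <= rho & g v = 0.
Proof.
move=> r0 gh gb g0; apply: contrapT => nz.
have gn v : N v <= rho -> g v != 0.
  by move=> vr; apply/eqP => gv; apply: nz; exists v.
pose D : set C := [set v | N v <= rho].
have cD : compact D := @compact_disc _ rho.
have gc v : D v -> forall e, 0 < e -> \forall z \near v, N (g z - g v) < e.
  move=> Dv e e0; have /nearC_ball[r rp Hr] := holo1_near_close (gh v Dv) e0.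
  apply/nearC_ball; exists r => // z zv; have := Hr (z - v).
  by rewrite subr0 addr0 [v + (z - v)]addrC subrK; apply.
have Ngc : {within D, continuous (fun v => - N (g v))}.
  apply: continuous_in_subspaceT => v; rewrite inE => Dv.
  apply: cvg_nearR => e e0; apply: filterS (gc v Dv e e0) => z zv.
  apply: le_lt_trans zv; rewrite ler_norml.
  have := modulusD (g z - g v) (g v); rewrite subrK.
  have := modulusD (g v - g z) (g z); rewrite subrK modulusBC.
  lra.
have D0 : D 0 by rewrite /D /= modulus0 ltW.
have [v1 Dv1 v1min] := compact_EVT_max (ex_intro _ _ D0) cD Ngc.
rewrite inE in Dv1; pose m := N (g v1).
have minm v : D v -> m <= N (g v).
  by move=> Dv; have := v1min v (mem_set Dv); rewrite lerN2.
pose S := D `&` [set v | N (g v) = m].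
have clD : closed D.
  exact: compact_closed (@norm_hausdorff _ _) cD.
have cS : compact S.
  apply: (subclosed_compact _ cD) => [|v []//].
  move=> z zS.
  have Dz : D z by apply: clD; apply: closureS zS => v [].
  split => //=; apply/eqP; rewrite eq_le minm// andbT leNgt; apply/negP => mz.
  have e0 : 0 < N (g z) - m by rewrite subr_gt0.
  have [v [[Dv /= vm] zv]] := zS _ (gc z Dz _ e0).
  have := modulusD (g z - g v) (g v); rewrite subrK modulusBC vm.
  by move: zv; lra.
have Nc : {within S, continuous (fun v : C => N v)}.
  apply: continuous_subspaceT => v; apply: cvg_nearR => e e0.
  apply/nearC_ball; exists e => // z; apply: le_lt_trans; rewrite ler_norml.
  have := modulusD (z - v) v; rewrite subrK.
  have := modulusD (v - z) z; rewrite subrK modulusBC.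
  lra.
have [v0 Sv0 v0max] := compact_EVT_max (ex_intro _ _ (conj Dv1 erefl)) cS Nc.
rewrite inE in Sv0; case: Sv0 => Dv0 /= gv0.
have mdelta : m < delta by apply: le_lt_trans g0; apply: minm.
have v0r : N v0 < rho.
  rewrite lt_neqAle Dv0 andbT; apply/eqP => E.
  by have := gb _ E; rewrite gv0 leNgt mdelta.
have h0 : g (v0 + 0) != 0 by rewrite addr0 gn.
have inD : \forall t \near (0 : C), D (v0 + t).
  apply/nearC_ball; exists (rho - N v0); first by rewrite subr_gt0.
  by move=> t; rewrite subr0 /D /= => Nt; rewrite (le_trans (modulusD _ _))//; lra.
have hmin : \forall t \near (0 : C), N (g (v0 + 0)) <= N (g (v0 + t)).
  by apply: filterS inD => t Dt; rewrite addr0 gv0 minm.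
have /nearC_ball[r rp Hr] := near_and inD (minimum_modulus (gh _ Dv0) h0 hmin).
(* v0 + t is farther from the origin than v0. *)
pose t := if v0 == 0 then ofR (r / 2) else ofR (r / 2 / N v0) * v0.
have r2 : 0 < r / 2 by lra.
have tr : N t = r / 2.
  rewrite /t; case: eqVneq => [_|v00]; first by rewrite modulus_ofR gtr0_norm.
  have Nv0 : 0 < N v0 by rewrite modulus_gt0.
  by rewrite modulusM modulus_ofR gtr0_norm ?divr_gt0// divfK ?gt_eqF.
have [|Dt gt] := Hr t; first by rewrite subr0 tr; lra.
have := v0max (v0 + t); rewrite inE => /(_ _).
have -> : N (v0 + t) = N v0 + r / 2.
  rewrite /t; case: eqVneq => [->|v00]; first by rewrite add0r modulus_ofR modulus0 gtr0_norm// add0r.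
  have Nv0 : 0 < N v0 by rewrite modulus_gt0.
  rewrite -{1}(mul1r v0) (_ : 1 = ofR 1)// -mulrDl -ofRD modulusM modulus_ofR gtr0_norm; last first.
    by rewrite addr_gt0// divr_gt0.
  by rewrite mulrDl mul1r divfK ?gt_eqF.
move=> /(_ _) H; have : N v0 + r / 2 <= N v0.
  by apply: H; split => //=; rewrite gt addr0 gv0.
lra.
Qed.

End Modulus_principle.

(** * Functions of two variables vanishing only on the axes *)

Section TwoVars.
Context {R : realType}.
Local Notation C := (Cx R).
Local Notation N := modulus.

Definition crd0 (x : 'rV[C]_2) : C := x 0 0.
Definition crd1 (x : 'rV[C]_2) : C := x 0 1.
Definition row2 (u v : C) : 'rV[C]_2 := \row_j (if j == 0 then u else v).

Lemma row2_0 u v : crd0 (row2 u v) = u. Proof. by rewrite /crd0 /crd1 mxE. Qed.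
Lemma row2_1 u v : crd1 (row2 u v) = v. Proof. by rewrite /crd0 /crd1 mxE. Qed.
Definition row2E := (row2_0, row2_1).
Lemma row2_eta (x : 'rV[C]_2) : row2 (crd0 x) (crd1 x) = x.
Proof.
apply/rowP => j; rewrite mxE; case: eqVneq => [->//|j0].
by congr (x _ _); apply: val_inj; case: j j0 => [[|[|]]].
Qed.
Lemma row2_00 : row2 0 0 = 0.
Proof. by apply/rowP => j; rewrite !mxE; case: ifP. Qed.

Lemma polydisc2 r (x : 'rV[C]_2) : polydisc 0 r x <-> (N (crd0 x) <= r /\ N (crd1 x) <= r).
Proof.
split=> [H|[H0 H1] i].
  by have := H 0; have := H 1; rewrite !mxE !subr0.
rewrite mxE subr0 -(row2_eta x) mxE; by case: ifP.
Qed.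

Lemma near_row2 (P : 'rV[C]_2 -> Prop) : (\forall x \near (0 : 'rV[C]_2), P x) <->
  exists2 r, 0 < r & forall u v, N u <= r -> N v <= r -> P (row2 u v).
Proof.
split=> [/near_row_polydisc[r r0 H]|[r r0 H]].
  by exists r => // u v ur vr; apply: H; apply/polydisc2; rewrite !row2E.
by apply/near_row_polydisc; exists r => // x /polydisc2[x0 x1]; rewrite -(row2_eta x); exact: H.
Qed.

Lemma holo_row2 n (f : 'rV[C]_2 -> C) (g h : 'rV[C]_n -> C) a :
  holo g a -> holo h a -> holo f (row2 (g a) (h a)) ->
  holo (fun x => f (row2 (g x) (h x))) a.
Proof. exact: holo_comp2. Qed.

(** Restriction to a parametrized holomorphic curve. *)
Lemma holo1_row2 (f : 'rV[C]_2 -> C) (g h : C -> C) :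
  holo1 g -> holo1 h -> holo f (row2 (g 0) (h 0)) -> holo1 (fun t => f (row2 (g t) (h t))).
Proof. by move=> gh hh fh; apply: holo_row2 => //; rewrite mxE. Qed.

Definition swap (x : 'rV[C]_2) := row2 (crd1 x) (crd0 x).
Lemma swapK : involutive swap.
Proof. by move=> x; rewrite /swap !row2E row2_eta. Qed.
Lemma swap0 : swap 0 = 0.
Proof. by rewrite /swap /crd0 /crd1 !mxE row2_00. Qed.
Lemma near_row_swap (P : 'rV[C]_2 -> Prop) : (\forall x \near (0 : 'rV[C]_2), P x) ->
  \forall x \near (0 : 'rV[C]_2), P (swap x).
Proof.
move=> /near_row2[r r0 H]; apply/near_row2; exists r => // u v ur vr.
by rewrite /swap !row2E; exact: H.
Qed.
Lemma holo_swap f : holo f 0 -> holo (f \o swap) 0.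
Proof.
move=> fh; apply: holo_row2; [exact: holo_coord|exact: holo_coord|].
by rewrite /crd0 /crd1 !mxE row2_00.
Qed.

Lemma polyfun_divide (p : 'rV[C]_2 -> C) : polyfun p ->
  exists2 q, polyfun q & forall x, p x = p (row2 0 (crd1 x)) + crd0 x * q x.
Proof.
elim => [c|i|p1 p2 P1 [q1 Q1 H1] P2 [q2 Q2 H2]|p1 p2 P1 [q1 Q1 H1] P2 [q2 Q2 H2]].
- by exists (fun=> 0) => [|x]; [exact: polyfun_const|rewrite mulr0 addr0].
- exists (fun=> if i == 0 then 1 else 0) => [|x]; first exact: polyfun_const.
  rewrite -{1}(row2_eta x) !mxE; case: eqVneq => [_|_]; first by rewrite mulr1 add0r.
  by rewrite mulr0 addr0.
- by exists (fun x => q1 x + q2 x) => [|x]; [exact: polyfunD|rewrite H1 H2; ring].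
- pose z (j : 'I_2) (x : 'rV[C]_2) := if j == 0 then 0 : C else crd1 x.
  have Hz : polyfun (fun x : 'rV[C]_2 => p1 (row2 0 (crd1 x))).
    apply: (@polyfun_comp _ _ _ _ z) => // j; rewrite /z.
    by case: (j == 0); [exact: polyfun_const|exact: polyfun_coord].
  exists (fun x => p1 (row2 0 (crd1 x)) * q2 x + q1 x * p2 x) => [|x].
    by apply: polyfunD; apply: polyfunM.
  by rewrite {1}(H1 x) mulrDl {1}(H2 x); ring.
Qed.

(** For an approximating polynomial p = p(0, v) + u q, the quotients q are close
    to f / u: for fixed v, the function f - u q is small and vanishes at u = 0,
    so its power series in u bounds it by a small multiple of |u|. *)
Lemma divide_first (f : 'rV[C]_2 -> C) : holo f 0 ->
  (\forall x \near (0 : 'rV[C]_2), crd0 x = 0 -> f x = 0) ->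
  exists2 g, holo g 0 & \forall x \near (0 : 'rV[C]_2), f x = crd0 x * g x.
Proof.
move=> [r1 r10 Hf] /near_row2[r2 r20 f0].
pose r := Num.min r1 r2.
have r0 : 0 < r by rewrite lt_min r10.
have rr1 : r <= r1 by rewrite ge_min lexx.
have rr2 : r <= r2 by rewrite ge_min lexx orbT.
have {}Hf := approx_sub (polydisc_le rr1) Hf.
have line v (k : 'rV[C]_2 -> C) : N v <= r -> poly_approx (polydisc 0 r) k ->
    approx1 r (fun u => k (row2 u v)).
  move=> vr Hk; have := @approx_line _ _ _ _ (row2 0 v) (row2 1 0) r Hk.
  rewrite (_ : (fun v0 => _) = (fun u => k (row2 u v))); last first.
    apply/funext => u; congr k; apply/rowP => j; rewrite !mxE.
    by case: ifP; rewrite ?add0r ?mulr1 ?mulr0 ?addr0.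
  apply=> u ur; apply/polydisc2; rewrite /crd0 /crd1 !mxE /=.
  by rewrite add0r mulr1 mulr0 addr0.
have Hw v : exists w : C -> C, N v <= r -> [/\ approx1 (r / 2) w &
    forall u, N u <= r / 2 -> f (row2 u v) = u * w u].
  have [vr|] := pselect (N v <= r); last by exists (fun=> 0).
  have H := line _ _ vr Hf; have [B B0 HB] := approx1_bounded H.
  have [c [_ Hc]] := power_series r0 H (ltW B0) HB.
  have c0 : c 0%N = 0.
    have := Hc 0 1%N; rewrite modulus0 mul0r expr1 mulr0 big_ord1 expr0 mulr1.
    rewrite f0 ?row2E ?modulus0 ?(ltW r20) ?(le_trans vr)// sub0r modulusN => H0.
    by apply/eqP; rewrite -modulus_eq0 eq_le modulus_ge0 H0//; lra.
  have [|w [wr _ fw]] := approx1_shift r0 (ltW B0) Hc (_ : forall i, (i < 1)%N -> c i = 0).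
    by case.
  by exists w => _; split.
have [w {}Hw] := choice Hw.
have r2' : 0 < r / 2 by lra.
exists (fun x => w (crd1 x) (crd0 x)); last first.
  apply/near_row2; exists (r / 2) => // u v ur vr; rewrite !row2E.
  by have [|_ ->] := Hw v; first lra.
exists (r / 2) => // e e0.
pose e' := e * r / 8.
have e'0 : 0 < e' by rewrite /e' !mulr_gt0.
have [p pp fp] := Hf _ e'0; have [q qq pq] := polyfun_divide pp.
exists q => // x /polydisc2[]; set u0 := crd0 x; set v := crd1 x => u0r vr.
have vr' : N v <= r by lra.
have [wr fw] := Hw v vr'.
(* The estimate off the axis {u = 0}; on the axis it follows by continuity. *)
have off u : u != 0 -> N u <= r / 2 -> N (w v u - q (row2 u v)) <= e / 2.
  move=> un ur; have Nu : 0 < N u by rewrite modulus_gt0.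
  pose k (x : 'rV[C]_2) := f x + - (crd0 x * q x).
  have kb u' : N u' <= r -> N (k (row2 u' v)) <= 2 * e'.
    move=> u'r; rewrite /k row2E.
    have -> : f (row2 u' v) + - (u' * q (row2 u' v)) =
      (f (row2 u' v) - p (row2 u' v)) - (f (row2 0 v) - p (row2 0 v)).
      rewrite (pq (row2 u' v)) !row2E (f0 0 v) ?row2E ?modulus0 ?(ltW r20) ?(le_trans vr')//; ring.
    rewrite (le_trans (modulusB _ _))// mulr_natl mulr2n lerD// fp//; apply/polydisc2; rewrite !row2E//.
    by rewrite modulus0 (ltW r0).
  have Hk : approx1 r (fun u => k (row2 u v)).
    apply: line => //; apply: approxD => //; apply: approx_polyfun.
    under eq_fun do rewrite -mulN1r.
    apply: polyfunM; first exact: polyfun_const.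
    by apply: polyfunM => //; exact: polyfun_coord.
  have [|c [_ Hc]] := power_series r0 Hk _ kb; first lra.
  have k0 : k (row2 0 v) = 0.
    by rewrite /k row2E mul0r oppr0 addr0 f0 ?row2E ?modulus0 ?(ltW r20) ?(le_trans vr').
  have c0 : c 0%N = 0.
    have := Hc 0 1%N; rewrite modulus0 mul0r expr1 mulr0 big_ord1 expr0 mulr1.
    rewrite k0 sub0r modulusN => H0.
    by apply/eqP; rewrite -modulus_eq0 eq_le modulus_ge0 H0//; lra.
  have := Hc u 1%N ur; rewrite big_ord1 expr0 mulr1 c0 subr0 expr1 /k row2E fw//.
  rewrite -mulrBr modulusM /e'.
  have -> : 2 * (2 * (e * r / 8)) * (N u / r) = N u * (e / 2) by field; rewrite gt_eqF.
  by rewrite ler_pM2l.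
have [u00|u00] := eqVneq u0 0; last by have := off u0 u00 u0r; rewrite row2_eta; lra.
rewrite u00; have e4 : 0 < e / 4 by lra.
have wh : holo1 (w v) by apply/holo1P; exists (r / 2).
have qh : holo1 (fun u => q (row2 u v)).
  apply: (@holo1_row2 q id (fun=> v)); [exact: holo1_id|exact: holo1_const|].
  exact: holo_polyfun.
have /near0_disc[s s0 Hs] := near_and (holo1_near_close wh e4) (holo1_near_close qh e4).
pose t := Num.min s (r / 2).
have t0 : 0 < t by rewrite lt_min s0.
have Nt : N (ofR t) = t by rewrite modulus_ofR gtr0_norm.
have [|h1 h2] := Hs (ofR t); first by rewrite Nt ge_min lexx.
have h3 : N (w v (ofR t) - q (row2 (ofR t) v)) <= e / 2.
  by apply: off; rewrite ?Nt ?ge_min ?lexx ?orbT// -modulus_gt0 Nt.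
have -> : q x = q (row2 0 v) by rewrite -u00 row2_eta.
have -> : w v 0 - q (row2 0 v) = (w v (ofR t) - q (row2 (ofR t) v)) -
   ((w v (ofR t) - w v 0) - (q (row2 (ofR t) v) - q (row2 0 v))) by ring.
have := modulusB (w v (ofR t) - q (row2 (ofR t) v))
   ((w v (ofR t) - w v 0) - (q (row2 (ofR t) v) - q (row2 0 v))).
have := modulusB (w v (ofR t) - w v 0) (q (row2 (ofR t) v) - q (row2 0 v)).
lra.
Qed.

Lemma divide_second (f : 'rV[C]_2 -> C) : holo f 0 ->
  (\forall x \near (0 : 'rV[C]_2), crd1 x = 0 -> f x = 0) ->
  exists2 g, holo g 0 & \forall x \near (0 : 'rV[C]_2), f x = crd1 x * g x.
Proof.
move=> fh f0; have [|g gh fg] := divide_first (holo_swap fh).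
  by apply: filterS (near_row_swap f0) => x; rewrite /= /swap !row2E.
exists (g \o swap); first exact: holo_swap.
by apply: filterS (near_row_swap fg) => x; rewrite /= swapK /swap !row2E.
Qed.

Lemma near_axis0 (P : 'rV[C]_2 -> Prop) : (\forall v \near (0 : C), P (row2 0 v)) ->
  \forall x \near (0 : 'rV[C]_2), crd0 x = 0 -> P x.
Proof.
move=> /near0_disc[r r0 H]; apply/near_row2; exists r => // u v _ vr.
by rewrite row2E => ->; exact: H.
Qed.

(** Hurwitz: f(0, v) has a zero at v = 0 and is bounded below on a small circle,
    so for small u the function f(u, v) of v has a zero in the disc; for nonzero
    u that zero can only be at v = 0, hence f(u, 0) = 0. *)
Lemma vanishes_on_second_axis (f : 'rV[C]_2 -> C) : holo f 0 -> f 0 = 0 ->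
  (\forall x \near (0 : 'rV[C]_2), f x = 0 -> crd0 x = 0 \/ crd1 x = 0) ->
  ~ (\forall x \near (0 : 'rV[C]_2), crd0 x = 0 -> f x = 0) ->
  \forall x \near (0 : 'rV[C]_2), crd1 x = 0 -> f x = 0.
Proof.
move=> fh f0 fz f_nz.
have hh : holo1 (fun v => f (row2 0 v)).
  by apply: holo1_row2; rewrite ?row2_00//; [exact: holo1_const|exact: holo1_id].
case: (holo1_order hh) => [h0|[k [w [wh w0 hw]]]].
  by exfalso; apply: f_nz; exact: near_axis0.
have w2 : 0 < N (w 0) / 2 by rewrite divr_gt0// modulus_gt0.
have /near0_disc[r1 r10 H1] := near_and hw (holo1_near_close wh w2).
have /near_row2[r2 r20 H2] := near_and fz (holo_near fh).
case: fh => r3 r30 H3.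
pose rho := Num.min r1 (Num.min r2 r3).
have rho0 : 0 < rho by rewrite !lt_min r10 r20.
have rho1 : rho <= r1 by rewrite ge_min lexx.
have rho2 : rho <= r2 by rewrite !ge_min lexx orbT.
have rho3 : rho <= r3 by rewrite !ge_min lexx !orbT.
have {}H3 := approx_sub (polydisc_le rho3) H3.
pose d := rho ^+ k * (N (w 0) / 2).
have d0 : 0 < d by rewrite mulr_gt0// exprn_gt0.
have hd v : N v = rho -> d <= N (f (row2 0 v)).
  move=> vr; have [|-> wv] := H1 v; first by rewrite vr.
  rewrite modulusM modulusX vr ler_wpM2l ?exprn_ge0 ?(ltW rho0)//.
  by have := modulusD (w 0 - w v) (w v); rewrite subrK modulusBC; lra.
have [|p pp fp] := H3 (d / 8); first lra.
have [q qq pq] := polyfun_divide pp.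
have [B B0 HB] := polyfun_bounded 0 rho qq.
pose eta := Num.min rho (d / (8 * B)).
have B8 : 0 < 8 * B by rewrite mulr_gt0.
have eta0 : 0 < eta by rewrite lt_min rho0 divr_gt0.
have eta1 : eta <= rho by rewrite ge_min lexx.
have etaB : eta * B <= d / 8.
  have : eta <= d / (8 * B) by rewrite ge_min lexx orbT.
  rewrite ler_pdivlMr//; lra.
have dev u v : N u <= eta -> N v <= rho -> N (f (row2 u v) - f (row2 0 v)) <= 3 * d / 8.
  move=> ur vr; have ur' := le_trans ur eta1.
  have in1 : polydisc 0 rho (row2 u v) by apply/polydisc2; rewrite !row2E.
  have in2 : polydisc 0 rho (row2 0 v) by apply/polydisc2; rewrite !row2E modulus0 ltW.
  have h1 := fp _ in1; have h2 := fp _ in2.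
  have h3 : N (u * q (row2 u v)) <= d / 8.
    by rewrite modulusM (le_trans _ etaB)// ler_pM ?modulus_ge0 ?HB.
  have -> : f (row2 u v) - f (row2 0 v) = (f (row2 u v) - p (row2 u v)) -
     ((f (row2 0 v) - p (row2 0 v)) - u * q (row2 u v)).
    by rewrite (pq (row2 u v)) !row2E; ring.
  have := modulusB (f (row2 u v) - p (row2 u v)) ((f (row2 0 v) - p (row2 0 v)) - u * q (row2 u v)).
  have := modulusB (f (row2 0 v) - p (row2 0 v)) (u * q (row2 u v)).
  lra.
apply/near_row2; exists eta => // u v ur _; rewrite row2E => ->.
have [->|u0] := eqVneq u 0; first by rewrite row2_00.
have ur' := le_trans ur eta1.
have [||||v' v'r fv'] := @disc_has_zero R (fun v => f (row2 u v)) rho (d / 2).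
- exact: rho0.
- move=> v' v'r; apply: holo1_row2.
  + exact: holo1_const.
  + by apply: holo1D; [exact: holo1_const|exact: holo1_id].
  + by rewrite addr0; case: (H2 u v'); rewrite ?(le_trans ur')// ?(le_trans v'r).
- move=> v' v'r; have := hd _ v'r; have := dev u v' ur; rewrite v'r lexx => /(_ isT).
  have := modulusD (f (row2 0 v') - f (row2 u v')) (f (row2 u v')); rewrite subrK modulusBC; lra.
- have := dev u 0 ur; rewrite modulus0 row2_00 f0 subr0 => /(_ (ltW rho0)); lra.
have [||H _] := H2 u v'; rewrite ?(le_trans ur')// ?(le_trans v'r)//.
have := H fv'; rewrite !row2E; case=> [u00|v0]; first by rewrite u00 eqxx in u0.
by move: fv' => /=; rewrite v0.
Qed.

(** Induction on the order k of f on the diagonal.  A function that vanishes at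
    the origin vanishes on one of the axes by [vanishes_on_second_axis]; dividing
    by that coordinate lowers k by one. *)
Lemma normal_form_aux k (f : 'rV[C]_2 -> C) : holo f 0 ->
  (\forall x \near (0 : 'rV[C]_2), f x = 0 -> crd0 x = 0 \/ crd1 x = 0) ->
  (exists w, [/\ holo1 w, w 0 != 0 &
    \forall t \near (0 : C), t != 0 -> f (row2 t t) = t ^+ k * w t]) ->
  exists a b U, [/\ holo U 0, U 0 != 0 &
    \forall x \near (0 : 'rV[C]_2), f x = crd0 x ^+ a * crd1 x ^+ b * U x].
Proof.
elim: k f => [|k IH] f fh fz [w [wh w0 fw]];
  (have [f0|f0] := eqVneq (f 0) 0; last first).
- exists 0%N, 0%N, f; split => //.
  by apply: filterE => x; rewrite !expr0 !mul1r.
- exfalso.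
  have diag g : holo g 0 -> (\forall t \near (0 : C), f (row2 t t) = t * g (row2 t t)) -> False.
    move=> gh fg.
    have dh : holo1 (fun t => t * g (row2 t t) + (-1) * w t).
      apply: holo1D; apply: holo1M => //; [exact: holo1_id| |exact: holo1_const].
      by apply: holo1_row2; rewrite ?row2_00//; exact: holo1_id.
    have /nearC_ball[r r0 Hr] := near_and fg fw.
    have /nbhs_singleton : \forall t \near (0 : C), t * g (row2 t t) + (-1) * w t = 0.
      apply: (holo1_zeros dh) => e e0; pose m := Num.min r e / 2.
      have h1 : 0 < Num.min r e by rewrite lt_min r0.
      have h2 : Num.min r e <= r by rewrite ge_min lexx.
      have h3 : Num.min r e <= e by rewrite ge_min lexx orbT.
      have m0 : 0 < m by rewrite divr_gt0.
      have mr : m < r by rewrite /m; lra.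
      have me : m < e by rewrite /m; lra.
      have Nm : N (ofR m) = m by rewrite modulus_ofR gtr0_norm.
      have m00 : ofR m != 0 by rewrite -modulus_gt0 Nm.
      exists (ofR m); split; rewrite ?Nm//.
      have [|E1 E2] := Hr (ofR m); first by rewrite subr0 Nm.
      by rewrite -E1 E2// expr0; ring.
    rewrite mul0r add0r mulN1r => /eqP; rewrite oppr_eq0; exact/negP.
  have diagR g : (\forall x \near (0 : 'rV[C]_2), f x = crd0 x * g x) \/
      (\forall x \near (0 : 'rV[C]_2), f x = crd1 x * g x) ->
      \forall t \near (0 : C), f (row2 t t) = t * g (row2 t t).
    by case=> /near_row2[r r0 H]; apply/near0_disc; exists r => // t tr; rewrite H// row2E.
  have [fu|fu] := pselect (\forall x \near (0 : 'rV[C]_2), crd0 x = 0 -> f x = 0).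
    have [g gh fg] := divide_first fh fu; apply: (diag g gh); apply: diagR; by left.
  have [g gh fg] := divide_second fh (vanishes_on_second_axis fh f0 fz fu).
  by apply: (diag g gh); apply: diagR; right.
- exists 0%N, 0%N, f; split => //.
  by apply: filterE => x; rewrite !expr0 !mul1r.
have quot g (cr : 'rV[C]_2 -> C) : (forall t, cr (row2 t t) = t) ->
    (\forall x \near (0 : 'rV[C]_2), f x = cr x * g x) ->
    (\forall x \near (0 : 'rV[C]_2), g x = 0 -> crd0 x = 0 \/ crd1 x = 0) /\
    (exists w, [/\ holo1 w, w 0 != 0 &
    \forall t \near (0 : C), t != 0 -> g (row2 t t) = t ^+ k * w t]).
  move=> crt fg; split.
    by apply: filterS (near_and fz fg) => x [Hx Ex] gx; apply: Hx; rewrite Ex gx mulr0.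
  exists w; split => //.
  move: fg => /near_row2[r r0 H]; have hr : \forall t \near (0 : C), N t <= r.
    by apply/near0_disc; exists r.
  apply: filterS (near_and fw hr) => t [ft tr] t0; apply: (mulfI t0).
  by rewrite mulrA -exprS -ft// H// crt.
have [fu|fu] := pselect (\forall x \near (0 : 'rV[C]_2), crd0 x = 0 -> f x = 0).
  have [g gh fg] := divide_first fh fu.
  have [gz gw] := quot g crd0 (fun t => row2_0 t t) fg.
  have [a [b [U [Uh U0 HU]]]] := IH g gh gz gw.
  exists a.+1, b, U; split => //.
  by apply: filterS (near_and fg HU) => x [-> ->]; rewrite exprS; ring.
have [g gh fg] := divide_second fh (vanishes_on_second_axis fh f0 fz fu).
have [gz gw] := quot g crd1 (fun t => row2_1 t t) fg.
have [a [b [U [Uh U0 HU]]]] := IH g gh gz gw.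
exists a, b.+1, U; split => //.
by apply: filterS (near_and fg HU) => x [-> ->]; rewrite exprS; ring.
Qed.

(** A function of two variables whose zeros lie on the coordinate axes is a
    monomial times a unit. *)
Lemma normal_form (f : 'rV[C]_2 -> C) : holo f 0 ->
  (\forall x \near (0 : 'rV[C]_2), f x = 0 -> crd0 x = 0 \/ crd1 x = 0) ->
  exists a b U, [/\ holo U 0, U 0 != 0 &
    \forall x \near (0 : 'rV[C]_2), f x = crd0 x ^+ a * crd1 x ^+ b * U x].
Proof.
move=> fh fz.
have dh : holo1 (fun t => f (row2 t t)).
  by apply: holo1_row2; rewrite ?row2_00//; exact: holo1_id.
case: (holo1_order dh) => [/near0_disc[r r0 Hr]|[k [w [wh w0 hw]]]]; last first.
  apply: (@normal_form_aux k) => //; exists w; split => //.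
  by apply: filterS hw => t ->.
move: fz => /near_row2[s s0 Hs]; pose t := Num.min r s.
have t0 : 0 < t by rewrite lt_min r0.
have Nt : N (ofR t) = t by rewrite modulus_ofR gtr0_norm.
have t00 : ofR t != 0 by rewrite -modulus_gt0 Nt.
have := Hs (ofR t) (ofR t); rewrite Nt ge_min lexx orbT !row2E => /(_ isT isT).
rewrite Hr ?Nt ?ge_min ?lexx// => /(_ erefl).
by case=> E; rewrite E eqxx in t00.
Qed.

End TwoVars.

(** * Connected sets *)

Section Connectedness.
Context {Y : topologicalType}.

(** A property that is locally always true or always false on a connected set,
    and true somewhere, is true everywhere. *)
Lemma connected_dichotomy (E G : set Y) : connected E ->
  (forall y, E y -> (\forall z \near y, E z -> G z) \/ (\forall z \near y, E z -> ~ G z)) ->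
  (exists2 y, E y & G y) -> E `<=` G.
Proof.
move=> cE dich [y0 Ey0 Gy0].
pose U : set Y := [set y : Y | nbhs y [set z | E z -> G z]].
pose V : set Y := [set y : Y | nbhs y [set z | E z -> ~ G z]].
have oU : open U.
  by rewrite openE => y Uy; apply: (nbhs_interior Uy).
have oV : open V.
  by rewrite openE => y Vy; apply: (nbhs_interior Vy).
have UG y : E y -> U y -> G y by move=> Ey /nbhs_singleton; exact.
have H : E `&` U = E.
  apply: cE.
  - exists y0; split => //; case: (dich _ Ey0) => // /nbhs_singleton H.
    by case: (H Ey0).
  - by exists U.
  - exists (~` V); first exact: open_closedC.
    apply/seteqP; split => y [Ey Hy]; split => //.
      by move=> /nbhs_singleton/(_ Ey); apply; exact: UG.
    by case: (dich _ Ey) => // /Hy.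
by move=> y Ey; apply: UG => //; move: Ey; rewrite -{1}H => -[].
Qed.

End Connectedness.

(** * Growth and quotients of functions along a curve *)

Section Charts.
Context {R : realType} {Y : topologicalType}.
Local Notation C := (Cx R).
Local Notation N := modulus.
Implicit Types (k : 'rV[C]_2 -> Y) (E : set Y) (F H : Y -> C) (y : Y).

(** k is continuous and open at x, as an equality of neighbourhood filters. *)
Definition homeo_at k x := forall P : set Y, nbhs (k x) P <-> nbhs x (k @^-1` P).

Definition chart_at y k : Prop :=
  [/\ k 0 = y, \forall x \near (0 : 'rV[C]_2), homeo_at k x &
      exists2 r, 0 < r & forall x x', polydisc 0 r x -> polydisc 0 r x' ->
        k x = k x' -> x = x'].

Definition monomial k F a b : Prop :=
  exists U, [/\ holo U 0, U 0 != 0 &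
    \forall x \near (0 : 'rV[C]_2), F (k x) = crd0 x ^+ a * crd1 x ^+ b * U x].

Definition first_axis k E : Prop :=
  \forall x \near (0 : 'rV[C]_2), E (k x) <-> crd0 x = 0.

Lemma chart_at_near y k (P : set Y) : chart_at y k ->
  (\forall z \near y, P z) <-> (\forall x \near (0 : 'rV[C]_2), P (k x)).
Proof. by case=> <- /nbhs_singleton h _; exact: h. Qed.

Lemma chart_at_swap y k : chart_at y k -> chart_at y (k \o swap).
Proof.
move=> [k0 kh [r r0 ki]]; split.
- by rewrite /= swap0.
- have := near_row_swap kh; apply: filterS => x hx P.
  apply: (iff_trans (hx P)); split=> /near_row_ball[s s0 H]; apply/near_row_ball; exists s => // z zs.
    apply: H => i; rewrite /swap /row2 !mxE; case: ifP => _; exact: zs.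
  rewrite -(swapK z); apply: H => i.
  rewrite -[x]swapK /swap /row2 /crd0 /crd1 !mxE /=; case: ifP => _; have := zs 0; have := zs 1;
  by rewrite /swap /row2 /crd0 /crd1 !mxE.
- exists r => // x x' xr xr' /ki E0; rewrite -(swapK x) -(swapK x') E0//.
  + by move: xr => /polydisc2[a b]; apply/polydisc2; rewrite /swap !row2E.
  + by move: xr' => /polydisc2[a b]; apply/polydisc2; rewrite /swap !row2E.
Qed.

Lemma monomial_swap k F a b : monomial k F a b -> monomial (k \o swap) F b a.
Proof.
case=> U [Uh U0 HU]; exists (U \o swap); split; [exact: holo_swap|by rewrite /= swap0|].
have := near_row_swap HU; apply: filterS => x /= ->; rewrite /swap !row2E; ring.
Qed.

Lemma chart_axis_points y k E r : chart_at y k -> first_axis k E -> 0 < r ->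
  \forall z \near y, E z -> exists2 v, N v <= r & z = k (row2 0 v).
Proof.
move=> ck kE r0; apply/(chart_at_near _ ck).
apply: filterS (near_and kE (near_polydisc 0 r0)) => x [Ex /polydisc2[_ xr]] /Ex x0.
by exists (crd1 x) => //; rewrite -x0 row2_eta.
Qed.

(** |F|^be and |H|^al bound each other near e up to a constant.  This expresses,
    with no reference to coordinates, that the orders of F and H at e are in the
    ratio al / be. *)
Definition power_comparable F H (al be : nat) (e : Y) : Prop :=
  exists2 M : R, 0 < M & \forall z \near e,
    N (F z) ^+ be <= M * N (H z) ^+ al /\ N (H z) ^+ al <= M * N (F z) ^+ be.

Lemma comparable_near F H al be e : power_comparable F H al be e ->
  \forall z \near e, power_comparable F H al be z.
Proof. by case=> M M0 /near_join H1; apply: filterS H1 => z Hz; exists M. Qed.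

Lemma pow_dominated (r K : R) p q : 0 < r -> 0 < K ->
  (forall t, 0 < t -> t < r -> t ^+ p <= K * t ^+ q) -> (q <= p)%N.
Proof.
move=> r0 K0 H; rewrite leqNgt; apply/negP => pq.
pose m := Num.min r (Num.min 1 K^-1).
have m0 : 0 < m by rewrite !lt_min r0 ltr01 invr_gt0.
have m1 : m <= 1 by rewrite !ge_min lexx orbT.
have mr : m <= r by rewrite ge_min lexx.
have mK : m <= K^-1 by rewrite !ge_min lexx !orbT.
have t0 : 0 < m / 2 by lra.
have := H (m / 2) t0 _; have -> : m / 2 < r by lra.
move=> /(_ isT); have -> : q = (p + (q - p).-1.+1)%N by lia.
rewrite exprD mulrCA -[X in X <= _]mulr1 ler_pM2l ?exprn_gt0//.
have tq : (m / 2) ^+ (q - p).-1.+1 <= m / 2.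
  rewrite exprS ler_piMr ?(ltW t0)//; apply: exprn_ile1; lra.
have KmK : K * m <= 1 by rewrite -(mulfV (lt0r_neq0 K0)) ler_wpM2l// ltW.
move=> H1; have := ler_wpM2l (ltW K0) tq; nra.
Qed.

Lemma holo_unit_bounds (f : 'rV[C]_2 -> C) (x0 : 'rV[C]_2) : holo f x0 -> f x0 != 0 ->
  \forall x \near x0, N (f x0) / 2 <= N (f x) /\ N (f x) <= 2 * N (f x0).
Proof.
move=> fh f0; have Nf : 0 < N (f x0) by rewrite modulus_gt0.
have e0 : 0 < N (f x0) / 2 by lra.
have /cvg_rowC_modulusP/(_ _ e0) := holo_continuous fh.
apply: filterS => x; have := modulusD (f x - f x0) (f x0); rewrite subrK.
have := modulusD (f x0 - f x) (f x); rewrite subrK modulusBC; lra.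
Qed.

Lemma holo_near_neq0 (f : 'rV[C]_2 -> C) (x0 : 'rV[C]_2) : holo f x0 -> f x0 != 0 ->
  \forall x \near x0, f x != 0.
Proof.
move=> fh f0; apply: filterS (holo_unit_bounds fh f0) => x [h _].
by rewrite -modulus_gt0; apply: lt_le_trans h; rewrite divr_gt0// modulus_gt0.
Qed.

(** If F and H are u^a and u^b times units, then |F|^be and |H|^al compare like
    the powers |u|^(a be) and |u|^(b al). *)
Lemma comparable_axis k x0 F H a b (phi psi : 'rV[C]_2 -> C) :
  homeo_at k x0 -> crd0 x0 = 0 ->
  holo phi x0 -> phi x0 != 0 -> holo psi x0 -> psi x0 != 0 ->
  (\forall x \near x0, F (k x) = crd0 x ^+ a * phi x) ->
  (\forall x \near x0, H (k x) = crd0 x ^+ b * psi x) ->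
  forall al be, power_comparable F H al be (k x0) <-> (a * be = b * al)%N.
Proof.
move=> kh x00 ph p0 sh s0 HF HH al be.
have bp := holo_unit_bounds ph p0; have bs := holo_unit_bounds sh s0.
have Np : 0 < N (phi x0) by rewrite modulus_gt0.
have Ns : 0 < N (psi x0) by rewrite modulus_gt0.
pose A := (2 * N (phi x0)) ^+ be; pose A' := (N (phi x0) / 2) ^+ be.
pose B := (2 * N (psi x0)) ^+ al; pose B' := (N (psi x0) / 2) ^+ al.
have A0 : 0 < A by rewrite exprn_gt0// mulr_gt0.
have A'0 : 0 < A' by rewrite exprn_gt0// divr_gt0.
have B0 : 0 < B by rewrite exprn_gt0// mulr_gt0.
have B'0 : 0 < B' by rewrite exprn_gt0// divr_gt0.
have est : \forall x \near x0,
   [/\ N (F (k x)) ^+ be <= A * N (crd0 x) ^+ (a * be),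
       A' * N (crd0 x) ^+ (a * be) <= N (F (k x)) ^+ be,
       N (H (k x)) ^+ al <= B * N (crd0 x) ^+ (b * al) &
       B' * N (crd0 x) ^+ (b * al) <= N (H (k x)) ^+ al].
  apply: filterS (near_and (near_and bp bs) (near_and HF HH)) => x [[[p1 p2] [s1 s2]] [-> ->]].
  rewrite !modulusM !modulusX !exprMn -!exprM ![_ * N (crd0 x) ^+ _]mulrC.
  have pw (u v : R) n c : 0 <= u -> u <= v -> N (crd0 x) ^+ c * u ^+ n <= N (crd0 x) ^+ c * v ^+ n.
    move=> u0 uv; rewrite ler_wpM2l ?exprn_ge0 ?modulus_ge0//.
    by apply: lerXn2r; rewrite ?nnegrE// (le_trans u0).
  by split; apply: pw; rewrite ?modulus_ge0 ?divr_ge0 ?modulus_ge0.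
split.
- case=> M M0 /kh HM.
  have /near_row_ball[r r0 Hr] := near_and est HM.
  pose D := Num.max (M * B / A') (M * A / B').
  have D0 : 0 < D by rewrite lt_max !divr_gt0 ?mulr_gt0.
  have key t : 0 < t -> t < r ->
    t ^+ (a * be) <= M * B / A' * t ^+ (b * al) /\
    t ^+ (b * al) <= M * A / B' * t ^+ (a * be).
    move=> t0 tr; pose x := row2 (ofR t) (crd1 x0).
    have Nt : N (ofR t) = t by rewrite modulus_ofR gtr0_norm.
    have [|[h1 h2 h3 h4] [h5 h6]] := Hr x.
      move=> i; rewrite /x /row2 mxE; case: ifP => [/eqP ->|i0].
        by rewrite -/(crd0 x0) x00 subr0 Nt.
      rewrite (_ : i = 1) ?subrr ?modulus0//; apply: val_inj; case: i i0 => [[|[|]]]//.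
    rewrite /x !row2E Nt in h1 h2 h3 h4.
    rewrite ![_ / _ * _]mulrAC !ler_pdivlMr// ![_ * A']mulrC ![_ * B']mulrC.
    split; first by rewrite (le_trans h2)// (le_trans h5)// -mulrA ler_wpM2l// ltW.
    by rewrite (le_trans h4)// (le_trans h6)// -mulrA ler_wpM2l// ltW.
  apply/eqP; rewrite eqn_leq; apply/andP; split.
    apply: (@pow_dominated r (M * A / B')) => //; first by rewrite !divr_gt0 ?mulr_gt0.
    by move=> t t0 tr; case: (key t t0 tr).
  apply: (@pow_dominated r (M * B / A')) => //; first by rewrite !divr_gt0 ?mulr_gt0.
  by move=> t t0 tr; case: (key t t0 tr).
- move=> E; exists (A / B' + B / A'); first by rewrite addr_gt0 ?divr_gt0.
  apply/kh; apply: filterS est => x /=; rewrite E; set s := N (crd0 x) ^+ _.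
  have s0' : 0 <= s by rewrite exprn_ge0 ?modulus_ge0.
  move=> [h1 h2 h3 h4].
  have h5 : s <= N (H (k x)) ^+ al / B' by rewrite ler_pdivlMr// mulrC.
  have h6 : s <= N (F (k x)) ^+ be / A' by rewrite ler_pdivlMr// mulrC.
  have P1 : 0 <= B / A' * N (H (k x)) ^+ al by rewrite mulr_ge0 ?exprn_ge0 ?modulus_ge0// divr_ge0 ?ltW.
  have P2 : 0 <= A / B' * N (F (k x)) ^+ be by rewrite mulr_ge0 ?exprn_ge0 ?modulus_ge0// divr_ge0 ?ltW.
  split.
    rewrite (le_trans h1)// mulrDl (le_trans (ler_wpM2l (ltW A0) h5))// mulrA.
    by rewrite [A * _ / _]mulrAC lerDl.
  rewrite (le_trans h3)// mulrDl (le_trans (ler_wpM2l (ltW B0) h6))// mulrA.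
  by rewrite [B * _ / _]mulrAC lerDr.
Qed.

(** E is {u = 0}, and F and H are the monomials u^a v^p and u^b v^q times
    units. *)
Definition adapted F H E y k a b p q : Prop :=
  [/\ chart_at y k, first_axis k E, monomial k F a p & monomial k H b q].

Lemma near_axis (P : 'rV[C]_2 -> Prop) : (\forall x \near (0 : 'rV[C]_2), P x) ->
  exists2 r, 0 < r & forall v, N v <= r -> P (row2 0 v).
Proof.
by move=> /near_row2[r r0 Hr]; exists r => // v vr; apply: Hr; rewrite ?modulus0// ltW.
Qed.

Lemma adapted_axis F H E y k a b p q : adapted F H E y k a b p q ->
  exists2 r, 0 < r &
    (forall v w, N v <= r -> N w <= r -> k (row2 0 v) = k (row2 0 w) -> v = w) /\
    forall v, N v <= r ->
    [/\ homeo_at k (row2 0 v), E (k (row2 0 v)) &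
        v != 0 -> forall al be,
          power_comparable F H al be (k (row2 0 v)) <-> (a * be = b * al)%N].
Proof.
move=> [[k0 kh [r1 r10 ki]] kE [U [Uh U0 HU]] [V [Vh V0 HV]]].
have /near_axis[r2 r20 Hr] := near_and (near_and (near_and kh kE) (near_and (near_join HU) (near_join HV)))
   (near_and (near_and (holo_near Uh) (holo_near_neq0 Uh U0)) (near_and (holo_near Vh) (holo_near_neq0 Vh V0))).
exists (Num.min r1 r2); first by rewrite lt_min r10.
split=> [v w|v]; rewrite ?le_min.
  move=> /andP[vr _] /andP[wr _] /ki E0.
  by rewrite -(row2_1 0 v) E0 ?row2_1//; apply/polydisc2; rewrite !row2E modulus0 (ltW r10).
move=> /andP[vr1 vr2].
have [[[hv Ev] [FU HV']] [[Uv U0v] [Vv V0v]]] := Hr v vr2.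
split => //; first by apply/Ev; rewrite row2E.
- move=> v0 al be.
  have cr (W : 'rV[C]_2 -> C) n : holo W (row2 0 v) -> holo (fun x => crd1 x ^+ n * W x) (row2 0 v).
    by move=> Wh; apply: holoM => //; apply: holoX; exact: holo_coord.
  apply: (@comparable_axis k (row2 0 v) F H a b _ _ hv (row2_0 0 v) (cr U p Uv) _ (cr V q Vv)).
  + by rewrite mulf_neq0// expf_neq0// row2E.
  + by rewrite mulf_neq0// expf_neq0// row2E.
  + by apply: filterS FU => x ->; rewrite mulrA.
  + by apply: filterS HV' => x ->; rewrite mulrA.
Qed.

(** Punctured version of [power_comparable] on E: at a crossing, F and H also
    vanish along the other component, and the comparison may fail at the
    point itself. *)
Definition generically_comparable F H E al be y :=
  \forall e \near y, E e -> e != y -> power_comparable F H al be e.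

(** No point of the axis is isolated in it, even after removing the centre. *)
Lemma axis_points_near k r v (P : set Y) : homeo_at k (row2 0 v) -> N v < r ->
  nbhs (k (row2 0 v)) P -> exists w, [/\ w != 0, w != v, N w <= r & P (k (row2 0 w))].
Proof.
move=> hv vr /hv /near_row_ball[t t0 Ht].
(* Move v by a small positive real d; d < |v| keeps the new point off 0. *)
have [d [d0 dt dr dv]] : exists d : R, [/\ 0 < d, d < t, d < r - N v & v != 0 -> d < N v].
  pose d := Num.min t (Num.min (r - N v) (if v == 0 then 1 else N v)).
  have d0 : 0 < d.
    rewrite !lt_min t0 subr_gt0 vr /=; case: eqVneq => // v0; by rewrite modulus_gt0.
  have d2 : d <= t by rewrite ge_min lexx.
  have d3 : d <= r - N v by rewrite !ge_min lexx orbT.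
  exists (d / 2); split; try lra.
  move=> v0; have : d <= N v by rewrite /d (negbTE v0) !ge_min lexx !orbT.
  lra.
have Nd : N (ofR d) = d by rewrite modulus_ofR gtr0_norm.
exists (v + ofR d); split.
- apply/eqP => E0; have /dv : v != 0.
    by apply/eqP => v0; move: E0; rewrite v0 add0r => /eqP; rewrite -modulus_eq0 Nd gt_eqF.
  by move: E0 => /eqP; rewrite addr_eq0 => /eqP ->; rewrite modulusN Nd ltxx.
- by rewrite -subr_eq0 addrC addKr -modulus_eq0 Nd gt_eqF.
- by rewrite (le_trans (modulusD _ _))// Nd; lra.
- apply: (Ht (row2 0 (v + ofR d))) => i; rewrite /row2 !mxE; case: ifP => _.
    by rewrite subrr modulus0.
  by rewrite [v + _]addrC addrK Nd.
Qed.

(** The condition has the same truth value at all points of E near y, which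
    allows to propagate it along E. *)
Lemma generically_comparableP F H E al be y k a b p q :
  adapted F H E y k a b p q ->
  (generically_comparable F H E al be y <-> (a * be = b * al)%N) /\
  (\forall e \near y, E e ->
     (generically_comparable F H E al be e <-> (a * be = b * al)%N)).
Proof.
move=> ad; have [r r0 [ki Hr]] := adapted_axis ad; have [ck kE _ _] := ad.
have key v : N v < r ->
    (generically_comparable F H E al be (k (row2 0 v)) <-> (a * be = b * al)%N).
  move=> vr; split=> [G|E0].
    have [hv _ _] := Hr v (ltW vr).
    have [w [w0 wv wr Hw]] := axis_points_near hv vr G.
    have [_ Ew Hc] := Hr w wr; apply/(Hc w0); apply: Hw => //.
    by apply: contra_neq wv => /ki; apply => //; exact: ltW.
  have [v0|v0] := eqVneq v 0; last first.
    have [_ _ Hc] := Hr v (ltW vr).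
    have /comparable_near G : power_comparable F H al be (k (row2 0 v)) by apply/Hc.
    by apply: filterS G.
  have -> : k (row2 0 v) = y by rewrite v0 row2_00; case: ck.
  apply: filterS (chart_axis_points ck kE r0) => e He /He[w wr ->] ey.
  have [_ _ Hc] := Hr w wr; apply/Hc => //.
  by apply: contra_neq ey => ->; rewrite row2_00; case: ck.
split.
  by have := key 0; rewrite row2_00 modulus0; case: ck => -> _ _; exact.
have r2 : 0 < r / 2 by lra.
apply: filterS (chart_axis_points ck kE r2) => e He /He[w wr ->].
by apply: key; apply: le_lt_trans wr _; lra.
Qed.

(** The ratio a / b of the orders of F and H along E does not depend on the point
    of the connected curve E. *)
Lemma comparable_exponents F H E al be y0 : connected E ->
  (forall y, E y -> exists k a b p q, adapted F H E y k a b p q) ->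
  E y0 -> power_comparable F H al be y0 ->
  forall y k a b p q, E y -> adapted F H E y k a b p q -> (a * be = b * al)%N.
Proof.
move=> cE charts Ey0 c0 y k a b p q Ey ad.
have [[+ _] _] := generically_comparableP al be ad; apply.
apply: (connected_dichotomy (G := generically_comparable F H E al be) cE) Ey.
  move=> z /charts[k' [a' [b' [p' [q' ad']]]]].
  have [_ near_z] := generically_comparableP al be ad'.
  have [E0|E0] := eqVneq (a' * be)%N (b' * al)%N; [left|right].
    by apply: filterS near_z => e He /He[_]; exact.
  by apply: filterS near_z => e He /He[+ _] G => /(_ G); apply/eqP.
exists y0 => //; apply: filterS (comparable_near c0) => e //.
Qed.

(** Maximum principle on a compact connected curve, for a function that is
    locally the modulus of a holomorphic one: the set where the maximum is
    attained is open and closed. *)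
Lemma modulus_constant E (psi : Y -> R) : compact E -> connected E ->
  (forall y, E y -> exists (k : C -> Y) (g : C -> C), [/\ k 0 = y, holo1 g,
     forall r : R, 0 < r -> \forall z \near y, E z -> exists2 v, N v <= r & z = k v,
     \forall v \near (0 : C), E (k v) &
     \forall v \near (0 : C), psi (k v) = N (g v)]) ->
  forall y z, E y -> E z -> psi y = psi z.
Proof.
move=> cE conE loc.
have psic y e : E y -> 0 < e -> \forall z \near y, E z -> `|psi z - psi y| < e.
  move=> Ey e0; have [k [g [k0 gh near_y _ pg]]] := loc y Ey.
  have /near0_disc[r r0 Hr] := near_and pg (holo1_near_close gh e0).
  have psiy : psi y = N (g 0) by rewrite -k0; case: (Hr 0); rewrite ?modulus0 ?(ltW r0).
  apply: filterS (near_y r r0) => z Hz /Hz[v vr ->]; have [-> ve] := Hr v vr.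
  rewrite psiy; apply: le_lt_trans ve; rewrite ler_norml.
  have := modulusD (g v - g 0) (g 0); rewrite subrK.
  have := modulusD (g 0 - g v) (g v); rewrite subrK modulusBC.
  lra.
suff H y : E y -> exists2 y0, E y0 & forall z, E z -> psi z = psi y0.
  by move=> y z Ey Ez; have [y0 _ Hy] := H y Ey; rewrite !Hy.
move=> Ey.
have wc : {within E, continuous psi}.
  apply/subspace_continuousP => z Ez; apply/(@cvgrPdistC_lt _ _ _ (within E (nbhs z)) _) => e e0.
  by rewrite near_withinE; exact: psic.
have [y0 Ey0 max0] := compact_EVT_max (ex_intro _ y Ey) cE wc.
rewrite inE in Ey0; exists y0 => //.
have {}max0 z : E z -> psi z <= psi y0 by move=> Ez; apply: max0; rewrite inE.
apply: (connected_dichotomy (G := [set z | psi z = psi y0]) conE); last by exists y0.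
move=> z Ez; have [E0|E0] := eqVneq (psi z) (psi y0); [left|right]; last first.
  have e0 : 0 < psi y0 - psi z by rewrite subr_gt0 lt_neqAle E0 max0.
  apply: filterS (psic z _ Ez e0) => w Hw /Hw; rewrite ltr_norml => /andP[_ h] /= E1.
  by move: h; rewrite E1 ltxx.
have [k [g [k0 gh near_z Ek pg]]] := loc z Ez.
have g0 : N (g 0) = psi y0 by have := nbhs_singleton pg; rewrite k0 E0.
have gmax : \forall v \near (0 : C), N (g v) <= N (g 0).
  by apply: filterS (near_and Ek pg) => v [Ev <-]; rewrite g0 max0.
have /near0_disc[r r0 Hr] := near_and pg (maximum_modulus gh gmax).
by apply: filterS (near_z r r0) => w Hw /Hw[v vr ->] /=; have [-> ->] := Hr v vr.
Qed.

(** The value at e of |F|^be / |H|^al, which is 0 / 0 on E, as a limit taken off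
    the zeros of F and H. *)
Definition limit_quotient F H (al be : nat) (e : Y) (L : R) : Prop :=
  forall eps, 0 < eps -> \forall z \near e, F z != 0 -> H z != 0 ->
    `|N (F z) ^+ be / N (H z) ^+ al - L| < eps.

(** In adapted coordinates the powers of u cancel, and the quotient is the
    modulus of v^(p be - q al) times a unit. *)
Lemma adapted_quotient F H E y k a b p q al be : adapted F H E y k a b p q ->
  (a * be = b * al)%N -> (q * al <= p * be)%N ->
  exists (W : 'rV[C]_2 -> C) r, [/\ 0 < r, holo1 (fun v => v ^+ (p * be - q * al) * W (row2 0 v)),
    forall v, N v <= r -> W (row2 0 v) != 0 &
    forall v, N v <= r -> forall L,
      limit_quotient F H al be (k (row2 0 v)) L <->
      L = N (v ^+ (p * be - q * al) * W (row2 0 v))].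
Proof.
move=> [[k0 kh _] kE [U [Uh U0 HU]] [V [Vh V0 HV]]] abE pqE.
set n := (p * be - q * al)%N.
pose W x := U x ^+ be * (V x ^+ al)^-1.
have Wh : holo W 0.
  apply: holoM; first exact: holoX.
  by apply: holoV; [exact: holoX|rewrite expf_neq0].
have W0 : W 0 != 0 by rewrite /W mulf_neq0 ?invr_neq0 ?expf_neq0.
pose h x := crd1 x ^+ n * W x.
have hh : holo h 0 by apply: holoM => //; apply: holoX; exact: holo_coord.
have /near_axis[r r0 Hr] := near_and (near_and kh (holo_near hh))
  (near_and (near_join (near_and HU HV)) (near_and (near_join (near_and (holo_near_neq0 Uh U0) (holo_near_neq0 Vh V0))) (holo_near_neq0 Wh W0))).
exists W, r; split => //.
- have := @holo1_row2 R h (fun=> 0) id (holo1_const 0) holo1_id; rewrite row2_00 => /(_ hh).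
  by rewrite /h; under eq_fun do rewrite row2E.
- by move=> v /Hr[_ [_ [_]]].
- move=> v vr L.
  have [[hv hhv] [HFH [HUV _]]] := Hr v vr.
  have -> : v ^+ n * W (row2 0 v) = h (row2 0 v) by rewrite /h row2E.
  have quot : \forall x \near row2 0 v, F (k x) != 0 -> H (k x) != 0 ->
     N (F (k x)) ^+ be / N (H (k x)) ^+ al = N (h x).
    apply: filterS HFH => x [-> ->]; rewrite !mulf_eq0 !negb_or.
    move=> /andP[/andP[c0a c1p] Ux] /andP[/andP[c0b c1q] Vx].
    rewrite /h /W !(modulusM, modulusX, modulusV) !exprMn.
    have -> : (N (crd0 x) ^+ a) ^+ be = (N (crd0 x) ^+ b) ^+ al by rewrite -!exprM abE.
    have -> : (N (crd1 x) ^+ p) ^+ be = N (crd1 x) ^+ n * (N (crd1 x) ^+ q) ^+ al.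
      by rewrite -!exprM -exprD subnK.
    have nz' (z : C) m : z ^+ m != 0 -> (N z ^+ m) ^+ al != 0.
      by move=> z0; rewrite -modulusX expf_neq0// modulus_eq0.
    have := nz' _ _ c0b; have := nz' _ _ c1q; have := nz' (V x) 1%N Vx; rewrite expr1.
    move: ((N (crd0 x) ^+ b) ^+ al) ((N (crd1 x) ^+ q) ^+ al) (N (V x) ^+ al) => X1 X2 X3 n1 n2 n3.
    by field; rewrite n1 n2 n3.
  have generic : \forall x \near row2 0 v, crd0 x != 0 -> crd1 x != 0 ->
      F (k x) != 0 /\ H (k x) != 0.
    apply: filterS (near_and HFH HUV) => x [[-> ->] [Ux Vx]] c0 c1.
    by split; rewrite !mulf_neq0 ?expf_neq0.
  have cont e : 0 < e -> \forall x \near row2 0 v, N (h x - h (row2 0 v)) < e.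
    by move=> e0; have /cvg_rowC_modulusP := holo_continuous hhv; exact.
  have dist (x w : C) : `|N x - N w| <= N (x - w).
    rewrite ler_norml; have := modulusD (x - w) w; rewrite subrK.
    have := modulusD (w - x) x; rewrite subrK modulusBC; lra.
  have lim : limit_quotient F H al be (k (row2 0 v)) (N (h (row2 0 v))).
    move=> e e0; apply/hv.
    by apply: filterS (near_and quot (cont e e0)) => x [Q ce] Fx Hx; rewrite Q// (le_lt_trans (dist _ _)).
  split=> [HL|->//].
  apply/eqP; rewrite eq_sym -subr_eq0 -normr_eq0 eq_le normr_ge0 andbT.
  apply/ler_addgt0Pl => e e0; rewrite addr0.
  have e2 : 0 < e / 2 by lra.
  have /near_row_ball[s s0 Hs] := near_and generic (near_and (proj1 (hv _) (HL _ e2)) (proj1 (hv _) (lim _ e2))).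
  pose m := s / 2.
  have m0 : 0 < m by rewrite /m; lra.
  have [w wv w0] : exists2 w : C, N (w - v) < s & w != 0.
    have [->|v0] := eqVneq v 0; last by exists v => //; rewrite subrr modulus0.
    by exists (ofR m); rewrite ?subr0 -?modulus_gt0 modulus_ofR gtr0_norm// /m; lra.
  have Nm : N (ofR m) = m by rewrite modulus_ofR gtr0_norm.
  have [|G [h1 h2]] := Hs (row2 (ofR m) w).
    move=> i; rewrite /row2 !mxE; case: ifP => _ //.
    by rewrite subr0 Nm /m; lra.
  have [||nF nH] := G; rewrite ?row2E// -?modulus_gt0 ?Nm//.
  have := h1 nF nH; have := h2 nF nH.
  rewrite !ltr_norml => /andP[a1 a2] /andP[b1 b2]; rewrite ler_norml; lra.
Qed.

Definition quotient_limit F H (al be : nat) (e : Y) : R := xget 0 (limit_quotient F H al be e).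

(** p be - q al is the order at y of the restriction of F^be / H^al to E: without
    poles this function is constant by [modulus_constant], so it has no zero. *)
Lemma no_pole_no_zero F H E al be : compact E -> connected E ->
  (forall y, E y -> exists k a b p q, [/\ adapted F H E y k a b p q,
     (a * be = b * al)%N & (q * al <= p * be)%N]) ->
  forall y k a b p q, E y -> adapted F H E y k a b p q ->
    (a * be = b * al)%N -> (q * al <= p * be)%N -> (q * al = p * be)%N.
Proof.
move=> cE conE charts y k a b p q Ey ad abE pqE.
have value k' a' b' p' q' y' : adapted F H E y' k' a' b' p' q' ->
    (a' * be = b' * al)%N -> (q' * al <= p' * be)%N ->
    exists (W : 'rV[C]_2 -> C) r, [/\ 0 < r,
     holo1 (fun v => v ^+ (p' * be - q' * al) * W (row2 0 v)),
     forall v, N v <= r -> W (row2 0 v) != 0 &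
     forall v, N v <= r -> quotient_limit F H al be (k' (row2 0 v)) =
       N (v ^+ (p' * be - q' * al) * W (row2 0 v))].
  move=> ad' abE' pqE'; have [W [r [r0 h1 h2 h3]]] := adapted_quotient ad' abE' pqE'.
  exists W, r; split => // v vr; have H3 := h3 v vr.
  have L0 : limit_quotient F H al be (k' (row2 0 v)) (N (v ^+ (p' * be - q' * al) * W (row2 0 v))).
    exact/H3.
  by apply/H3; exact: xgetI L0.
have const : forall y z, E y -> E z -> quotient_limit F H al be y = quotient_limit F H al be z.
  apply: (modulus_constant cE conE) => z /charts[k' [a' [b' [p' [q' [ad' abE' pqE']]]]]].
  have [W [r [r0 h1 h2 h3]]] := value _ _ _ _ _ _ ad' abE' pqE'.
  have [ck' kE' _ _] := ad'.
  exists (fun v => k' (row2 0 v)), (fun v => v ^+ (p' * be - q' * al) * W (row2 0 v)).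
  split => //; first by rewrite row2_00; case: ck'.
  - by move=> s s0; exact: chart_axis_points ck' kE' s0.
  - have /near_axis[s s0 Hs] := kE'.
    by apply/near0_disc; exists s => // v /Hs[_]; rewrite row2E; apply.
  - by apply/near0_disc; exists r.
apply/eqP; rewrite eqn_leq pqE leqNgt; apply/negP => lt.
have [W [r [r0 h1 h2 h3]]] := value _ _ _ _ _ _ ad abE pqE.
have [ck kE _ _] := ad.
have /near_axis[s s0 Hs] := kE.
pose t := Num.min r s; have t0 : 0 < t by rewrite lt_min r0.
have tr : t <= r by rewrite ge_min lexx.
have ts : t <= s by rewrite ge_min lexx orbT.
have Nt : N (ofR t) = t by rewrite modulus_ofR gtr0_norm.
have Et : E (k (row2 0 (ofR t))) by apply/Hs; rewrite ?Nt ?row2E.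
have k0 : k (row2 0 0) = y by rewrite row2_00; case: ck.
have : quotient_limit F H al be y = quotient_limit F H al be (k (row2 0 (ofR t))).
  exact: const.
rewrite -{1}k0 h3 ?modulus0 ?(ltW r0)// h3 ?Nt// expr0n subn_eq0 leqNgt lt /= mul0r modulus0.
move/esym/eqP; rewrite modulus_eq0 mulf_eq0 (negbTE (h2 _ _)) ?Nt// orbF expf_eq0 => /andP[_].
by rewrite -modulus_eq0 Nt gt_eqF.
Qed.

End Charts.

(** * Smooth curves in a complex surface *)

Section Frames.
Context {R : realType} {Y : topologicalType}.
Local Notation C := (Cx R).
Local Notation N := modulus.
Implicit Types (A : set (@chart R Y 2)) (c : @chart R Y 2) (E : set Y) (y : Y).

Definition holomorphic A (h : Y -> C) y : Prop :=
  forall c, A c -> dom c y -> holo (h \o param c) (Defs.coord c y).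

Lemma holomorphic_at_holo A h y : holomorphic_at A h y -> holomorphic A h y.
Proof. by move=> H c Ac cy; apply: analytic_holo; exact: H. Qed.

Lemma chart_continuity c z : is_chart c -> dom c z ->
  (forall P : set Y, nbhs z P <-> nbhs (Defs.coord c z) (param c @^-1` P)).
Proof.
move=> [od oi cc cp pc] dz P.
have U : (Defs.coord c @` dom c) (Defs.coord c z) by exists z.
have cpz : {for Defs.coord c z, continuous (param c)}.
  by move: cp; rewrite continuous_open_subspace// => /(_ (Defs.coord c z)); rewrite inE; exact.
have ccz : {for z, continuous (Defs.coord c)}.
  by move: cc; rewrite continuous_open_subspace// => /(_ z); rewrite inE; exact.
split=> [Pz|Pz].
  by apply: cpz; rewrite pc.
have h1 : nbhs z (dom c) by apply: open_nbhs_nbhs.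
have h2 := ccz _ Pz.
by apply: filterS (filterI h1 h2) => w [dw]; rewrite /= pc.
Qed.

(** Coordinates at y together with all that is needed to compute in them: chi is
    a local inverse of k, its components are holomorphic, and holomorphic
    functions become [holo] when read through k. *)
Definition frame A y (k : 'rV[C]_2 -> Y) (chi : Y -> 'rV[C]_2) : Prop :=
  [/\ chart_at y k, \forall x \near (0 : 'rV[C]_2), chi (k x) = x,
      forall j, holomorphic A (fun z => chi z 0 j) y &
      forall h, holomorphic A h y -> holo (h \o k) 0].

(** Coordinates need not belong to the atlas, so a function is transported
    through a chart of the atlas and the change of coordinates. *)
Lemma coordinates_frame A y c : complex_manifold A -> coordinates_at A y c ->
  frame A y (param c) (Defs.coord c).
Proof.
move=> [_ _ charts cover _] [cc dy c0 comp].
have [od oi _ _ pc] := cc.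
have U0 : nbhs (0 : 'rV[C]_2) (Defs.coord c @` dom c).
  by apply: open_nbhs_nbhs; split => //; exists y.
have inU x : (Defs.coord c @` dom c) x -> Defs.coord c (param c x) = x.
  by move=> [z dz <-]; rewrite pc.
split.
- split; first by rewrite -c0 pc.
  + apply: filterS U0 => x [z dz <-] P; rewrite pc//.
    exact: chart_continuity.
  + have /near_row_polydisc[r r0 Hr] := U0; exists r => // x x' /Hr/inU Ex /Hr/inU Ex' E0.
    by rewrite -Ex -Ex' E0.
- exact: filterS U0.
- move=> j c' Ac' dc'; apply: analytic_holo.
  by case: (comp c' Ac') => _; exact.
- move=> h hh; have [c' Ac' dc'] := cover y.
  have := hh c' Ac' dc'.
  have cj j : holo (fun x => Defs.coord c' (param c x) 0 j) (0 : 'rV[C]_2).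
    by apply: analytic_holo; rewrite -c0; case: (comp c' Ac') => + _; exact.
  have E0 z : \row_j Defs.coord c' z 0 j = Defs.coord c' z by apply/rowP => j; rewrite mxE.
  have pc0 : param c 0 = y by rewrite -c0 pc.
  move=> hc'; have := @holo_comp R 2 2 (h \o param c') (fun j x => Defs.coord c' (param c x) 0 j) 0 cj.
  rewrite E0 pc0 => /(_ hc'); apply: holo_eq.
  have [od' _ _ _ pc'] := charts c' Ac'.
  have : nbhs y (dom c') by apply: open_nbhs_nbhs.
  move=> /(chart_continuity cc dy); rewrite c0; apply: filterS => x /= dx.
  by rewrite E0 pc'.
Qed.

Lemma frame_swap A y k chi : frame A y k chi -> frame A y (k \o swap) (swap \o chi).
Proof.
move=> [ck ki kc kh]; split; first exact: chart_at_swap.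
- by have := near_row_swap ki; apply: filterS => x /= ->; rewrite swapK.
- move=> j; rewrite /swap.
  have -> : (fun z => ((fun x => row2 (crd1 x) (crd0 x)) \o chi) z 0 j) =
     (fun z => chi z 0 (if j == 0 then 1 else 0)).
    by apply/funext => z /=; rewrite mxE; case: ifP.
  exact: kc.
- by move=> h /kh hh; have := holo_swap hh.
Qed.

Lemma frame_retract A y k chi : frame A y k chi -> \forall z \near y, k (chi z) = z.
Proof. by move=> [ck ki _ _]; apply/(chart_at_near _ ck); apply: filterS ki => x ->. Qed.

Lemma frame_center A y k chi : frame A y k chi -> chi y = 0.
Proof. by move=> [[k0 _ _] ki _ _]; have := nbhs_singleton ki; rewrite k0. Qed.

Lemma near_crd0 (P : C -> Prop) : (\forall s \near (0 : C), P s) ->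
  nbhs (0 : 'rV[C]_2) [set x | P (crd0 x)].
Proof.
move=> /near0_disc[r r0 H]; apply/near_row2; exists r => // u v ur _ /=.
by rewrite row2E; exact: H.
Qed.

Lemma holo1_axis0 (h : 'rV[C]_2 -> C) : holo h 0 -> holo1 (fun v => h (row2 0 v)).
Proof.
move=> hh; apply: holo1_row2; rewrite ?row2_00//; [exact: holo1_const|exact: holo1_id].
Qed.

Lemma holo1_axis1 (h : 'rV[C]_2 -> C) : holo h 0 -> holo1 (fun u => h (row2 u 0)).
Proof.
move=> hh; apply: holo1_row2; rewrite ?row2_00//; [exact: holo1_id|exact: holo1_const].
Qed.

Lemma near_restrict0 (P : 'rV[C]_2 -> Prop) : (\forall x \near (0 : 'rV[C]_2), P x) ->
  \forall v \near (0 : C), P (row2 0 v).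
Proof.
by move=> /near_row2[r r0 H]; apply/near0_disc; exists r => // v vr; apply: H; rewrite ?modulus0// ltW.
Qed.

Lemma near_restrict1 (P : 'rV[C]_2 -> Prop) : (\forall x \near (0 : 'rV[C]_2), P x) ->
  \forall u \near (0 : C), P (row2 u 0).
Proof.
by move=> /near_row2[r r0 H]; apply/near0_disc; exists r => // v vr; apply: H; rewrite ?modulus0// ltW.
Qed.

(** The inclusion of E in {u = 0} is the hypothesis, read through the
    parametrization s of E.  Conversely, the equation of E restricted to
    {u = 0} is a function of v that vanishes at the points v(s), which accumulate
    at 0, so it vanishes identically. *)
Lemma smooth_axis_half A y E k chi k' chi' : frame A y k chi -> frame A y k' chi' ->
  (\forall x \near (0 : 'rV[C]_2), E (k' x) <-> crd1 x = 0) ->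
  (\forall s \near (0 : C), crd0 (chi (k' (row2 s 0))) = 0) -> first_axis k E.
Proof.
move=> fr fr' Ek' us.
have [ck ki kc kh] := fr; have [ck' ki' kc' kh'] := fr'.
have k0 : k 0 = y by case: ck.
have k'0 : k' 0 = y by case: ck'.
have sub : \forall z \near y, E z -> crd0 (chi z) = 0.
  apply/(chart_at_near _ ck').
  apply: filterS (near_and Ek' (near_crd0 us)) => x [Ex /= u0] /Ex x1.
  by rewrite -(row2_eta x) x1.
have Ey : \forall z \near y, E z <-> crd1 (chi' z) = 0.
  by apply/(chart_at_near _ ck'); apply: filterS (near_and Ek' ki') => x [Ex ->].
move/(chart_at_near _ ck): sub => sub; move/(chart_at_near _ ck): Ey => Ey.
have tau0 : \forall v \near (0 : C), crd1 (chi' (k (row2 0 v))) = 0.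
  apply: (@holo1_zeros R (fun v => crd1 (chi' (k (row2 0 v))))).
    exact: (holo1_axis0 (kh _ (kc' 1))).
  move=> r r0.
  have vh : holo1 (fun s => crd1 (chi (k' (row2 s 0)))) := holo1_axis1 (kh' _ (kc 1)).
  have /(chart_at_near _ ck') kchi := frame_retract fr.
  have /near0_disc[t t0 Ht] := near_and (near_and us (holo1_near_close vh r0)) (near_restrict1 (near_and ki' kchi)).
  have Nt : N (ofR t) = t by rewrite modulus_ofR gtr0_norm.
  have [|[u0 vr] [ki't kchit]] := Ht (ofR t); first by rewrite Nt.
  set z := k' (row2 (ofR t) 0) in u0 vr ki't kchit.
  have chiz : row2 0 (crd1 (chi z)) = chi z by rewrite -u0 row2_eta.
  exists (crd1 (chi z)); split.
  - apply/eqP => v0; have : z = k' 0.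
      by rewrite -kchit -chiz v0 row2_00 k0 k'0.
    move=> /(congr1 chi'); rewrite ki't (nbhs_singleton ki') => /(congr1 crd0).
    by rewrite row2E /crd0 mxE => /eqP; rewrite -modulus_eq0 Nt gt_eqF.
  - by move: vr; rewrite row2_00 k'0 (frame_center fr) /crd1 mxE subr0.
  - by rewrite chiz kchit ki't row2E.
have sup := @near_axis0 R (E \o k) _.
have {}sup : \forall x \near (0 : 'rV[C]_2), crd0 x = 0 -> E (k x).
  apply: sup; apply: filterS (near_and tau0 (near_restrict0 Ey)) => v [t0 Ev] /=.
  exact/Ev.
apply: filterS (near_and (near_and sub sup) ki) => x [[h1 h2] chix].
by split=> [/h1|//]; rewrite chix.
Qed.

(** Along the parametrized curve E the product of the coordinates u and v
    vanishes, so one of them vanishes identically. *)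
Lemma smooth_axis A y E k chi : complex_manifold A -> frame A y k chi ->
  submanifold_at A 1 E y ->
  (\forall x \near (0 : 'rV[C]_2), E (k x) -> crd0 x = 0 \/ crd1 x = 0) ->
  first_axis k E \/ first_axis (k \o swap) E.
Proof.
move=> mA fr [_ [c' cc' Ec']] Esub.
have fr' := coordinates_frame mA cc'.
set k' := param c' in fr'; set chi' := Defs.coord c' in fr'.
have [ck ki kc kh] := fr; have [ck' ki' kc' kh'] := fr'.
have Ek' : \forall x \near (0 : 'rV[C]_2), E (k' x) <-> crd1 x = 0.
  move/(chart_at_near _ ck'): Ec' => Ec'.
  apply: filterS (near_and Ec' ki') => x [Ex chix]; apply: (iff_trans Ex); rewrite -/chi' chix.
  split=> [H|H j j1]; first exact: H.
  by rewrite (_ : j = 1)//; apply: val_inj; case: j j1 => [[|[|]]].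
pose u s := crd0 (chi (k' (row2 s 0))); pose v s := crd1 (chi (k' (row2 s 0))).
have uh : holo1 u := holo1_axis1 (kh' _ (kc 0)).
have vh : holo1 v := holo1_axis1 (kh' _ (kc 1)).
have uv : \forall s \near (0 : C), u s = 0 \/ v s = 0.
  have : \forall z \near y, E z -> crd0 (chi z) = 0 \/ crd1 (chi z) = 0.
    by apply/(chart_at_near _ ck); apply: filterS (near_and Esub ki) => x [h ->].
  move/(chart_at_near _ ck') => H.
  apply: filterS (near_restrict1 (near_and H Ek')) => s [h e]; apply: h; apply/e.
  by rewrite row2E.
case: (holo1_order uh) => [u0|[n [w [wh w0 uw]]]].
  by left; exact: smooth_axis_half fr fr' Ek' u0.
right; apply: (smooth_axis_half (frame_swap fr) fr' Ek').
have v00 : v 0 = 0.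
  rewrite /v row2_00; case: ck' => -> _ _; by rewrite (frame_center fr) /crd1 mxE.
apply: filterS (near_and (near_and uv uw) (holo1_near_neq0 wh w0)) => s [[uvs us] ws].
rewrite /= /swap row2E -/(v s); have [->//|s0] := eqVneq s 0.
case: uvs => // /eqP; rewrite us mulf_eq0 expf_eq0 (negbTE s0) andbF (negbTE ws) //.
Qed.

Lemma analytic_subset_closed A (Z : set Y) : complex_manifold A -> analytic_subset A Z ->
  closed Z.
Proof.
move=> [_ _ charts cover _] aZ y clZ.
have [m [h [hh Zh]]] := aZ y.
suff H j : h j y = 0 by apply/(nbhs_singleton Zh).
apply/eqP/negPn/negP => hj.
have [c Ac dc] := cover y.
have hol := holomorphic_at_holo (hh j) Ac dc.
have Nh : 0 < N (h j y) by rewrite modulus_gt0.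
have [_ _ _ _ pc] := charts c Ac.
have /cvg_rowC_modulusP/(_ _ Nh) := holo_continuous hol.
rewrite /= pc// => /(chart_continuity (charts c Ac) dc (fun z => N (h j z - h j y) < N (h j y))) near_y.
have [z [Zz [hz Zz']]] := clZ _ (filterI near_y Zh).
by move: hz; rewrite (proj1 Zz' Zz) sub0r modulusN ltxx.
Qed.

End Frames.

(** * The exceptional curve *)

Section Geometry.
Context {R : realType} {Y : topologicalType}.
Local Notation C := (Cx R).
Local Notation N := modulus.
Implicit Types (A : set (@chart R Y 2)) (y : Y).

(** The two parts of a separation of E would be analytic subsets. *)
Lemma irreducible_connected A (E : set Y) : complex_manifold A ->
  irreducible_analytic_subset A E -> connected E.
Proof.
move=> mA [aE _ irr] B B0 [U oU BU] [V cV BV].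
have clE := analytic_subset_closed mA aE.
have clB : closed B by rewrite BV; exact: closedI.
have empty y (Z : set Y) : (\forall z \near y, ~ Z z) -> analytic_set_at A Z y.
  move=> nZ; exists 1%N, (fun _ _ => 1); split.
    move=> _ c Ac dc; exists (fun a => if a == [ffun=> 0%N] then 1 else 0), 1, 1; split => //.
      move=> a; rewrite expr1n mulr1; case: ifP; rewrite ?normr1 ?normr0//.
    move=> x _; apply/cvg_modulusP => e e0; exists 1%N => // d /= d0.
    pose z : {ffun 'I_2 -> 'I_d} := [ffun=> Ordinal d0].
    rewrite (bigD1 z) //= [X in _ + X - _]big1 ?addr0.
      rewrite (_ : [ffun i => val (z i)] = [ffun=> 0%N]); last by apply/ffunP => i; rewrite !ffunE.
      rewrite eqxx big1 ?mul1r ?subrr ?modulus0// => i _; by rewrite ffunE expr0.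
    move=> s sz; rewrite ifN ?mul0r//; apply: contra_neq sz => /ffunP H.
    by apply/ffunP => i; apply: val_inj; have := H i; rewrite !ffunE.
  apply: filterS nZ => z nZz; split => // /(_ 0) /eqP; by rewrite oner_eq0.
have local y (Z W : set Y) : (\forall z \near y, Z z <-> W z) ->
    analytic_set_at A Z y -> analytic_set_at A W y.
  move=> ZW [m [h [hh Zh]]]; exists m, h; split => //.
  by apply: filterS (filterI ZW Zh) => z [zw zh]; rewrite -zw.
have aB : analytic_subset A B.
  move=> y; have [By|nBy] := pselect (B y).
    have Uy : U y by move: By; rewrite BU => -[].
    have nU : nbhs y U by apply: open_nbhs_nbhs.
    apply: local (aE y); apply: filterS nU => z Uz; rewrite BU.
    by split=> [Ez|[]].
  have nB : nbhs y (~` B) by apply: open_nbhs_nbhs; split => //; exact: closed_openC.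
  exact: empty.
have aEB : analytic_subset A (E `\` B).
  move=> y; have [By|nBy] := pselect (B y).
    have Uy : U y by move: By; rewrite BU => -[].
    have nU : nbhs y U by apply: open_nbhs_nbhs.
    apply: empty; apply: filterS nU => z Uz [Ez]; apply; rewrite BU; by split.
  have nB : nbhs y (~` B) by apply: open_nbhs_nbhs; split => //; exact: closed_openC.
  apply: local (aE y); apply: filterS nB => z nBz.
  by split=> [Ez|[]].
have BE : B `<=` E by rewrite BU => z [].
have EU : E = B `|` (E `\` B).
  apply/seteqP; split=> [z Ez|z [/BE//|[]//]].
  by have [Bz|nBz] := pselect (B z); [left|right].
have [//|ED] := irr _ _ aB aEB EU.
by have [z Bz] := B0; have := BE z Bz; rewrite ED => -[].
Qed.

(** All that is used of a good resolution.  The conditions are symmetric in F and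
    H. *)
Record configuration A (I : finType) (E : I -> set Y) (F H : Y -> C) : Prop := {
  conf_manifold : complex_manifold A;
  conf_compact : compact (\bigcup_i E i);
  conf_irreducible : forall i, irreducible_analytic_subset A (E i);
  conf_irredundant : forall i j, E i `<=` E j -> i = j;
  conf_smooth : forall i y, E i y -> submanifold_at A 1 (E i) y;
  conf_holF : forall i y, E i y -> holomorphic A F y;
  conf_holH : forall i y, E i y -> holomorphic A H y;
  conf_zeroF : forall i y, E i y -> F y = 0;
  conf_zeroH : forall i y, E i y -> H y = 0;
  conf_common : forall i y, E i y ->
    \forall z \near y, F z = 0 -> H z = 0 -> (\bigcup_i E i) z;
  conf_crossings : forall i y, E i y ->
    normal_crossings_at A [set z | F z * H z = 0] y }.

Section Config.
Variables (A : set (@chart R Y 2)) (I : finType) (E : I -> set Y) (F H : Y -> C).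
Hypothesis conf : configuration A E F H.
Let Exc := \bigcup_i E i.

Lemma conf_closed i : closed (E i).
Proof.
apply: (analytic_subset_closed (conf_manifold conf)).
by case: (conf_irreducible conf i).
Qed.

Lemma conf_compact1 i : compact (E i).
Proof.
apply: (subclosed_compact (@conf_closed i) (conf_compact conf)).
exact: bigcup_sup.
Qed.

Lemma conf_connected i : connected (E i).
Proof. exact: irreducible_connected (conf_manifold conf) (conf_irreducible conf i). Qed.

Lemma conf_away i y : ~ E i y -> \forall z \near y, ~ E i z.
Proof.
move=> nE; apply: open_nbhs_nbhs; split => //.
exact: closed_openC (@conf_closed i).
Qed.

Lemma near_components y : \forall z \near y, forall m, E m z -> E m y.
Proof.
apply: filter_forall => m; have [Em|nE] := pselect (E m y); first exact: filterE.
by apply: filterS (conf_away nE).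
Qed.

Lemma near_single_component i y : (forall j, E j y -> j = i) ->
  \forall z \near y, Exc z -> E i z.
Proof.
by move=> single; apply: filterS (near_components y) => z Hz [j _ /[dup] Ejz /Hz /single <-].
Qed.

Lemma conf_frame i y : E i y -> exists k,
  [/\ chart_at y k, exists a p, monomial k F a p, exists b q, monomial k H b q,
      \forall x \near (0 : 'rV[C]_2), F (k x) * H (k x) = 0 -> crd0 x = 0 \/ crd1 x = 0 &
      forall j, E j y -> first_axis k (E j) \/ first_axis (k \o swap) (E j)].
Proof.
move=> Ey; have [c cc Tc] := conf_crossings conf Ey.
have fr := coordinates_frame (conf_manifold conf) cc.
have [ck ki kc kh] := fr.
have T : \forall x \near (0 : 'rV[C]_2), F (param c x) * H (param c x) = 0 -> crd0 x = 0 \/ crd1 x = 0.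
  case: Tc => /(chart_at_near _ ck) Tc; apply: filterS (near_and Tc ki) => x [Tx cx] /Tx;
  rewrite cx //; by left.
exists (param c); split => //.
- have [|a [p [U HU]]] := normal_form (kh _ (conf_holF conf Ey)); last by exists a, p, U.
  by apply: filterS T => x /= Tx Fx; apply: Tx; rewrite Fx mul0r.
- have [|a [p [U HU]]] := normal_form (kh _ (conf_holH conf Ey)); last by exists a, p, U.
  by apply: filterS T => x /= Tx Fx; apply: Tx; rewrite Fx mulr0.
move=> j Ej; apply: (smooth_axis (conf_manifold conf) fr (conf_smooth conf Ej)).
have Fj z : E j z -> F z = 0 := fun h => conf_zeroF conf h.
by apply: filterS T => x /= Tx Ejx; apply: Tx; rewrite Fj// mul0r.
Qed.

(** Two components that agree near a point agree near each point of a connected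
    set, hence one contains the other. *)
Lemma same_axis i j y (k : 'rV[C]_2 -> Y) : E i y -> chart_at y k -> first_axis k (E i) ->
  first_axis k (E j) -> i = j.
Proof.
move=> Ei ck ki kj; apply: (conf_irredundant conf).
pose G : set Y := [set z : Y | nbhs z [set w | E i w -> E j w]].
suff : E i `<=` G by move=> h z Ez; apply: (nbhs_singleton (h z Ez)).
apply: (connected_dichotomy (@conf_connected i)).
  move=> z Ez.
  have [Ejz|nEj] := pselect (E j z); last first.
    right; apply: filterS (conf_away nEj) => w nEw Ew.
    by move=> /nbhs_singleton/(_ Ew).
  have [k' [ck' _ _ _ ax]] := conf_frame Ez.
  have cks' := chart_at_swap ck'.
  have same (k1 : 'rV[C]_2 -> Y) : chart_at z k1 -> first_axis k1 (E i) -> first_axis k1 (E j) ->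
      \forall w \near z, E i w -> G w.
    move=> ck1 h1 h2.
    have : \forall w \near z, E i w -> E j w.
      by apply/(chart_at_near _ ck1); apply: filterS (near_and h1 h2) => x [e1 e2] /e1 /e2.
    by move/near_join; apply: filterS => w hw _.
  have diff (k1 : 'rV[C]_2 -> Y) : chart_at z k1 -> first_axis k1 (E i) -> first_axis (k1 \o swap) (E j) ->
      \forall w \near z, E i w -> ~ G w.
    move=> ck1 h1 h2; have [_ hk _] := ck1.
    have /near_axis[r r0 Hr] := near_and (near_and hk h1) (near_row_swap h2).
    have r2 : 0 < r / 2 by lra.
    apply: filterS (chart_axis_points ck1 h1 r2) => w hw /hw [v vr ->] Gv.
    have vr' : N v < r by lra.
    have [[hv _] _] := Hr v (ltW vr').
    have [u [u0 _ ur /= Hu]] := axis_points_near hv vr' Gv.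
    have [[_ e1] e2] := Hr u ur.
    have Eiu : E i (k1 (row2 0 u)) by apply/e1; rewrite row2E.
    move/eqP: u0; apply; move: e2; rewrite /= swapK => -[+ _] => /(_ (Hu Eiu)).
    by rewrite /swap !row2E.
  have swK : k' = (k' \o swap) \o swap by apply/funext => x /=; rewrite swapK.
  case: (ax i Ez) => hi; case: (ax j Ejz) => hj.
  - by left; exact: same hi hj.
  - by right; exact: diff hi hj.
  - by right; apply: (diff (k' \o swap)) => //; rewrite -swK.
  - by left; exact: same hi hj.
exists y => //; rewrite /G /=.
by apply/(chart_at_near _ ck); apply: filterS (near_and ki kj) => x [e1 e2] /e1 /e2.
Qed.

Lemma conf_adapted_aux i y : E i y -> exists k a p b q,
  [/\ adapted F H (E i) y k a b p q,
      \forall x \near (0 : 'rV[C]_2), F (k x) * H (k x) = 0 -> crd0 x = 0 \/ crd1 x = 0 &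
      forall j, E j y -> i = j \/ first_axis (k \o swap) (E j)].
Proof.
move=> Ey; have [k [ck [a [p Fk]] [b [q Hk]] T ax]] := conf_frame Ey.
have swK : (k \o swap) \o swap = k by apply/funext => x /=; rewrite swapK.
case: (ax i Ey) => hi.
  exists k, a, p, b, q; split => // j Ej.
  by case: (ax j Ej) => hj; [left; exact: same_axis Ey ck hi hj|right].
exists (k \o swap), p, a, q, b; split => //.
- by split => //; [exact: chart_at_swap|exact: monomial_swap|exact: monomial_swap].
- have := near_row_swap T; apply: filterS => x h e; have := h e.
  by rewrite /swap !row2E => -[]; [right|left].
- move=> j Ej; case: (ax j Ej) => hj; first by right; rewrite swK.
  by left; exact: same_axis Ey (chart_at_swap ck) hi hj.
Qed.

Lemma conf_adapted i y : E i y -> exists k a b p q, adapted F H (E i) y k a b p q.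
Proof.
by move=> /conf_adapted_aux[k [a [p [b [q [ad _ _]]]]]]; exists k, a, b, p, q.
Qed.

(** F and H vanish on E. *)
Lemma adapted_pos i y k a b p q : adapted F H (E i) y k a b p q ->
  (0 < a)%N /\ (0 < b)%N.
Proof.
move=> [_ kE mF mH].
have pos G n m : monomial k G n m -> (forall z, E i z -> G z = 0) -> (0 < n)%N.
  move=> [U [Uh U0 HU]] G0; rewrite lt0n; apply/negP => /eqP n0.
  have /near_restrict0 H1 := near_and kE HU.
  have H2 := holo1_near_neq0 (holo1_axis0 Uh); rewrite row2_00 in H2.
  have /near0_disc[r r0 Hr] := near_and H1 (H2 U0).
  have Nr : N (ofR r) = r by rewrite modulus_ofR gtr0_norm.
  have [|[e GE] Ur] := Hr (ofR r); first by rewrite Nr.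
  have : G (k (row2 0 (ofR r))) = 0 by apply: G0; apply/e; rewrite row2E.
  rewrite GE n0 expr0 mul1r row2E => /eqP; rewrite mulf_eq0 (negbTE Ur) orbF expf_eq0 => /andP[_].
  by rewrite -modulus_eq0 Nr gt_eqF.
split; first by apply: pos mF _ => z; exact: (conf_zeroF conf).
by apply: pos mH _ => z; exact: (conf_zeroH conf).
Qed.

(** Where two components meet they are the two axes; the total transform has no
    room for another branch. *)
Lemma conf_crossing i j y : E i y -> E j y -> i <> j -> exists k a p b q,
  [/\ adapted F H (E i) y k a b p q, adapted F H (E j) y (k \o swap) p q a b,
      \forall z \near y, F z * H z = 0 -> Exc z &
      forall m, E m y -> m = i \/ m = j].
Proof.
move=> Ei Ej ij; have [k [a [p [b [q [ad T ax]]]]]] := conf_adapted_aux Ei.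
have [ck kE mF mH] := ad.
have kj : first_axis (k \o swap) (E j) by case: (ax j Ej).
have cks := chart_at_swap ck.
exists k, a, p, b, q; split => //.
- by split => //; exact: monomial_swap.
- apply/(chart_at_near _ ck).
  apply: filterS (near_and T (near_and kE (near_row_swap kj))) => x [h [e1 e2]] /h[x0|x1].
    by exists i => //; apply/e1.
  by exists j => //; move: e2; rewrite /= swapK /swap row2E => ->.
- move=> m Em; case: (ax m Em) => [->|km]; first by left.
  by right; apply/esym; exact: same_axis Ej cks kj km.
Qed.

(** Away from the crossings, {v = 0} is not exceptional; its points with u <> 0
    are zeros of G exactly when v occurs in G. *)
Lemma conf_single_aux (G : Y -> C) i y (k : 'rV[C]_2 -> Y) n m : E i y -> (forall j, E j y -> j = i) ->
  chart_at y k -> first_axis k (E i) -> monomial k G n m -> (0 < n)%N ->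
  ((0 < m)%N <-> strict_transform Exc G y).
Proof.
move=> Ey single ck kE [U [Uh U0 HU]] n0.
have near_Exc := near_single_component single.
split=> [m0 P Py|st].
  have /(chart_at_near _ ck) H1 := near_and (P := P) Py near_Exc.
  have /near_restrict1/near0_disc[r r0 Hr] := near_and (near_and H1 kE) HU.
  have Nr : N (ofR r) = r by rewrite modulus_ofR gtr0_norm.
  have [|[[Pk ex] e] GE] := Hr (ofR r); first by rewrite Nr.
  exists (k (row2 (ofR r) 0)); split => //; split => /=.
    by rewrite GE !row2E expr0n (gtn_eqF m0) mulr0 mul0r.
  by move=> /ex/e; rewrite row2E => /eqP; rewrite -modulus_eq0 Nr gt_eqF.
rewrite lt0n; apply/negP => /eqP m0.
have Unz := holo_near_neq0 Uh U0.
have : \forall z \near y, G z = 0 -> E i z.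
  apply/(chart_at_near _ ck).
  apply: filterS (near_and (near_and HU Unz) kE) => x [[-> Ux] e] /eqP.
  rewrite m0 expr0 mulr1 mulf_eq0 (negbTE Ux) orbF expf_eq0 => /andP[_ /eqP x0].
  exact/e.
move=> /st[z [[/= Gz nEz] hz]]; apply: nEz; exists i => //; exact: hz.
Qed.

(** F and H have no common zero near y outside the exceptional curve, so v occurs
    in at most one of them. *)
Lemma conf_single i y : E i y -> (forall j, E j y -> j = i) -> exists k a p b q,
  [/\ adapted F H (E i) y k a b p q, (0 < p)%N <-> strict_transform Exc F y,
      (0 < q)%N <-> strict_transform Exc H y & p = 0%N \/ q = 0%N].
Proof.
move=> Ey single; have [k [a [p [b [q [ad T ax]]]]]] := conf_adapted_aux Ey.
have [ck kE mF mH] := ad; have [a0 b0] := adapted_pos ad.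
exists k, a, p, b, q; split => //.
- exact: conf_single_aux Ey single ck kE mF a0.
- exact: conf_single_aux Ey single ck kE mH b0.
have [->|p0] := posnP p; first by left.
have [->|q0] := posnP q; first by right.
exfalso.
have near_Exc := near_single_component single.
have /(chart_at_near _ ck) H1 := near_and (conf_common conf Ey) near_Exc.
case: mF => U [Uh U0 HU]; case: mH => V [Vh V0 HV].
have /near_restrict1/near0_disc[r r0 Hr] := near_and (near_and H1 kE) (near_and HU HV).
have Nr : N (ofR r) = r by rewrite modulus_ofR gtr0_norm.
have [|[[com ex] e] [FE HE]] := Hr (ofR r); first by rewrite Nr.
have : Exc (k (row2 (ofR r) 0)).
  apply: com; rewrite ?FE ?HE !row2E expr0n gtn_eqF//= mulr0 mul0r//.
by move=> /ex/e; rewrite row2E => /eqP; rewrite -modulus_eq0 Nr gt_eqF.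
Qed.

End Config.

End Geometry.

(** * Orders along curvettas *)

Section Curvetta.
Context {R : realType} {Y : topologicalType}.
Local Notation C := (Cx R).
Local Notation N := modulus.
Implicit Types (A : set (@chart R Y 2)) (y : Y).

Lemma order_unique (m n : nat) (u v : C -> C) : holo1 u -> holo1 v -> u 0 != 0 -> v 0 != 0 ->
  (\forall t \near (0 : C), t ^+ m * u t = t ^+ n * v t) -> m = n.
Proof.
wlog mn : m n u v / (m <= n)%N => [W uh vh u0 v0 E0|uh vh u0 v0 E0].
  have [mn|mn] := leqP m n; first exact: (W m n u v).
  apply/esym; apply: (W n m v u) => //; first exact: ltnW.
  by apply: filterS E0 => t ->.
apply/eqP; rewrite eqn_leq mn leqNgt; apply/negP => lt.
have dh : holo1 (fun t => u t + (-1) * (t ^+ (n - m) * v t)).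
  apply: holo1D => //; apply: holo1M; first exact: holo1_const.
  by apply: holo1M => //; apply: holo1X; exact: holo1_id.
have /nbhs_singleton : \forall t \near (0 : C), u t + (-1) * (t ^+ (n - m) * v t) = 0.
  apply: (holo1_zeros dh) => r r0; have /near0_disc[s s0 Hs] := E0.
  pose t := Num.min r s / 2.
  have h1 : 0 < Num.min r s by rewrite lt_min r0.
  have h2 : Num.min r s <= r by rewrite ge_min lexx.
  have h3 : Num.min r s <= s by rewrite ge_min lexx orbT.
  have t0 : 0 < t by rewrite divr_gt0.
  have Nt : N (ofR t) = t by rewrite modulus_ofR gtr0_norm.
  have tn : ofR t != 0 by rewrite -modulus_gt0 Nt.
  exists (ofR t); split; rewrite ?Nt//; first by rewrite /t; lra.
  apply: (mulfI (expf_neq0 m tn)); rewrite mulr0 mulrDr Hs ?Nt; last by rewrite /t; lra.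
  by rewrite mulN1r mulrN mulrA -exprD subnKC// subrr.
by rewrite expr0n subn_eq0 leqNgt lt /= mul0r mulr0 addr0 => /eqP; apply/negP.
Qed.

Lemma analytic1_holo1 (u : C -> C) : analytic1_at u 0 -> holo1 u.
Proof.
move=> /analytic_holo; rewrite /holo1 (_ : const_mx 0 = 0)//.
Qed.

Lemma order_onE (h : Y -> C) (gam : C -> Y) m (u : C -> C) : holo1 u -> u 0 != 0 ->
  (\forall t \near (0 : C), h (gam t) = t ^+ m * u t) -> order_on h gam = m.
Proof.
move=> uh u0 hm; rewrite /order_on.
set P := [set _ | _].
have Pm : P m by exists u; split => //; exact: holo1_analytic.
have [v [/analytic1_holo1 vh v0 hv]] : P (xget 0%N P) := xgetI 0%N Pm.
apply: (order_unique vh uh v0 u0).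
by apply: filterS (near_and hm hv) => t [-> ->].
Qed.

(** A velocity that does not vanish excludes that u vanishes to order at least
    two. *)
Lemma derive1_zero (u : C -> C) n (w : C -> C) : holo1 w ->
  (\forall t \near (0 : C), u t = t ^+ n.+2 * w t) -> derive1 u 0 = 0.
Proof.
move=> wh uw; rewrite derive1E /derive.
have u0 : u 0 = 0 by rewrite (nbhs_singleton uw) expr0n mul0r.
apply: cvg_lim => //.
have gh : holo1 (fun t => t ^+ n.+1 * w t).
  by apply: holo1M => //; apply: holo1X; exact: holo1_id.
have := holo1_continuous gh; rewrite expr0n mul0r => cv.
have {}cv : t ^+ n.+1 * w t @[t --> 0^'] --> (0 : C).
  by apply: cvg_trans cv; apply: cvg_app; exact: cvg_within.
apply: cvg_trans cv; apply: near_eq_cvg.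
have h1 : \forall t \near (0 : C)^', u t = t ^+ n.+2 * w t by exact: cvg_within uw.
have h2 : \forall t \near (0 : C)^', t != 0 by exact: nbhs_dnbhs_neq.
apply: filterS2 h1 h2 => t ut t0 /=.
rewrite addr0 u0 subr0 [t *: 1]mulr1 ut.
by rewrite /GRing.scale /= [t ^+ n.+2]exprS -mulrA mulKf.
Qed.

(** In the coordinates of the curvetta F is u^a times a unit; since u has order
    one on the curvetta, a is the order of F on it. *)
Lemma curvetta_comparable A (F H : Y -> C) (Ei : set Y) (gam : C -> Y) :
  complex_manifold A -> holomorphic A F (gam 0) -> holomorphic A H (gam 0) ->
  curvetta A [set z | F z * H z = 0] Ei gam ->
  F (gam 0) = 0 -> H (gam 0) = 0 ->
  [/\ Ei (gam 0), (0 < order_on F gam)%N, (0 < order_on H gam)%N &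
      power_comparable F H (order_on F gam) (order_on H gam) (gam 0)].
Proof.
move=> mA Fh Hh [c cc [Tc Ec cg ca dg]] F0 H0.
have fr := coordinates_frame mA cc; have [ck ki kc kh] := fr.
have c0 : Defs.coord c (gam 0) = 0 := frame_center fr.
have Ei0 : Ei (gam 0) by apply/(nbhs_singleton Ec); rewrite c0 mxE.
set k := param c in ck ki kc kh.
pose u j t := Defs.coord c (gam t) 0 j.
have uh j : holo1 (u j) by apply: analytic1_holo1; exact: ca.
have u00 j : u j 0 = 0 by rewrite /u c0 mxE.
have [w [wh w0 uw]] : exists w, [/\ holo1 w, w 0 != 0 & \forall t \near (0 : C), u 0 t = t * w t].
  case: (holo1_order (uh 0)) => [z0|[n [w [wh w0 uw]]]].
    move/eqP: dg; case; apply: (@derive1_zero _ 0 (fun=> 0)); first exact: holo1_const.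
    by apply: filterS z0 => t E0; rewrite mulr0 -E0.
  case: n uw => [|[|n]] uw; last by move/eqP: dg; case; exact: (derive1_zero wh uw).
    by move: w0; rewrite -[w 0]mul1r -(expr0 0) -(nbhs_singleton uw) u00 eqxx.
  by exists w; split => //; apply: filterS uw => t; rewrite expr1.
have Tk : \forall x \near (0 : 'rV[C]_2), F (k x) * H (k x) = 0 <-> crd0 x = 0.
  move/(chart_at_near _ ck): Tc => Tc.
  by apply: filterS (near_and Tc ki) => x [Tx cx]; apply: (iff_trans Tx); rewrite cx.
have gk : \forall t \near (0 : C), gam t = k (row2 (u 0 t) (u 1 t)).
  have H1 := frame_retract fr.
  have : \forall t \near (0 : C), k (Defs.coord c (gam t)) = gam t := cg _ H1.
  by apply: filterS => t E0; rewrite -{1}E0; congr k; rewrite -[LHS]row2_eta.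
have order G : holomorphic A G (gam 0) -> (forall z, G z = 0 -> F z * H z = 0) ->
   G (gam 0) = 0 ->
   exists (a : nat) U, [/\ holo U 0, U 0 != 0, \forall x \near (0 : 'rV[C]_2), G (k x) = crd0 x ^+ a * U x,
     (0 < a)%N & order_on G gam = a].
  move=> Gh GT G0.
  have [|a [p [U [Uh U0 GU]]]] := normal_form (kh _ Gh).
    by apply: filterS Tk => x h /GT/h ?; left.
  have p0 : p = 0%N.
    apply/eqP; rewrite -leqn0 leqNgt; apply/negP => p0.
    have /near_restrict1/near0_disc[r r0 Hr] := near_and Tk GU.
    have Nr : N (ofR r) = r by rewrite modulus_ofR gtr0_norm.
    have [|h1 h2] := Hr (ofR r); first by rewrite Nr.
    have /GT/h1 : G (k (row2 (ofR r) 0)) = 0.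
      by move: h2 => /= ->; rewrite !row2E expr0n gtn_eqF// mulr0 mul0r.
    by rewrite row2E => /eqP; rewrite -modulus_eq0 Nr gt_eqF.
  have {}GU : \forall x \near (0 : 'rV[C]_2), G (k x) = crd0 x ^+ a * U x.
    by apply: filterS GU => x /= ->; rewrite p0 expr0 mulr1.
  exists a, U; split => //.
    rewrite lt0n; apply/negP => /eqP a0; have := nbhs_singleton GU.
    case: ck => -> _ _; rewrite G0 a0 expr0 mul1r => /esym/eqP; exact/negP.
  have Uu : holo1 (fun t => U (row2 (u 0 t) (u 1 t))).
    by apply: holo1_row2 => //; rewrite !u00 row2_00.
  apply: (@order_onE _ _ a (fun t => w t ^+ a * U (row2 (u 0 t) (u 1 t)))).
  - by apply: holo1M => //; exact: holo1X.
  - by rewrite mulf_neq0 ?expf_neq0// !u00 row2_00.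
  - have : \forall t \near (0 : C), G (k (row2 (u 0 t) (u 1 t))) = u 0 t ^+ a * U (row2 (u 0 t) (u 1 t)).
      have /near_row2[r r0 Hr] := GU.
      have /near0_disc[s s0 Hs] := near_and (holo1_near_close (uh 0) r0) (holo1_near_close (uh 1) r0).
      apply/near0_disc; exists s => // t /Hs[]; rewrite !u00 !subr0 => h0 h1.
      by rewrite Hr ?row2E ?ltW.
    move=> Gu; apply: filterS (near_and (near_and Gu gk) uw) => t [[Gt gt] ut].
    by rewrite gt Gt {1}ut exprMn mulrA.
have [a [U [Uh U0 FU a0 ->]]] := order F Fh (fun z h => etrans (congr1 (fun t => t * H z) h) (mul0r _)) F0.
have [b [V [Vh V0 HV b0 ->]]] := order H Hh (fun z h => etrans (congr1 (fun t => F z * t) h) (mulr0 _)) H0.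
split => //.
have [k0 hk _] := ck; rewrite -k0.
apply/(comparable_axis (nbhs_singleton hk) _ Uh U0 Vh V0 FU HV); last by rewrite mulnC.
by rewrite /crd0 mxE.
Qed.

End Curvetta.

(** * Lifting germs to the resolution *)

Section Lift.
Context {R : realType} {Y : topologicalType}.
Local Notation C := (Cx R).
Local Notation N := modulus.

Lemma near_compose n m (g : 'I_m -> 'rV[C]_n -> C) (a : 'rV[C]_n) (P : 'rV[C]_m -> Prop) :
  (forall j, holo (g j) a) -> (\forall w \near \row_j g j a, P w) ->
  \forall x \near a, P (\row_j g j x).
Proof.
move=> gh /near_row_ball[r r0 Hr].
have : \forall x \near a, forall j, N (g j x - g j a) < r.
  apply: (@filter_forall _ _ _ (nbhs a) (nbhs_filter a)) => j.
  by have /cvg_rowC_modulusP := holo_continuous (gh j); exact.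
by apply: filterS => x Hx; apply: Hr => i; rewrite !mxE.
Qed.

Lemma finite_isolated n (S : set 'rV[C]_n) (p : 'rV[C]_n) : finite_set S ->
  \forall v \near p, S v -> v = p.
Proof.
move=> /finite_seqP[s ->]; elim: s => [|q s IH]; first exact: filterE.
have hq : \forall v \near p, v = q -> v = p.
  have [->|qp] := eqVneq q p; first exact: filterE.
  have [i qi] : exists i, q 0 i != p 0 i.
    apply: contrapT => nq; move/eqP: qp; apply; apply/rowP => i.
    by apply/eqP/negPn/negP => qi; apply: nq; exists i.
  apply/near_row_ball; exists (N (q 0 i - p 0 i)); first by rewrite modulus_gt0 subr_eq0.
  by move=> v Hv E0; have := Hv i; rewrite E0 ltxx.
apply: filterS (near_and hq IH) => v [h1 h2] /=; rewrite inE => /orP[/eqP|]; [exact: h1|exact: h2].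
Qed.

Lemma row_eta (l : nat) (v : 'rV[C]_l) : \row_j v 0 j = v.
Proof. by apply/rowP => j; rewrite mxE. Qed.

Section Data.
Variables (A : set (@chart R Y 2)) (n m : nat).
Variables (X : set 'rV[C]_n) (p : 'rV[C]_n) (Xb : set 'rV[C]_m) (pb : 'rV[C]_m).
Variables (nu : 'rV[C]_m -> 'rV[C]_n) (Rb : Y -> 'rV[C]_m).
Hypotheses (mA : complex_manifold A).
Hypotheses (RbX : forall z, Xb (Rb z)).
Hypotheses (Rb_hol : forall y j, holomorphic A (fun z => Rb z 0 j) y).
Hypotheses (nu_reg : forall j, regular_at Xb (fun w => nu w 0 j) pb).
Hypotheses (nuX : \forall w \near pb, Xb w -> X (nu w)).
Hypotheses (nup : nu pb = p) (Xpb : Xb pb).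

Lemma near_Rb y (P : 'rV[C]_m -> Prop) : (\forall w \near Rb y, P w) ->
  \forall z \near y, P (Rb z).
Proof.
move=> HP; have [_ _ charts cover _] := mA; have [c Ac dc] := cover y.
apply/(chart_continuity (charts c Ac) dc).
have [_ _ _ _ pc] := charts c Ac.
have := @near_compose 2 m (fun j x => Rb (param c x) 0 j) (Defs.coord c y) P.
rewrite row_eta pc// => /(_ _ HP) H; have {}H := H (fun j => Rb_hol j Ac dc).
by apply: filterS H => x; rewrite row_eta.
Qed.

Lemma nu_extension : exists G : 'I_n -> 'rV[C]_m -> C,
  [/\ forall j, holo (G j) pb, \row_j G j pb = p &
      \forall w \near pb, Xb w -> nu w = \row_j G j w].
Proof.
have H j : exists G : 'rV[C]_m -> C, holo G pb /\ \forall w \near pb, Xb w -> nu w 0 j = G w.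
  by have [G Gh GE] := nu_reg j; exists G; split => //; exact: analytic_holo.
have [G HG] := choice H.
exists G.
have E0 : \forall w \near pb, Xb w -> nu w = \row_j G j w.
  have : \forall w \near pb, forall j, Xb w -> nu w 0 j = G j w.
    apply: (@filter_forall _ _ _ (nbhs pb) (nbhs_filter pb)) => j; by case: (HG j).
  by apply: filterS => w Hw Xw; apply/rowP => j; rewrite mxE Hw.
split => //; first by move=> j; case: (HG j).
by rewrite -(nbhs_singleton E0 Xpb).
Qed.

Lemma near_lift y (P : 'rV[C]_n -> Prop) : Rb y = pb -> (\forall v \near p, P v) ->
  \forall z \near y, P (nu (Rb z)).
Proof.
move=> yE HP; have [G [Gh Gp GE]] := nu_extension.
have := @near_compose m n G pb P Gh; rewrite Gp => /(_ HP) HG.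
have := @near_Rb y (fun w => P (nu w)); rewrite yE.
have H : \forall w \near pb, Xb w -> P (nu w).
  by apply: filterS (near_and HG GE) => w [Pw E0] Xw; rewrite E0.
have := @near_Rb y (fun w => Xb w -> P (nu w)); rewrite yE => /(_ H) H' _.
by apply: filterS H' => z; apply.
Qed.

(** Near y the function is the composite of germs of analytic functions on the
    ambient spaces. *)
Lemma lift_holomorphic (h : 'rV[C]_n -> C) y : Rb y = pb -> regular_at X h p ->
  holomorphic A (fun z => h (nu (Rb z))) y.
Proof.
move=> yE [K /analytic_holo Kh KE] c Ac dc.
have [_ _ charts cover _] := mA.
have [_ _ _ _ pc] := charts c Ac.
have [G [Gh Gp GE]] := nu_extension.
pose x0 := Defs.coord c y.
pose rb j x := Rb (param c x) 0 j.
have rbh j : holo (rb j) x0 := Rb_hol j Ac dc.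
have rb0 : \row_j rb j x0 = pb by rewrite row_eta pc.
have gh i : holo (fun x => G i (\row_j rb j x)) x0.
  by apply: holo_comp => //; rewrite rb0.
have Kh' : holo (fun x => K (\row_i G i (\row_j rb j x))) x0.
  apply: (@holo_comp R n 2 K (fun i x => G i (\row_j rb j x))) => //.
  by rewrite rb0 Gp.
apply: holo_eq Kh'.
have H1 : \forall z \near y, nu (Rb z) = \row_i G i (Rb z).
  have := @near_Rb y (fun w => Xb w -> nu w = \row_i G i w).
  by rewrite yE => /(_ GE); apply: filterS => z; apply.
have H2 : \forall z \near y, X (nu (Rb z)).
  have := @near_Rb y (fun w => Xb w -> X (nu w)).
  by rewrite yE => /(_ nuX); apply: filterS => z; apply.
have H3 := near_lift yE KE.
have : \forall z \near y, K (\row_i G i (Rb z)) = h (nu (Rb z)).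
  by apply: filterS (near_and H1 (near_and H2 H3)) => z [e [Xz hk]]; rewrite hk// e.
move=> /(chart_continuity (charts c Ac) dc); apply: filterS => x /= <-.
by congr K; apply/rowP => i; rewrite !mxE row_eta.
Qed.

End Data.

Lemma regular_component n (X : set 'rV[C]_n) (p : 'rV[C]_n) (f g : 'rV[C]_n -> C) :
  analytic_map_at X (pair_map f g) p -> regular_at X f p /\ regular_at X g p.
Proof.
move=> H; have := H 0; have := H 1; move=> [G1 a1 e1] [G0 a0 e0].
split; [exists G0|exists G1] => //.
  by apply: filterS e0 => z h /h; rewrite mxE.
by apply: filterS e1 => z h /h; rewrite mxE.
Qed.

(** The common zeros of the lifts near the exceptional curve are exceptional
    because phi and nu have finite fibres, which meet small neighbourhoods of p
    and of its preimage in one point. *)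
Lemma resolution_configuration (n : nat) (X : set 'rV[C]_n) (p : 'rV[C]_n)
  (X_germ : analytic_germ X p) (f g : 'rV[C]_n -> C)
  (phi_fin : finite_morphism X p (pair_map f g) setT 0)
  (m : nat) (Xb : set 'rV[C]_m) (pb : 'rV[C]_m)
  (nu : 'rV[C]_m -> 'rV[C]_n) (nu_norm : normalization Xb pb nu X p)
  (A : set (@chart R Y 2)) (mA : complex_manifold A)
  (Rb : Y -> 'rV[C]_m) (I : finType) (E : I -> set Y)
  (Rb_good : good_resolution A Rb Xb pb (f \o nu) (g \o nu) E) :
  exceptional Rb pb = \bigcup_i E i /\
  configuration A E (f \o nu \o Rb) (g \o nu \o Rb).
Proof.
case: phi_fin => phi0 [U [V [[oU Up _] _ [phi_maps phi_an _ phi_fib]]]].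
case: nu_norm => [[[Xpb _] _] nup [U' [V' [S [[oU' Upb _] [oV' Vp _] _ [nu_maps nu_an _ nu_fib] _]]]]].
case: Rb_good => [[W [G [[[oW Wpb _] Rb_im] Rb_hol0 Rb_proper _ _]]] [EE Eirr Eirred] Esm Enc].
have Xp : X p by case: X_germ.
have RbX z : Xb (Rb z).
  have : (Rb @` setT) (Rb z) by exists z.
  by rewrite Rb_im => -[].
have Rb_hol y j : holomorphic A (fun z => Rb z 0 j) y.
  exact/holomorphic_at_holo/Rb_hol0.
have nu_reg : analytic_map_at Xb nu pb by apply: nu_an.
have nuX : \forall w \near pb, Xb w -> X (nu w).
  have : nbhs pb U' by apply: open_nbhs_nbhs.
  by apply: filterS => w Uw Xw; case: (nu_maps w).
have [freg greg] := regular_component (phi_an p (conj Xp Up)).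
have f0 : f p = 0 by have := congr1 (fun v : 'rV[C]_2 => v 0 0) phi0; rewrite !mxE.
have g0 : g p = 0 by have := congr1 (fun v : 'rV[C]_2 => v 0 1) phi0; rewrite !mxE.
have excE i y : E i y -> Rb y = pb.
  by move=> Ey; have : exceptional Rb pb y by rewrite EE; exists i.
split => //; split => //.
- rewrite -EE; apply: Rb_proper; last exact: compact_set1.
  by move=> _ ->.
- move=> i y /excE yE.
  exact: (lift_holomorphic mA RbX Rb_hol nu_reg nuX nup Xpb yE freg).
- move=> i y /excE yE.
  exact: (lift_holomorphic mA RbX Rb_hol nu_reg nuX nup Xpb yE greg).
- by move=> i y /excE yE /=; rewrite yE nup.
- by move=> i y /excE yE /=; rewrite yE nup.
- move=> i y Ey; have yE := excE _ _ Ey.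
  have nearU : nbhs p U by apply: open_nbhs_nbhs.
  have nearU' : nbhs pb U' by apply: open_nbhs_nbhs.
  have fib := finite_isolated p (phi_fib 0).
  have fib' := finite_isolated pb (nu_fib p).
  have H1 := near_lift mA RbX Rb_hol nu_reg nup Xpb yE (near_and (P := U) nearU fib).
  have H2 : \forall z \near y, U' (Rb z) /\
      ((Xb `&` U' `&` nu @^-1` [set p]) (Rb z) -> Rb z = pb).
    have := @near_Rb A m Rb mA Rb_hol y (fun w => U' w /\
      ((Xb `&` U' `&` nu @^-1` [set p]) w -> w = pb)); rewrite yE; apply.
    exact: (near_and (P := U') nearU' fib').
  apply: filterS (near_and H1 H2) => z [[Uz fz] [Uz' fz']] /= Fz Hz.
  rewrite -EE; apply: fz'; split; first by split.
  apply: fz; split.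
    by split => //; case: (nu_maps (Rb z)).
  by apply/rowP => j; rewrite /= !mxE; case: ifP.
- by move=> i y Ey; apply: Enc; rewrite EE; exists i.
Qed.

End Lift.

(** * Graphs whose vertices are balanced *)

Section ContinuousSum.
Context {R : realType} {T : topologicalType}.

Lemma continuous_add (f g : T -> R) : continuous f -> continuous g ->
  continuous (fun x => f x + g x).
Proof. by move=> hf hg x; apply: cvgD; [exact: hf|exact: hg]. Qed.

Lemma continuous_sum (I : Type) (r : seq I) (P : pred I) (f : I -> T -> R) :
  (forall i, continuous (f i)) -> continuous (fun x => \sum_(i <- r | P i) f i x).
Proof.
move=> hf; elim: r => [|i r IH].
  have -> : (fun x => \sum_(i <- [::] | P i) f i x) = (fun=> 0).
    by apply/funext => x; rewrite big_nil.
  by move=> x; exact: cvg_cst.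
have -> : (fun x => \sum_(i <- i :: r | P i) f i x) =
    (fun x => (if P i then f i x else 0) + \sum_(i <- r | P i) f i x).
  by apply/funext => x; rewrite big_cons; case: (P i); rewrite ?add0r.
by apply: continuous_add => //; case: (P i) => // x; exact: cvg_cst.
Qed.

End ContinuousSum.

Section Graph.
Context {R : realType} (G : dual_graph).
Implicit Types (i j : vertex G) (y : node G).
Local Notation q := (@quotient_of G).

Definition up_at i y : Prop := (exists2 j, joins i j y & q i < q j) \/ out_arrow i y.
Definition down_at i y : Prop := (exists2 j, joins i j y & q j < q i) \/ in_arrow i y.

(** The properties of a resolution graph that make the theorem true: no node
    carries two edges, an edge and an arrow, or arrows of both kinds, there are
    finitely many edges, and a vertex
    has an edge or arrow going up if and only if it has one going down. *)
Record balanced_graph : Prop := {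
  joins_sym : forall i j y, joins i j y -> joins j i y;
  joins_two : forall i j k l y, joins i j y -> joins k l y ->
    (k = i /\ l = j) \/ (k = j /\ l = i);
  joins_in : forall i j k y, joins i j y -> ~ in_arrow k y;
  joins_out : forall i j k y, joins i j y -> ~ out_arrow k y;
  in_out : forall i k y, in_arrow i y -> ~ out_arrow k y;
  up_down : forall i, (exists y, up_at i y) <-> (exists y, down_at i y);
  finite_nodes : exists n (d : 'I_n -> node G), injective d /\
    forall i j y, joins i j y -> exists m, y = d m }.

Hypothesis bal : balanced_graph.

Definition ascending k (v : nat -> vertex G) (e : nat -> node G) : Prop :=
  forall l, (l < k)%N -> positively_oriented (v l) (v l.+1) (e l.+1).

Definition up_chain i k v e : Prop :=
  [/\ v 0%N = i, ascending k v e & out_arrow (v k) (e k.+1)].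
Definition down_chain i k v e : Prop :=
  [/\ v k = i, ascending k v e & in_arrow (v 0%N) (e 0%N)].

(** Induction on the number of vertices of larger quotient: the vertex reached by
    an edge going up has that edge going down, so by balance it can be left
    upwards. *)
Lemma up_chain_exists i y : up_at i y -> exists k v e, up_chain i k v e /\ e 1%N = y /\
  (forall j, joins i j y -> q i < q j -> (0 < k)%N /\ v 1%N = j).
Proof.
have [n] := ubnP #|[pred j | (q i < q j)%R]|; elim: n i y => // n IH i y ni.
case=> [[j ij qij]|out]; last first.
  exists 0%N, (fun=> i), (fun=> y); split; first by split.
  by split=> // j /(joins_out bal)/(_ out).
have [y' upj] : exists y', up_at j y'.
  apply/(up_down bal); exists y; left; exists i => //; exact: joins_sym.
have nj : (#|[pred l | (q j < q l)%R]| < n)%N.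
  move: ni; rewrite ltnS; apply: leq_trans; apply: proper_card; apply/properP; split.
    by apply/fintype.subsetP => l; rewrite !inE; apply: lt_trans.
  by exists j; rewrite !inE ?ltxx.
have [k [v [e [[v0 asc out] _]]]] := IH j y' nj upj.
exists k.+1, (fun l => if l is l'.+1 then v l' else i), (fun l => if l is l'.+2 then e l'.+1 else y).
split; last first.
  split=> // j' ij' qij'; split => //.
  case: (joins_two bal ij ij') => -[_ E0]; first by rewrite v0.
  by move: qij'; rewrite E0 ltxx.
split=> //; case=> [|l] lk; last exact: asc.
by rewrite v0.
Qed.

Lemma down_chain_exists i y : down_at i y -> exists k v e, down_chain i k v e.
Proof.
have [n] := ubnP #|[pred j | (q j < q i)%R]|; elim: n i y => // n IH i y ni.
case=> [[j ij qij]|inn]; last by exists 0%N, (fun=> i), (fun=> y); split.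
have [y' downj] : exists y', down_at j y'.
  apply/(up_down bal); exists y; left; exists i => //; exact: joins_sym.
have nj : (#|[pred l | (q l < q j)%R]| < n)%N.
  move: ni; rewrite ltnS; apply: leq_trans; apply: proper_card; apply/properP; split.
    by apply/fintype.subsetP => l; rewrite !inE => ql; apply: lt_trans qij.
  by exists j; rewrite !inE ?ltxx.
have [k [v [e [vk asc inn]]]] := IH j y' nj downj.
exists k.+1, (fun l => if (l <= k)%N then v l else i), (fun l => if (l <= k)%N then e l else y).
split; rewrite ?ltnn//= => l; rewrite ltnS => lk; rewrite lk.
have [kl|kl] := ltnP l k; first exact: asc.
have -> : l = k by lia.
rewrite vk; split => //; exact: joins_sym.
Qed.

Lemma ascending_lt k v e : ascending k v e ->
  forall l m, (l < m)%N -> (m <= k)%N -> q (v l) < q (v m).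
Proof.
move=> asc l m; elim: m => // m IH; rewrite ltnS leq_eqVlt => /orP[/eqP ->|lm] mk.
  by case: (asc m mk).
by apply: lt_trans (IH lm (ltnW mk)) _; case: (asc m mk).
Qed.

(** Quotients increase strictly along the chain, so no vertex is repeated; a
    repeated node would lie on two distinct edges, or on an edge and an
    arrow. *)
Lemma chain_maximal_arc k v e : in_arrow (v 0%N) (e 0%N) -> ascending k v e ->
  out_arrow (v k) (e k.+1) -> maximal_arc k v e.
Proof.
move=> inn asc out; have mono := ascending_lt asc.
split=> //.
- move=> l l' lk lk' vl; case: (ltngtP l l') => // ll.
    by have := mono _ _ ll lk'; rewrite vl ltxx.
  by have := mono _ _ ll lk; rewrite vl ltxx.
- suff H l l' : (l < l')%N -> (l' <= k.+1)%N -> e l <> e l'.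
    move=> l l' lk lk' el; case: (ltngtP l l') => // ll.
      by case: (H _ _ ll lk').
    by case: (H _ _ ll lk).
  case: l' => // l' ll lk' E0.
  have last : l' = k -> out_arrow (v k) (e l) by move=> lk; rewrite E0 lk.
  case: l ll E0 last => [|l] ll E0 last.
    have [lk|lk] := eqVneq l' k; first by case: (in_out bal inn (last lk)).
    case: (asc l') => [|jo _]; first by lia.
    by apply: (joins_in bal jo); rewrite -E0; exact: inn.
  have [jo _] : positively_oriented (v l) (v l.+1) (e l.+1) by apply: asc; lia.
  have [lk|lk] := eqVneq l' k; first by case: (joins_out bal jo (last lk)).
  have [jo' _] : positively_oriented (v l') (v l'.+1) (e l'.+1) by apply: asc; lia.
  rewrite -E0 in jo'.
  have h1 : q (v l) < q (v l') by apply: mono; lia.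
  have h2 : q (v l.+1) < q (v l'.+1) by apply: mono; lia.
  have h3 : q (v l) < q (v l'.+1) by apply: mono; lia.
  by case: (joins_two bal jo jo') => -[e1 e2]; move: h1 h2 h3; rewrite e1 e2 ?ltxx.
Qed.

Lemma glue_chains i k1 v1 e1 k2 v2 e2 : down_chain i k1 v1 e1 -> up_chain i k2 v2 e2 ->
  exists v e, [/\ maximal_arc (k1 + k2) v e,
    forall l, (l <= k1)%N -> v l = v1 l /\ e l = e1 l,
    forall l, v (k1 + l)%N = v2 l & forall l, e (k1 + l.+1)%N = e2 l.+1].
Proof.
move=> [vk asc1 inn] [v0 asc2 out].
pose v l := if (l <= k1)%N then v1 l else v2 (l - k1)%N.
pose e l := if (l <= k1)%N then e1 l else e2 (l - k1)%N.
have vE l : v (k1 + l)%N = v2 l.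
  rewrite /v; case: l => [|l]; first by rewrite addn0 leqnn vk v0.
  by rewrite addnS ltnNge leq_addr /= -addnS addKn.
have eE l : e (k1 + l.+1)%N = e2 l.+1.
  by rewrite /e addnS ltnNge leq_addr /= -addnS addKn.
have ve1 l : (l <= k1)%N -> v l = v1 l /\ e l = e1 l by rewrite /v /e => ->.
exists v, e; split => //; apply: chain_maximal_arc.
- by rewrite /v /e.
- move=> l lk; have [lk1|lk1] := ltnP l k1.
    have [-> _] := ve1 l (ltnW lk1); have [-> ->] := ve1 l.+1 lk1; exact: asc1.
  have -> : l = (k1 + (l - k1))%N by rewrite subnKC.
  by rewrite -addnS !vE eE; apply: asc2; lia.
- by rewrite vE -addnS eE.
Qed.

Local Notation half := (half_edge R).

Lemma half_edge_arc k v e l y : maximal_arc k v e -> (l <= k)%N -> y = e l \/ y = e l.+1 ->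
  half (v l) y `<=` union_of_arcs R G.
Proof.
move=> arc lk yE x hx; exists k, v, e; split => //; exists l => //.
by case: yE => <-; [left|right].
Qed.

Lemma out_arrow_covered i y : out_arrow i y -> half i y `<=` union_of_arcs R G.
Proof.
move=> out; have up : up_at i y by right.
have [k2 [v2 [e2 [u [e21 _]]]]] := up_chain_exists up.
have [y' /down_chain_exists[k1 [v1 [e1 d]]]] : exists y', down_at i y'.
  by apply/(up_down bal); exists y.
have [v [e [arc _ vE eE]]] := glue_chains d u.
have := half_edge_arc (l := (k1 + 0)%N) (y := y) arc; rewrite vE; case: u => -> _ _.
by apply; [rewrite leq_add2l|right; rewrite -addnS eE e21].
Qed.

Lemma in_arrow_covered i y : in_arrow i y -> half i y `<=` union_of_arcs R G.
Proof.
move=> inn; have d : down_chain i 0 (fun=> i) (fun=> y) by split.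
have [y' /up_chain_exists[k2 [v2 [e2 [u _]]]]] : exists y', up_at i y'.
  by apply/(up_down bal); exists y; right.
have [v [e [arc ve _ _]]] := glue_chains d u.
have [v0 e0] := ve 0%N isT.
have := half_edge_arc (l := 0%N) (y := y) arc (leq0n _); rewrite v0; apply.
by left; rewrite e0.
Qed.

Lemma oriented_edge_covered i j y : joins i j y -> q i != q j ->
  half i y `<=` union_of_arcs R G.
Proof.
have key i' j' : joins i' j' y -> q i' < q j' ->
    half i' y `<=` union_of_arcs R G /\ half j' y `<=` union_of_arcs R G.
  move=> ij qij; have up : up_at i' y by left; exists j'.
  have [k2 [v2 [e2 [u [e21 H]]]]] := up_chain_exists up.
  have [k20 v21] := H _ ij qij.
  have [y' /down_chain_exists[k1 [v1 [e1 d]]]] : exists y', down_at i' y'.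
    by apply/(up_down bal); exists y.
  have [v [e [arc _ vE eE]]] := glue_chains d u.
  split.
    have := half_edge_arc (l := (k1 + 0)%N) (y := y) arc; rewrite vE; case: u => -> _ _.
    by apply; [rewrite leq_add2l|right; rewrite -addnS eE e21].
  have := half_edge_arc (l := (k1 + 1)%N) (y := y) arc; rewrite vE v21.
  by apply; [rewrite leq_add2l|left; rewrite eE e21].
move=> ij; rewrite neq_lt => /orP[lt|lt]; first by case: (key _ _ ij lt).
by case: (key _ _ (joins_sym bal ij) lt).
Qed.

Local Notation point := ({ptws (vertex G + node G)%type -> R}).
Let complement : set point := topological_graph R G `\` union_of_arcs R G.

Lemma complement_point x : complement x ->
  (exists i, x = vertex_point R i) \/
  exists i j y t, [/\ joins i j y, q i = q j &
     x = fun s => (1 - t) * basis_point R (inl i) s + t * basis_point R (inr y) s].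
Proof.
move=> [[[i _ <-]|[[i y] /= inc hx]] nA]; first by left; exists i.
right; case: inc => [[j ij]|inn|out].
- have [t _ xE] := hx; exists i, j, y, t; split => //.
  apply/eqP/negPn/negP => qij; apply: nA; exact: oriented_edge_covered ij qij _ hx.
- by case: nA; exact: in_arrow_covered inn _ hx.
- by case: nA; exact: out_arrow_covered out _ hx.
Qed.

Lemma evaluation_continuous (s : (vertex G + node G)%type) :
  continuous (fun x : point => x s).
Proof.
move=> x; exact: (@proj_continuous {classic (vertex G + node G)%type} (fun=> R) s x).
Qed.

(** The indicator function of the quotient r on the vertices and on the middles of
    the edges that have an end of quotient r, extended linearly; there are
    finitely many edges, so it is continuous. *)
Definition level n (d : 'I_n -> node G) (r : rat) (x : point) : R :=
  \sum_(i | q i == r) x (inl i) +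
  \sum_(m < n | `[< exists i j, joins i j (d m) /\ q i = r >]) x (inr (d m)).

Lemma level_continuous n (d : 'I_n -> node G) r : continuous (level d r).
Proof.
by apply: (@continuous_add R point); apply: (@continuous_sum R point) => i;
  exact: evaluation_continuous.
Qed.

Lemma level_vertex n (d : 'I_n -> node G) r i : level d r (vertex_point R i) = (q i == r)%:R.
Proof.
rewrite /level [X in _ + X]big1 ?addr0; last first.
  by move=> m _; rewrite /vertex_point /basis_point asboolF.
have [qi|qi] := boolP (q i == r).
  rewrite (bigD1 i) //= /vertex_point {1}/basis_point asboolT// big1 ?addr0// => j /andP[_ ji].
  by rewrite /basis_point asboolF// => -[E0]; rewrite E0 eqxx in ji.
rewrite big1// => j qj; rewrite /vertex_point /basis_point asboolF// => -[E0].
by rewrite -E0 qj in qi.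
Qed.

Lemma level_node n (d : 'I_n -> node G) r i j y : injective d -> (exists m, y = d m) ->
  joins i j y -> q i = q j -> level d r (basis_point R (inr y)) = (q i == r)%:R.
Proof.
move=> dinj [m ->] ij qij; rewrite /level big1 ?add0r; last first.
  by move=> l _; rewrite /basis_point asboolF.
have zero l : l != m -> basis_point R (inr (d m)) (inr (d l)) = 0.
  by move=> lm; rewrite /basis_point asboolF// => -[/dinj E0]; rewrite E0 eqxx in lm.
have [qi|qi] := boolP (q i == r).
  rewrite (bigD1 m) /=; last by apply/asboolP; exists i, j; split => //; exact/eqP.
  rewrite {1}/basis_point asboolT// big1 ?addr0// => l /andP[_]; exact: zero.
rewrite big1// => l /asboolP[i' [j' [ij' qi']]].
have [lm|] := eqVneq l m; last exact: zero.
rewrite lm in ij'; exfalso; move/negP: qi; apply.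
by case: (joins_two bal ij ij') => -[E1 _]; [rewrite -E1 qi'|rewrite qij -E1 qi'].
Qed.

(** The two ends of an edge that is not on an arc have the same quotient, so the
    function is constant along it. *)
Lemma level_complement n (d : 'I_n -> node G) r x : injective d ->
  (forall i j y, joins i j y -> exists m, y = d m) ->
  complement x -> level d r x = 0 \/ level d r x = 1.
Proof.
move=> dinj dall /complement_point[[i ->]|[i [j [y [t [ij qij ->]]]]]].
  by rewrite level_vertex; case: (_ == _); [right|left].
have -> : level d r (fun s => (1 - t) * basis_point R (inl i) s + t * basis_point R (inr y) s) =
  (1 - t) * level d r (vertex_point R i) + t * level d r (basis_point R (inr y)).
  rewrite /level !big_split /= -!mulr_sumr; ring.
rewrite level_vertex (level_node _ dinj (dall _ _ _ ij) ij qij).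
by case: (_ == _); [right|left]; rewrite /=; ring.
Qed.

(** On the closure of the complement of the arcs the function [level] is
    continuous with values 0 and 1, so it is constant on connected components;
    at a vertex it tells whether the quotient is r. *)
Lemma balanced_graph_quotients (K : set point) :
  (exists2 x, closure complement x & K = connected_component (closure complement) x) ->
  forall i j, K (vertex_point R i) -> K (vertex_point R j) -> q i = q j.
Proof.
move=> [x0 _ KE] i j Ki Kj; apply/eqP/negPn/negP => qij.
have [n [d [dinj dall]]] := finite_nodes bal.
pose L := level d (q i).
have cL : continuous L := @level_continuous n d (q i).
have conK : connected K by rewrite KE; exact: component_connected.
have K01 x : K x -> L x = 0 \/ L x = 1.
  have cl : closed (L @^-1` ([set 0] `|` [set 1])).
    by apply: preimage_closed => [z _|]; [exact: cL|apply: closedU; exact: closed_eq].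
  rewrite KE => /connected_component_sub clx; apply: cl; apply: closureS clx => z.
  exact: level_complement.
have Li : L (vertex_point R i) = 1 by rewrite /L level_vertex eqxx.
have Lj : L (vertex_point R j) = 0 by rewrite /L level_vertex eq_sym (negbTE qij).
have : K `&` (L @^-1` [set 0]) = K.
  apply: conK.
  - by exists (vertex_point R j).
  - exists (L @^-1` [set t | t < 1/2]).
      by apply: open_comp => [z _|]; [exact: cL|exact: open_lt].
    apply/seteqP; split=> x [Kx] /= Lx; split => //=; first by rewrite Lx; lra.
    by case: (K01 x Kx) Lx => // ->; lra.
  - exists (L @^-1` [set 0]) => //.
    by apply: preimage_closed => [z _|]; [exact: cL|exact: closed_eq].
by move=> E0; move: Ki; rewrite -E0 => -[_ /=]; rewrite Li => /eqP; rewrite oner_eq0.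
Qed.

End Graph.

(** * The resolution graph is balanced *)

Section Balance.
Context {R : realType} {Y : topologicalType}.
Local Notation C := (Cx R).
Local Notation N := modulus.

Section Double.
Variables (A : set (@chart R Y 2)) (I : finType) (E : I -> set Y) (F H : Y -> C).
Hypothesis conf : configuration A E F H.

Lemma double_isolated i y : E i y ->
  \forall z \near y, (exists m l, [/\ m <> l, E m z & E l z]) -> z = y.
Proof.
move=> Ei; have comp := near_components conf y.
have [[j [ij Ej]]|single] := pselect (exists j, i <> j /\ E j y); last first.
  apply: filterS comp => z Hz [m [l [ml Em El]]]; exfalso.
  have im : i = m by apply: contrapT => im; apply: single; exists m; split => //; exact: Hz.
  have il : i = l by apply: contrapT => il; apply: single; exists l; split => //; exact: Hz.
  by apply: ml; rewrite -im -il.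
have [k [a [p [b [q [ad1 ad2 _ two]]]]]] := conf_crossing conf Ei Ej ij.
have [ck ki _ _] := ad1; have [_ kj _ _] := ad2.
have EE : \forall z \near y, E i z -> E j z -> z = y.
  apply/(chart_at_near _ ck).
  apply: filterS (near_and ki (near_row_swap kj)) => x [e1 /= +] => /= e2 /e1 x0.
  rewrite swapK /swap row2E in e2 => /e2 x1.
  by rewrite -(row2_eta x) x0 x1 row2_00; case: ck.
apply: filterS (near_and comp EE) => z [Hz Ez] [m [l [ml Em El]]].
case: (two m (Hz m Em)) => mE; case: (two l (Hz l El)) => lE; subst m l => //.
  exact: Ez.
exact: Ez.
Qed.

(** The crossings are isolated and lie in the compact exceptional curve. *)
Lemma finite_double : finite_set [set y | exists m l, [/\ m <> l, E m y & E l y]].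
Proof.
set D := [set y | _].
have cov : near_covering (\bigcup_i E i).
  by apply/compact_near_coveringP; exact: (conf_compact conf).
(* Finite sequences ordered by inclusion, to use compactness in the form of
   near coverings. *)
pose large : set_system (seq Y) := 
  [set S : set (seq Y) | exists s0 : seq Y, forall s : seq Y, {subset s0 <= s} -> S s].
have large_filter : Filter large.
  split.
  - by exists [::].
  - move=> S T [s hs] [t ht]; exists (s ++ t) => u su; split.
      by apply: hs => z zs; apply: su; rewrite mem_cat zs.
    by apply: ht => z zt; apply: su; rewrite mem_cat zt orbT.
  - by move=> S T ST [s hs]; exists s => u /hs /ST.
have [|s0 Hs0] := cov (seq Y) large (fun (s : seq Y) z => D z -> z \in s) large_filter.
  move=> y [i _ Ei].
  exists ([set z | D z -> z = y], [set s : seq Y | y \in s]) => /=.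
    split; first exact: (double_isolated Ei).
    by exists [:: y] => s; apply; rewrite mem_head.
  by move=> [z s] [/= zD ys] Dz; rewrite (zD Dz).
apply: sub_finite_set (finite_seq s0) => y Dy /=.
have [m [l [ml Em El]]] := Dy.
by apply: (Hs0 s0 _ y) => //; exists m.
Qed.

Variable c : I -> C -> Y.
Hypothesis curv : forall i, curvetta A [set z | F z * H z = 0] (E i) (c i).
Let Exc := \bigcup_i E i.
Let G := resolution_graph Exc E F H c.
Let al i := order_on F (c i).
Let be i := order_on H (c i).

Lemma curvetta_orders i : [/\ E i (c i 0), (0 < al i)%N, (0 < be i)%N &
  power_comparable F H (al i) (be i) (c i 0)].
Proof.
have Ei : E i (c i 0).
  have [cc cco [_ Ec _ _ _]] := curv i; apply/(nbhs_singleton Ec).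
  by case: cco => _ _ -> _; rewrite mxE.
by apply: (curvetta_comparable (conf_manifold conf) (conf_holF conf Ei) (conf_holH conf Ei));
  [exact: curv|exact: (conf_zeroF conf Ei)|exact: (conf_zeroH conf Ei)].
Qed.

(** The orders of F and H on the curvetta of E i are in the same ratio as their
    orders along E i at any point. *)
Lemma adapted_orders i y k a b p q : E i y -> adapted F H (E i) y k a b p q ->
  (a * be i = b * al i)%N.
Proof.
have [Ei _ _ ci] := curvetta_orders i.
apply: comparable_exponents ci y k a b p q => //.
- exact: (conf_connected conf).
- by move=> y; exact: (conf_adapted conf).
Qed.

Lemma quotient_lt i j : (@quotient_of G i < @quotient_of G j) = (al i * be j < al j * be i)%N.
Proof.
have [_ _ bi _] := curvetta_orders i; have [_ _ bj _] := curvetta_orders j.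
rewrite /= -/(al i) -/(al j) -/(be i) -/(be j).
rewrite ltr_pdivrMr ?ltr0n// mulrAC ltr_pdivlMr ?ltr0n//.
by rewrite -!natrM ltr_nat.
Qed.

Lemma not_strict_transform (h : Y -> C) y : (forall z, h z = 0 -> F z * H z = 0) ->
  (\forall z \near y, F z * H z = 0 -> Exc z) -> ~ strict_transform Exc h y.
Proof. by move=> hT near_y /(_ _ near_y)[z [[hz nz] Tz]]; apply: nz; exact/Tz/hT. Qed.

Lemma F_zero z : F z = 0 -> F z * H z = 0.
Proof. by move=> ->; rewrite mul0r. Qed.
Lemma H_zero z : H z = 0 -> F z * H z = 0.
Proof. by move=> ->; rewrite mulr0. Qed.

(** At a crossing with E j the exponents of v are the orders along E j, so
    p be_j = q al_j, and the sign of p be_i - q al_i is that of q_j - q_i.  At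
    another point the function v is absent, or occurs in F alone or in H alone,
    and the point carries no arrow, a going-out or a going-in arrow. *)
Lemma local_directions i y : E i y -> exists k a b p q,
  [/\ adapted F H (E i) y k a b p q,
      up_at (G := G) i y <-> (q * al i < p * be i)%N &
      down_at (G := G) i y <-> (p * be i < q * al i)%N].
Proof.
move=> Ei; have [_ ai bi _] := curvetta_orders i.
have [[j [ij Ej]]|single] := pselect (exists j, i <> j /\ E j y).
  have [k [a [p [b [q [ad1 ad2 T two]]]]]] := conf_crossing conf Ei Ej ij.
  have [_ aj bj _] := curvetta_orders j.
  have [p0 q0] := adapted_pos conf ad2.
  have pq := adapted_orders Ej ad2.
  have nF := not_strict_transform F_zero T.
  have nH := not_strict_transform H_zero T.
  have uniq j' : [/\ i <> j', E i y & E j' y] -> j' = j.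
    by move=> [ij' _ Ej']; case: (two j' Ej') => // E0; case: ij'.
  exists k, a, b, p, q; split => //.
  - split=> [[[j' /uniq ->]|[_ st]]|lt].
    + rewrite quotient_lt => lt.
      have : (al i * be j * p < al j * be i * p)%N by rewrite ltn_pmul2r.
      have -> : (al i * be j * p = q * al i * al j)%N by rewrite -mulnA (mulnC (be j)) pq; lia.
      have -> : (al j * be i * p = p * be i * al j)%N by lia.
      by rewrite ltn_pmul2r.
    + by case: nF.
    + left; exists j => //; rewrite quotient_lt -(ltn_pmul2r p0).
      have -> : (al i * be j * p = q * al i * al j)%N by rewrite -mulnA (mulnC (be j)) pq; lia.
      have -> : (al j * be i * p = p * be i * al j)%N by lia.
      by rewrite ltn_pmul2r.
  - split=> [[[j' /uniq ->]|[_ st]]|lt].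
    + rewrite quotient_lt => lt.
      have : (al j * be i * p < al i * be j * p)%N by rewrite ltn_pmul2r.
      have -> : (al i * be j * p = q * al i * al j)%N by rewrite -mulnA (mulnC (be j)) pq; lia.
      have -> : (al j * be i * p = p * be i * al j)%N by lia.
      by rewrite ltn_pmul2r.
    + by case: nH.
    + left; exists j => //; rewrite quotient_lt -(ltn_pmul2r p0).
      have -> : (al i * be j * p = q * al i * al j)%N by rewrite -mulnA (mulnC (be j)) pq; lia.
      have -> : (al j * be i * p = p * be i * al j)%N by lia.
      by rewrite ltn_pmul2r.
have {}single j : E j y -> j = i.
  by move=> Ej; apply: contrapT => ji; apply: single; exists j; split => // ij; apply: ji.
have [k [a [p [b [q [ad sF sH pq]]]]]] := conf_single conf Ei single.
exists k, a, b, p, q; split => //.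
- split=> [[[j' [ij' _ /single //]]|[_ /sF p0]]|lt].
  + by move=> E0; case: ij'.
  + by case: pq => E0; [rewrite E0 in p0|rewrite E0 mul0n muln_gt0 p0].
  + right; split => //; apply/sF; case: p lt {ad sF pq} => //.
- split=> [[[j' [ij' _ /single //]]|[_ /sH q0]]|lt].
  + by move=> E0; case: ij'.
  + by case: pq => E0; [rewrite E0 mul0n muln_gt0 q0|rewrite E0 in q0].
  + right; split => //; apply/sH; case: q lt {ad sH pq} => //.
Qed.

Lemma adapted_sym i y k a b p q : adapted F H (E i) y k a b p q ->
  adapted H F (E i) y k b a q p.
Proof. by case. Qed.

Lemma up_incident i y : up_at (G := G) i y -> E i y.
Proof. by case=> [[j [_ +]]|[+]]. Qed.
Lemma down_incident i y : down_at (G := G) i y -> E i y.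
Proof. by case=> [[j [_ +]]|[+]]. Qed.

(** [no_pole_no_zero] for F^be / H^al and for its inverse. *)
Lemma up_iff_down i : (exists y, up_at (G := G) i y) <-> (exists y, down_at (G := G) i y).
Proof.
split=> -[y Hy]; apply: contrapT => none.
- have Ei := up_incident Hy.
  have [k [a [b [p [q [ad up _]]]]]] := local_directions Ei.
  have lt := proj1 up Hy.
  have : (q * al i = p * be i)%N.
    apply: (no_pole_no_zero (@conf_compact1 _ _ _ _ _ _ _ conf i)
      (@conf_connected _ _ _ _ _ _ _ conf i) _ Ei ad (adapted_orders Ei ad) (ltnW lt)).
    move=> z Ez; have [k' [a' [b' [p' [q' [ad' _ down]]]]]] := local_directions Ez.
    exists k', a', b', p', q'; split => //; first exact: adapted_orders Ez ad'.
    by rewrite leqNgt; apply/negP => /down dz; apply: none; exists z.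
  by move=> E0; rewrite E0 ltnn in lt.
- have Ei := down_incident Hy.
  have [k [a [b [p [q [ad _ down]]]]]] := local_directions Ei.
  have lt := proj1 down Hy.
  have : (p * be i = q * al i)%N.
    apply: (no_pole_no_zero (@conf_compact1 _ _ _ _ _ _ _ conf i)
      (@conf_connected _ _ _ _ _ _ _ conf i) _ Ei (adapted_sym ad)
      (esym (adapted_orders Ei ad)) (ltnW lt)).
    move=> z Ez; have [k' [a' [b' [p' [q' [ad' up _]]]]]] := local_directions Ez.
    exists k', b', a', q', p'; split => //; first exact: adapted_sym.
      by apply/esym; exact: adapted_orders Ez ad'.
    by rewrite leqNgt; apply/negP => /up dz; apply: none; exists z.
  by move=> E0; rewrite E0 ltnn in lt.
Qed.

Lemma resolution_graph_balanced : balanced_graph G.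
Proof.
have crossing i j y : joins (d := G) i j y -> (forall m, E m y -> m = i \/ m = j) /\
    ~ strict_transform Exc F y /\ ~ strict_transform Exc H y.
  move=> [ij Ei Ej]; have [k [a [p [b [q [_ _ T two]]]]]] := conf_crossing conf Ei Ej ij.
  by split => //; split; [exact: not_strict_transform F_zero T|exact: not_strict_transform H_zero T].
split.
- by move=> i j y [ij Ei Ej]; split => // E0; apply: ij.
- move=> i j k l y /crossing[two _] [kl Ek El].
  case: (two k Ek) => Ek'; case: (two l El) => El'; subst k l;
    [by case: kl|by left|by right|by case: kl].
- by move=> i j k y /crossing[_ [_ +]] [_].
- by move=> i j k y /crossing[_ [+ _]] [_].
- move=> i k y [Ei sH] [Ek sF].
  have [[j [ij Ej]]|single] := pselect (exists j, i <> j /\ E j y).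
    by have [_ [nF _]] : _ /\ _ := crossing i j y (And3 ij Ei Ej).
  have {}single j : E j y -> j = i.
    by move=> Ej; apply: contrapT => ji; apply: single; exists j; split => // ij; apply: ji.
  have [k' [a [p [b [q [_ hF hH [p0|q0]]]]]]] := conf_single conf Ei single.
    by move/hF: sF; rewrite p0.
  by move/hH: sH; rewrite q0.
- exact: up_iff_down.
- have /finite_seqP[s sE] := finite_double.
  exists (size (undup s)), (tnth (in_tuple (undup s))); split.
    by apply/tuple_uniqP; exact: undup_uniq.
  move=> i j y [ij Ei Ej]; have : y \in undup s.
    by rewrite mem_undup; have : [set` s] y; [rewrite -sE; exists i, j|].
  by move=> /(tnthP (in_tuple (undup s))).
Qed.

End Double.

End Balance.

Theorem mainTheorem2 (R : realType)
  (N : nat) (X : set 'rV[Cx R]_N) (p : 'rV[Cx R]_N)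
  (X_irr : irreducible_germ X p) (X_surf : surface_germ X p)
  (f g : 'rV[Cx R]_N -> Cx R)
  (phi_fin : finite_morphism X p (pair_map f g) setT 0)
  (M : nat) (Xb : set 'rV[Cx R]_M) (pb : 'rV[Cx R]_M)
  (nu : 'rV[Cx R]_M -> 'rV[Cx R]_N) (nu_norm : normalization Xb pb nu X p)
  (Y : topologicalType) (A : set (@chart R Y 2)) (Y_surf : complex_manifold A)
  (Rb : Y -> 'rV[Cx R]_M) (I : finType) (E : I -> set Y)
  (Rb_good : good_resolution A Rb Xb pb (f \o nu) (g \o nu) E)
  (c : I -> Cx R -> Y)
  (c_curv : forall i,
     curvetta A [set z | f (nu (Rb z)) * g (nu (Rb z)) = 0] (E i) (c i)) :
  let G := resolution_graph (exceptional Rb pb) E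
             (f \o nu \o Rb) (g \o nu \o Rb) c in
  let complement := topological_graph R G `\` union_of_arcs R G in
  (forall K, (exists2 x, closure complement x &
                K = connected_component (closure complement) x) ->
     forall i j : vertex G, K (vertex_point R i) -> K (vertex_point R j) ->
       quotient_of i = quotient_of j) /\
  (forall (i : vertex G) (y : node G), in_arrow i y \/ out_arrow i y ->
     half_edge R i y `&` complement = set0).

Proof.
have [EE conf] := resolution_configuration (proj1 X_surf) phi_fin nu_norm Y_surf Rb_good.
have curv i : curvetta A [set z | (f \o nu \o Rb) z * (g \o nu \o Rb) z = 0] (E i) (c i).
  exact: c_curv.
have bal := resolution_graph_balanced conf curv; rewrite -EE in bal.
split; first exact: (balanced_graph_quotients bal).
move=> i y ar; apply/seteqP; split=> // x [hx [_ nA]]; apply: nA.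
by case: ar => ar; [exact: (in_arrow_covered bal ar hx)|exact: (out_arrow_covered bal ar hx)].
Qed.
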